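(* Assume (a)–(c) of the context, and let $U_0=(U_{0I},U_{0II})\in\mathcal U$. Assume that, with all matrices evaluated at $U_0$, $$\sigma\big(B_{22}^{-1}(A_{22}-A_{21}A_{11}^{-1}A_{12})\big)\cap \big(2i\pi\mathbb Z\setminus\{0\}\big)=\emptyset .$$ Then there exist $\delta>0$ and $\varepsilon>0$ such that for any $U_{1II}\in\mathbb R^{n-r}$ with $|U_{0II}-U_{1II}|\le\delta$ there exists a unique solution $\hat U$ of $$ (f(\hat U))_x=(B(\hat U)\hat U_x)_x\ \ (0<x<1),\qquad \hat U(0)=U_0,\qquad \hat U_{II}(1)=U_{1II}, $$ satisfying $|\hat U_{II}'(0)|\le\varepsilon$. Moreover, this solution is nondegenerate, i.e. it corresponds to a root $C_2$ of the map $\Psi$ of the context at which $d\Psi(C_2)$ is invertible.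
   Context: Setting. $\mathcal U\subset\mathbb R^n$ is an open set of states $U=(U_I,U_{II})\in\mathbb R^r\times\mathbb R^{n-r}$. The steady problem above is that of $\partial_t f^0(U)+f(U)_x=(B(U)U_x)_x$ on $0<x<1$. Here $f^0=(f^0_I,f^0_{II})$ and $f=(f_I,f_{II})$ take values in $\mathbb R^r\times\mathbb R^{n-r}$, $B=\begin{pmatrix} 0 & 0 \\ 0 & B_{22} \end{pmatrix}$ with $B_{22}(U)\in M_{n-r}(\mathbb R)$. Write $A^0=df^0=\begin{pmatrix} \mathrm{Id}_r & 0 \\ A^0_{21} & A^0_{22} \end{pmatrix}$ (invertible, with $\det A^0_{22}>0$) and $A=df=\begin{pmatrix} A_{11} & A_{12} \\ A_{21} & A_{22} \end{pmatrix}$ with $A_{11}\in M_r(\mathbb R)$. Assumptions, for every $U\in\mathcal U$: (a) $f^0$, $f$, $B$ are smooth. (b) $(A^0_{22})^{-1}B_{22}+((A^0_{22})^{-1}B_{22})^T$ has positive eigenvalues (so $B_{22}$ is invertible). (c) The eigenvalues of $A_{11}(U)=(df_I)_I(U)$ are real and positive. The map $\Psi$. For fixed $U_0$, $U_{1II}$, and $C_2\in\mathbb R^{n-r}$, let $U$ be the maximal solution with $U(0)=U_0$ of $$B_{22}(U)U_{II}'=f_{II}(U)-f_{II}(U_0)+B_{22}(U_0)C_2,\qquad f_I(U)=f_I(U_0).$$ $\Psi$ is defined on the set of $C_2$ for which $U$ is defined on $[0,1]$, by $\Psi(C_2)=U_{II}(1)-U_{1II}$. Steady solutions correspond to roots $C_2=\hat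 U_{II}'(0)$ of $\Psi$. *)

(* Defs.v *)
From HB Require Import structures.
From mathcomp Require Import all_boot all_order all_algebra.
From mathcomp Require Import all_classical all_reals all_analysis.
From mathcomp Require Export complex.

Set Implicit Arguments.
Unset Strict Implicit.
Unset Printing Implicit Defensive.

Import Order.TTheory GRing.Theory Num.Theory.
Import numFieldNormedType.Exports.

Local Open Scope classical_set_scope.
Local Open Scope ring_scope.

(* Iterated directional derivatives: in finite dimension, [Ck k D f] for open
   [D] is the usual C^k regularity. *)
Fixpoint Ck (R : realType) (V W : normedModType R) (k : nat)
    (D : set V) (f : V -> W) : Prop :=
  match k with
  | 0 => forall x, D x -> {for x, continuous f}
  | k'.+1 => (forall x, D x -> differentiable f x) /\
             (forall v : V, Ck k' D (fun x => 'D_v f x))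
  end.

Definition smooth_on (R : realType) (V W : normedModType R)
    (D : set V) (f : V -> W) : Prop := forall k, Ck k D f.

(* The library's [jacobian] is for row vectors and is the transpose of the
   usual matrix; here entry (i, j) is the j-th partial derivative of f_i. *)
Definition jac (R : realType) (p q : nat) (f : 'cV[R]_p -> 'cV[R]_q)
    (x : 'cV[R]_p) : 'M[R]_(q, p) :=
  \matrix_(i, j) ('D_(delta_mx j 0) f x) i 0.

(* Euclidean norm; the library norm on matrices is the sup norm. *)
Definition enorm (R : realType) (p : nat) (v : 'cV[R]_p) : R :=
  Num.sqrt (\sum_i v i 0 ^+ 2).

Definition spectrum (R : realType) (p : nat) (M : 'M[R]_p) : set R[i] :=
  [set z | eigenvalue (map_mx (real_complex R) M) z].

Definition is_derive_in (R : realType) (V : normedModType R) (J : set R)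
    (u : R -> V) (x : R) (v : V) : Prop :=
  (y - x)^-1 *: (u y - u x) @[y --> within J x^'] --> v.

(* A state is U = (U_I, U_II) with U_I = usubmx U and U_II = dsubmx U. *)
Definition diffusion (R : realType) (r m : nat)
    (B22 : 'cV[R]_(r + m) -> 'M[R]_m) (U : 'cV[R]_(r + m)) : 'M[R]_(r + m) :=
  block_mx 0 0 0 (B22 U).

(* Classical solutions of (f(u))_x = (B(u) u_x)_x with the mixed boundary
   conditions. No regularity up to the boundary beyond continuity is imposed. *)
Definition steady_solution (R : realType) (r m : nat)
    (D : set 'cV[R]_(r + m)) (f : 'cV[R]_(r + m) -> 'cV[R]_(r + m))
    (B22 : 'cV[R]_(r + m) -> 'M[R]_m)
    (U0 : 'cV[R]_(r + m)) (U1II : 'cV[R]_m) (u : R -> 'cV[R]_(r + m)) : Prop :=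
  let viscous_flux := fun x : R => diffusion B22 (u x) *m derive1 u x in
  [/\ {within `[0, 1], continuous u},
      forall x : R, 0 <= x <= 1 -> D (u x),
      forall x : R, 0 < x < 1 ->
        [/\ derivable u x 1,
            derivable (f \o u) x 1,
            derivable viscous_flux x 1 &
            derive1 (f \o u) x = derive1 viscous_flux x],
      u 0 = U0 &
      dsubmx (u 1) = U1II].

(* Solutions, on an interval J containing 0, of the differential-algebraic
   Cauchy problem with parameter C2:
     B_22(u) u_II' = f_II(u) - f_II(U0) + B_22(U0) C2,  f_I(u) = f_I(U0),
   with u(0) = U0; the derivative is one-sided at the endpoints of J. *)
Definition cauchy_solution (R : realType) (r m : nat)
    (D : set 'cV[R]_(r + m)) (f : 'cV[R]_(r + m) -> 'cV[R]_(r + m))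
    (B22 : 'cV[R]_(r + m) -> 'M[R]_m) (U0 : 'cV[R]_(r + m)) (C2 : 'cV[R]_m)
    (J : set R) (u : R -> 'cV[R]_(r + m)) : Prop :=
  [/\ is_interval J /\ J 0,
      {within J, continuous u},
      forall x, J x -> D (u x),
      forall x, J x ->
        usubmx (f (u x)) = usubmx (f U0) /\
        exists2 v : 'cV[R]_m, is_derive_in J (fun y => dsubmx (u y)) x v &
          B22 (u x) *m v =
            dsubmx (f (u x)) - dsubmx (f U0) + B22 U0 *m C2 &
      u 0 = U0].

Definition maximal_solution (R : realType) (r m : nat)
    (D : set 'cV[R]_(r + m)) (f : 'cV[R]_(r + m) -> 'cV[R]_(r + m))
    (B22 : 'cV[R]_(r + m) -> 'M[R]_m) (U0 : 'cV[R]_(r + m)) (C2 : 'cV[R]_m)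
    (J : set R) (u : R -> 'cV[R]_(r + m)) : Prop :=
  cauchy_solution D f B22 U0 C2 J u /\
  forall (J' : set R) (u' : R -> 'cV[R]_(r + m)),
    cauchy_solution D f B22 U0 C2 J' u' ->
    J `<=` J' -> (forall x, J x -> u' x = u x) -> J' = J.

Definition Psi_dom (R : realType) (r m : nat)
    (D : set 'cV[R]_(r + m)) (f : 'cV[R]_(r + m) -> 'cV[R]_(r + m))
    (B22 : 'cV[R]_(r + m) -> 'M[R]_m) (U0 : 'cV[R]_(r + m)) : set 'cV[R]_m :=
  [set C2 | exists (J : set R) (u : R -> 'cV[R]_(r + m)),
     maximal_solution D f B22 U0 C2 J u /\ `[0, 1] `<=` J].

(* The value is meaningful for C2 in [Psi_dom] only; the maximal solution being
   unique, the set below is then a singleton. *)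
Definition Psi (R : realType) (r m : nat)
    (D : set 'cV[R]_(r + m)) (f : 'cV[R]_(r + m) -> 'cV[R]_(r + m))
    (B22 : 'cV[R]_(r + m) -> 'M[R]_m) (U0 : 'cV[R]_(r + m)) (U1II : 'cV[R]_m)
    (C2 : 'cV[R]_m) : 'cV[R]_m :=
  get [set w | exists (J : set R) (u : R -> 'cV[R]_(r + m)),
    [/\ maximal_solution D f B22 U0 C2 J u, `[0, 1] `<=` J &
        w = dsubmx (u 1) - U1II]].

(* [uhat] corresponds to the root C2 = uhat_II'(0) of Psi, and dPsi(C2), which
   makes sense because C2 is interior to the domain of Psi, is invertible. *)
Definition nondegenerate_solution (R : realType) (r m : nat)
    (D : set 'cV[R]_(r + m)) (f : 'cV[R]_(r + m) -> 'cV[R]_(r + m))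
    (B22 : 'cV[R]_(r + m) -> 'M[R]_m) (U0 : 'cV[R]_(r + m)) (U1II : 'cV[R]_m)
    (uhat : R -> 'cV[R]_(r + m)) : Prop :=
  exists C2 : 'cV[R]_m,
    [/\ is_derive_in `[0, 1] (fun x => dsubmx (uhat x)) 0 C2,
        exists (J : set R) (u : R -> 'cV[R]_(r + m)),
          [/\ maximal_solution D f B22 U0 C2 J u, `[0, 1] `<=` J &
              forall x : R, 0 <= x <= 1 -> u x = uhat x],
        interior (Psi_dom D f B22 U0) C2,
        Psi D f B22 U0 U1II C2 = 0 &
        differentiable (Psi D f B22 U0 U1II) C2 /\
        jac (Psi D f B22 U0 U1II) C2 \in unitmx].

(* Main.v *)
(** Differentiating [f_I(U) = f_I(U0)] turns the differential-algebraic Cauchy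
    problem into an autonomous equation [y' = F(y)] for [y = (U, C2)], where [F]
    is smooth near [(U0, 0)] and vanishes there. Its time-one map is strictly
    differentiable at [(U0, 0)]; the derivative of [C2 |-> U_II(1)] at [C2 = 0]
    is [Phi(1)], where [Phi' = M Phi + 1], [Phi(0) = 0] and
    [M = B22^-1 (A22 - A21 A11^-1 A12)]. Formally [Phi(1) = (e^M - 1) / M], which
    is singular only if [M] has an eigenvalue in [2 i pi Z] other than [0]. Since
    [C2 |-> U_II(1) - Phi(1) C2] is Lipschitz with a small constant near [0], a
    contraction solves [Psi(C2) = 0] uniquely, and [dPsi] remains invertible.
    Conversely, a steady solution solves the Cauchy problem with
    [C2 = U_II'(0)], and this problem has a unique solution on [[0, 1]]. *)

Require Import Defs.
From HB Require Import structures.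
From mathcomp Require Import all_boot all_order all_algebra.
From mathcomp Require Import all_classical all_reals all_analysis.
From mathcomp Require Import sesquilinear spectral.
From mathcomp Require Import ring lra.

Set Implicit Arguments.
Unset Strict Implicit.
Unset Printing Implicit Defensive.

Import Order.TTheory GRing.Theory Num.Theory.
Import numFieldNormedType.Exports.

Local Open Scope classical_set_scope.
Local Open Scope ring_scope.

(** * Norms and derivatives of matrix-valued functions *)

Section MatrixNorm.
Context {R : realType}.

(** Two features of the Cauchy problem shape the uniqueness argument. A Cauchy solution provides a
    derivative of [U_II] only; a quantitative injectivity estimate on the level sets of [f_I] bounds
    the distance of two states by that of their second components and closes a Gronwall argument for
    the latter. Moreover nothing confines a competitor to a neighbourhood of [U0]; a continuity
    argument traps it, because agreement with the reference solution halves the bound it satisfies.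
    The flow estimate is a quadratic remainder that is uniform in its base point: based at [0] it
    drives the contraction, based at the root it differentiates [Psi], and comparing the two gives
    invertibility there. No matrix exponential appears. A singular [Phi(1)] has a left kernel stable
    under [M], hence a complex eigenvector of [M] in it, and one scalar equation, split into real
    and imaginary parts, remains. [Psi] refers to maximal solutions. Zorn's lemma supplies them, and
    uniqueness on [0, 1] makes the value independent of the choice. *)

Lemma mx_entry_le_norm p q (A : 'M[R]_(p, q)) i j : `|A i j| <= `|A|.
Proof.
by rewrite [leRHS]/Num.Def.normr/= mx_normrE; exact: (le_bigmax _ _ (i, j)).
Qed.

Lemma mx_norm_leP p q (A : 'M[R]_(p, q)) (M : R) : 0 <= M ->
  (forall i j, `|A i j| <= M) -> `|A| <= M.
Proof.
move=> M0 AM; rewrite [leLHS]/Num.Def.normr/= mx_normrE.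
by apply: bigmax_le => //= -[i j] _; exact: AM.
Qed.

(** The sup norm is not submultiplicative; the factor counts the terms in one entry of the
    product. *)
Lemma norm_mulmx_le p q s (A : 'M[R]_(p, q)) (B : 'M[R]_(q, s)) :
  `|A *m B| <= q%:R * `|A| * `|B|.
Proof.
apply: mx_norm_leP => [|i j]; first by rewrite !mulr_ge0.
rewrite mxE; apply: le_trans (ler_norm_sum _ _ _) _.
apply: (@le_trans _ _ (\sum_(k < q) `|A| * `|B|)); last first.
  by rewrite sumr_const card_ord -[X in X <= _]mulr_natl mulrA.
by apply: ler_sum => k _; rewrite normrM ler_pM ?mx_entry_le_norm.
Qed.

Lemma norm_mulmx_le2 p q s (A : 'M[R]_(p, q)) (B : 'M[R]_(q, s)) (a b : R) :
  `|A| <= a -> `|B| <= b -> `|A *m B| <= q%:R * a * b.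
Proof.
move=> Aa Bb; apply: le_trans (norm_mulmx_le A B) _.
by rewrite -!mulrA ler_wpM2l// ler_pM.
Qed.

Lemma norm_col_mx p q s (A : 'M[R]_(p, s)) (B : 'M[R]_(q, s)) :
  `|col_mx A B| = Num.max `|A| `|B|.
Proof.
apply/eqP; rewrite eq_le; apply/andP; split.
  apply: mx_norm_leP => [|i j]; first by rewrite le_max normr_ge0.
  rewrite mxE; case: splitP => k _; rewrite le_max mx_entry_le_norm ?orbT//.
rewrite ge_max; apply/andP; split; apply: mx_norm_leP => // i j.
  by rewrite -(col_mxEu A B) mx_entry_le_norm.
by rewrite -(col_mxEd A B) mx_entry_le_norm.
Qed.

Lemma cvg_mxP (T : Type) (F : set_system T) {FF : Filter F} p q
  (u : T -> 'M[R]_(p, q)) (l : 'M[R]_(p, q)) :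
  (u x @[x --> F] --> l) <-> forall i j, u x i j @[x --> F] --> l i j.
Proof.
split=> [ul i j|ul].
  exact: (cvg_comp _ _ ul (@coord_continuous _ _ _ i j l)).
apply/cvgrPdist_le => /= e e0.
have : \forall x \near F, forall ij : 'I_p * 'I_q,
    `|l ij.1 ij.2 - u x ij.1 ij.2| <= e.
  by apply: filter_forall => -[i j]; exact: ((cvgrPdist_le _ _).1 (ul i j)).
apply: filterS => x H; apply: mx_norm_leP => [|i j]; first exact: ltW.
by rewrite !mxE; exact: (H (i, j)).
Qed.

Lemma continuous_mxP (T : topologicalType) p q (u : T -> 'M[R]_(p, q)) x :
  {for x, continuous u} <-> forall i j, {for x, continuous (fun y => u y i j)}.
Proof. exact: cvg_mxP. Qed.

Lemma is_derive_mxP (V : normedModType R) p q (u : V -> 'M[R]_(p, q)) x v w :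
  is_derive x v u w <-> forall i j, is_derive x v (fun y => u y i j) (w i j).
Proof.
split=> [[ud uw] i j|uw].
  apply: DeriveDef; first exact: (derivable_mxP _ _ _).1 ud i j.
  by rewrite -uw derive_mx// mxE.
have ud : derivable u x v.
  by apply/derivable_mxP => i j; exact: (@ex_derive _ _ _ _ _ _ _ (uw i j)).
apply: DeriveDef => //; rewrite derive_mx//; apply/matrixP => i j.
by rewrite mxE; exact: (@derive_val _ _ _ _ _ _ _ (uw i j)).
Qed.

Lemma is_derive_continuous (W : normedModType R) (u : R -> W) (x : R) v :
  is_derive x 1 u v -> {for x, continuous u}.
Proof.
move=> uv; apply/differentiable_continuous/derivable1_diffP.
exact: (@ex_derive _ _ _ _ _ _ _ uv).
Qed.

Lemma is_derive_mulmxl p q s (A : 'M[R]_(p, q)) (u : R -> 'M[R]_(q, s)) (x : R) v :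
  is_derive x 1 u v -> is_derive x 1 (fun y => A *m u y) (A *m v).
Proof.
move=> /is_derive_mxP uv; apply/is_derive_mxP => i j; rewrite mxE.
under [X in is_derive _ _ X _]eq_fun do rewrite mxE.
rewrite (_ : (fun y => _) = \sum_k (fun y => A i k * u y k j)); last first.
  by apply/funext => y; rewrite fct_sumE.
by apply: is_derive_sum => k; exact: is_deriveZ.
Qed.

Lemma is_derive_mulmxr p q s (A : 'M[R]_(q, s)) (u : R -> 'M[R]_(p, q)) (x : R) v :
  is_derive x 1 u v -> is_derive x 1 (fun y => u y *m A) (v *m A).
Proof.
move=> /is_derive_mxP uv; apply/is_derive_mxP => i j; rewrite mxE.
under [X in is_derive _ _ X _]eq_fun do rewrite mxE.
rewrite (_ : (fun y => _) = \sum_k (fun y => A k j * u y i k)); last first.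
  by apply/funext => y; rewrite fct_sumE; apply: eq_bigr => k _; rewrite mulrC.
rewrite (_ : \sum_k _ = \sum_k (A k j * v i k)); last first.
  by apply: eq_bigr => k _; rewrite mulrC.
by apply: is_derive_sum => k; exact: is_deriveZ.
Qed.

End MatrixNorm.

(** * Mean value inequalities, antiderivatives and geometric sequences *)

Section OneVariable.
Context {R : realType}.

Lemma within_continuousB (W : normedModType R) (A : set R) (f g : R -> W) :
  {within A, continuous f} -> {within A, continuous g} ->
  {within A, continuous (fun x => f x - g x)}.
Proof. by move=> cf cg x; apply: cvgB; [exact: cf|exact: cg]. Qed.

Lemma within_continuous_norm (W : normedModType R) (A : set R) (f : R -> W) :
  {within A, continuous f} -> {within A, continuous (fun x => `|f x|)}.
Proof. by move=> cf x; apply: cvg_norm; exact: cf. Qed.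

Lemma is_derive_cmull (c : R) (f : R -> R) (x df : R) :
  is_derive x 1 f df -> is_derive x 1 (fun y => c * f y) (c * df).
Proof. by move=> h; exact: (is_deriveZ c h). Qed.

Lemma is_derive_subl (W : normedModType R) (f g : R -> W) (x : R) (df dg : W) :
  is_derive x 1 f df -> is_derive x 1 g dg ->
  is_derive x 1 (fun y => f y - g y) (df - dg).
Proof. by move=> hf hg; exact: (is_deriveB hf hg). Qed.

(** This is the mean value theorem for [g - f]. Derivatives are asked for in the open interval only,
    to suit solutions that are merely continuous at the endpoints. *)
Lemma ler_derive (f g df dg : R -> R) (a b : R) : a <= b ->
  {within `[a, b], continuous f} -> {within `[a, b], continuous g} ->
  (forall x, a < x < b -> is_derive x 1 f (df x)) ->
  (forall x, a < x < b -> is_derive x 1 g (dg x)) ->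
  (forall x, a < x < b -> df x <= dg x) ->
  f b - f a <= g b - g a.
Proof.
rewrite le_eqVlt => /orP[/eqP -> _ _ _ _ _|ab cf cg hf hg le]; first by rewrite !subrr.
have hgf x : x \in `]a, b[%R -> is_derive x 1 (fun x => g x - f x) (dg x - df x).
  by rewrite in_itv/= => xab; exact: is_derive_subl (hg x xab) (hf x xab).
have cgf := within_continuousB cg cf.
have [c cab] := MVT ab hgf cgf; rewrite -subr_ge0 => E.
suff -> : g b - g a - (f b - f a) = (dg c - df c) * (b - a).
  rewrite in_itv/= in cab.
  by rewrite mulr_ge0 ?subr_ge0 ?le// ltW.
by rewrite -E; ring.
Qed.

Lemma abs_ler_derive (f g df dg : R -> R) (a b : R) : a <= b ->
  {within `[a, b], continuous f} -> {within `[a, b], continuous g} ->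
  (forall x, a < x < b -> is_derive x 1 f (df x)) ->
  (forall x, a < x < b -> is_derive x 1 g (dg x)) ->
  (forall x, a < x < b -> `|df x| <= dg x) ->
  `|f b - f a| <= g b - g a.
Proof.
move=> ab cf cg hf hg le; rewrite ler_norml; apply/andP; split.
  have := @ler_derive (- f) g (fun x => - df x) dg a b ab.
  rewrite -![(- f) _]/(- f _) => H.
  rewrite lerNl opprB; have -> : f a - f b = - f b - - f a by ring.
  apply: H => // [x|x xab|x xab]; first by apply: cvgN; exact: cf.
    by apply: is_deriveN; exact: hf.
  by have := le x xab; rewrite ler_norml => /andP[+ _]; rewrite lerNl.
apply: (ler_derive ab cf cg hf hg) => x xab.
by have := le x xab; rewrite ler_norml => /andP[].
Qed.

Lemma continuous_antiderivative p q (h : R -> 'M[R]_(p, q)) : continuous h ->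
  exists2 F : R -> 'M[R]_(p, q), F 0 = 0 &
    forall x : R, 0 <= x <= 1 -> is_derive x 1 F (h x).
Proof.
move=> ch.
have S (k : R -> R) : continuous k -> exists2 F : R -> R, F 0 = 0 &
    forall x : R, 0 <= x <= 1 -> is_derive x 1 F (k x).
  move=> ck.
  (* Starting the integral at -1, and using 2 as right end below, makes both ends of [0, 1] interior
     points, so the derivatives there are two-sided. *)
  pose F (x : R) : R := (\int[lebesgue_measure]_(t in [set` `[(- 1)%R, x]]) k t)%R.
  have Fd (x : R) : 0 <= x <= 1 -> is_derive x 1 F (k x).
    move=> /andP[x0 x1].
    have [] := @continuous_FTC1_closed R k (-1) x 2.
    - lra.
    - apply: continuous_compact_integrable; first exact: segment_compact.
      exact: continuous_subspaceT.
    - lra.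
    - exact: ck.
    move=> d1 d2; apply: DeriveDef; first exact: d1.
    by rewrite -derive1E; exact: d2.
  exists (F - cst (F 0)); first by rewrite -[LHS]/(F 0 - F 0) subrr.
  move=> x x01; rewrite -[k x]subr0; apply: is_deriveB; exact: Fd.
have {}S i j : exists F : R -> R, F 0 = 0 /\
    forall x : R, 0 <= x <= 1 -> is_derive x 1 F (h x i j).
  have [|F F0 F1] := S (fun x => h x i j); last by exists F.
  by move=> x; exact: ((continuous_mxP h x).1 (ch x)).
pose G i j := sval (cid (S i j)).
exists (fun x => \matrix_(i, j) G i j x).
  by apply/matrixP => i j; rewrite !mxE; exact: (svalP (cid (S i j))).1.
move=> x x01; apply/is_derive_mxP => i j.
under [X in is_derive _ _ X _]eq_fun do rewrite mxE.
exact: (svalP (cid (S i j))).2.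
Qed.

(** With [e k] the tail of the geometric series, the intervals of centre [v k] and radius [e k] are
    nested. The supremum of their left ends lies in all of them. *)
Lemma geometric_limit (v : nat -> R) (c : R) :
  (forall k, `|v k.+1 - v k| <= c * 2^-1 ^+ k) ->
  exists l, forall k, `|v k - l| <= 2 * c * 2^-1 ^+ k.
Proof.
move=> hv.
have c0 : 0 <= c by have := hv 0%N; rewrite expr0 mulr1; apply: le_trans.
pose e k : R := 2 * c * 2^-1 ^+ k.
have eS k : e k = e k.+1 + c * 2^-1 ^+ k.
  by rewrite /e exprS; field.
have e0 k : 0 <= e k by rewrite /e !mulr_ge0// exprn_ge0// invr_ge0.
have aS k n : v k - e k <= v (n + k)%N - e (n + k)%N.
  elim: n => // n IH; apply: le_trans IH _; rewrite addSn (eS (n + k)%N).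
  by have := hv (n + k)%N; rewrite ler_norml => /andP[]; lra.
have bS k n : v (n + k)%N + e (n + k)%N <= v k + e k.
  elim: n => // n IH; apply: le_trans _ IH; rewrite addSn (eS (n + k)%N).
  by have := hv (n + k)%N; rewrite ler_norml => /andP[]; lra.
have ab k j : v k - e k <= v j + e j.
  apply: le_trans (aS k j) _; apply: (@le_trans _ _ (v (j + k)%N + e (j + k)%N)).
    by have := e0 (j + k)%N; lra.
  by rewrite addnC; exact: bS.
pose S := [set v k - e k | k in setT].
have S0 : S !=set0 by exists (v 0%N - e 0%N), 0%N.
have hS j : ubound S (v j + e j) by move=> _ [k _ <-].
have sS : has_sup S by split=> //; exists (v 0%N + e 0%N); exact: hS.
exists (sup S) => k; rewrite distrC ler_distl -/(e k); apply/andP; split.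
  by apply: (ub_le_sup sS.2); exists k.
exact: ge_sup.
Qed.

End OneVariable.

(** * Projection onto an interval *)

Section Clamp.
Context {R : realType}.

(** Composition with this projection extends data from an interval, or coordinatewise from a
    sup-norm ball, to the whole space without increasing Lipschitz constants. Picard's theorem can
    then be stated for globally defined data. *)
Definition clamp (a b x : R) : R := Num.max a (Num.min x b).

Lemma clamp_lip a b x y : `|clamp a b x - clamp a b y| <= `|x - y|.
Proof.
rewrite /clamp; set u := Num.min x b; set v := Num.min y b.
have uv : `|u - v| <= `|x - y|.
  rewrite /u /v; case: (ger0P (x - y)) => ?;
  case: (lerP x b) => ?; case: (lerP y b) => ?;
  rewrite ler_norml; apply/andP; split; lra.
apply: le_trans uv; case: (ger0P (u - v)) => ?;
  case: (lerP a u) => ?; case: (lerP a v) => ?;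
  rewrite ler_norml; apply/andP; split; lra.
Qed.

Lemma clamp_in a b x : a <= b -> a <= clamp a b x <= b.
Proof. by move=> ab; rewrite /clamp le_max lexx/= ge_max ab/= ge_min lexx orbT. Qed.

Lemma clamp_id a b x : a <= x <= b -> clamp a b x = x.
Proof. by move=> /andP[ax xb]; rewrite /clamp min_l// max_r. Qed.

Lemma lip_continuous (V W : normedModType R) (f : V -> W) (k : R) :
  (forall x y, `|f x - f y| <= k * `|x - y|) -> continuous f.
Proof.
move=> fk x; apply/cvgrPdist_le => /= e e0.
have k1 : 0 < `|k| + 1 by rewrite ltr_wpDl.
near=> y; apply: le_trans (fk x y) _.
apply: (@le_trans _ _ ((`|k| + 1) * `|x - y|)).
  by rewrite ler_wpM2r// (le_trans (ler_norm k))// lerDl.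
rewrite -ler_pdivlMl//; near: y.
by apply: cvgr_dist_le; [exact: cvg_id|rewrite mulr_gt0// invr_gt0].
Unshelve. all: by end_near. Qed.

Lemma le0_geometric (a c : R) : (forall k, a <= c * 2^-1 ^+ k) -> a <= 0.
Proof.
move=> H; rewrite leNgt; apply/negP => a0.
have c0 : 0 < c by have := H 0%N; rewrite expr0 mulr1; apply: lt_le_trans.
have := H (Num.truncn (c / a)).+1; rewrite exprVn.
rewrite ler_pdivlMr ?exprn_gt0// => le1.
have : c / a < 2 ^+ (Num.truncn (c / a)).+1.
  apply: lt_le_trans (truncnS_gt _) _; rewrite -natrX ler_nat.
  exact/ltnW/ltn_expl.
by rewrite ltr_pdivrMr// mulrC ltNge le1.
Qed.

End Clamp.

(** * Gronwall's inequality *)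

Section Gronwall.
Context {R : realType}.

(** For the sup norm the inequality reduces to single entries, with no loss in the constant. *)
Lemma norm_ler_derive p q (f df : R -> 'M[R]_(p, q)) (g dg : R -> R) (a b : R) :
  a <= b ->
  {within `[a, b], continuous f} -> {within `[a, b], continuous g} ->
  (forall x, a < x < b -> is_derive x 1 f (df x)) ->
  (forall x, a < x < b -> is_derive x 1 g (dg x)) ->
  (forall x, a < x < b -> `|df x| <= dg x) ->
  `|f b - f a| <= g b - g a.
Proof.
move=> ab cf cg hf hg le; apply: mx_norm_leP => [|i j].
  have := @ler_derive R (cst 0) g (cst 0) dg a b ab _ cg _ hg.
  rewrite /cst subrr; apply => [x|x xab]; first exact: cvg_cst.
  exact: le_trans (normr_ge0 _) (le x xab).
rewrite !mxE.
apply: (@abs_ler_derive R (fun x => f x i j) g (fun x => df x i j) dg) => //.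
- by move=> x; have /cvg_mxP := cf x; apply.
- by move=> x xab; have /is_derive_mxP := hf x xab; apply.
- by move=> x xab; apply: le_trans (le x xab); exact: mx_entry_le_norm.
Qed.

Lemma is_derive_expRM (k x : R) :
  is_derive x 1 (fun y => expR (k * y)) (k * expR (k * x)).
Proof.
have h : is_derive x 1 ( *%R k) k.
  by rewrite -[X in is_derive _ _ _ X]mulr1; exact: is_deriveZ.
have := @is_derive1_comp R expR ( *%R k) x _ _ (is_derive_expR _) h.
by rewrite mulrC.
Qed.

(** The norm is not differentiable, so the estimate is run on the sum [E] of the squared entries,
    which satisfies E' <= k E + N b^2. The constant depends on [p], [q] and [L] alone. *)
Lemma gronwall p q (L : R) : 0 <= L -> exists2 C : R, 1 <= C &
  forall (z dz : R -> 'M[R]_(p, q)) (T b : R), 0 <= T <= 1 -> 0 <= b ->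
    {within `[0, T], continuous z} ->
    (forall x, 0 < x < T -> is_derive x 1 z (dz x)) ->
    (forall x, 0 < x < T -> `|dz x| <= L * `|z x| + b) ->
    `|z T| <= C * (`|z 0| + b).
Proof.
(* [N] is the number of entries. The rate [k] comes from 2 |z| (L |z| + b) <= (2 L + 1) |z|^2 + b^2,
   summed over the entries. *)
move=> L0; pose N : R := p%:R * q%:R; pose k := N * (2 * L + 1).
have N0 : 0 <= N by rewrite mulr_ge0.
have NS (F : 'I_p -> 'I_q -> R) c : (forall i j, F i j <= c) ->
    \sum_i \sum_j F i j <= N * c.
  move=> Fc; apply: (@le_trans _ _ (\sum_(i < p) \sum_(j < q) c)).
    by apply: ler_sum => i _; apply: ler_sum.
  rewrite sumr_const card_ord sumr_const card_ord /N -!mulrnA.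
  by rewrite mulnC -natrM mulr_natl.
have k0 : 0 <= k by rewrite mulr_ge0// addr_ge0// mulr_ge0.
(* This dominates the square root of N e^k and is at least 1 even for empty matrices. *)
exists (1 + N * expR k); first by rewrite lerDl mulr_ge0// expR_ge0.
move=> z dz T b /andP[T0 T1] b0 cz hz le.
pose E x := \sum_i \sum_j (z x i j) ^+ 2.
pose dE x := \sum_i \sum_j (2 * z x i j * dz x i j).
have zE x : `|z x| ^+ 2 <= E x.
  have E0 : 0 <= E x by apply: sumr_ge0 => i _; apply: sumr_ge0 => j _; exact: sqr_ge0.
  have [->|/mx_norm_neq0[[i j]]] := eqVneq (`|z x|) 0; first by rewrite expr0n.
  rewrite -[mx_norm _]/(`|z x|) => ->; rewrite real_normK ?num_real//= /E (bigD1 i)//= (bigD1 j)//= -addrA lerDl.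
  by rewrite addr_ge0// !sumr_ge0// => *; rewrite ?sumr_ge0// => *; rewrite sqr_ge0.
have hE (x : R) : 0 < x < T -> is_derive x 1 E (dE x).
  move=> /hz/is_derive_mxP hx.
  rewrite (_ : E = \sum_i \sum_j ((fun y => z y i j) * (fun y => z y i j))).
    apply: is_derive_sum => i; apply: is_derive_sum => j.
    have := is_deriveM (hx i j) (hx i j).
    rewrite (_ : _ + _ = 2 * z x i j * dz x i j)//.
    by rewrite /GRing.scale/=; ring.
  apply/funext => y; rewrite fct_sumE; apply: eq_bigr => i _.
  by rewrite fct_sumE; apply: eq_bigr.
have dEle x : 0 < x < T -> dE x <= k * E x + N * b ^+ 2.
  move=> xT; apply: (@le_trans _ _ (N * ((2 * L + 1) * `|z x| ^+ 2 + b ^+ 2))).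
    apply: NS => i j.
    apply: (@le_trans _ _ (2 * (`|z x| * (L * `|z x| + b)))).
      rewrite -mulrA ler_pM2l// (le_trans (ler_norm _))// normrM ler_pM//.
        exact: mx_entry_le_norm.
      by apply: le_trans (le x xT); exact: mx_entry_le_norm.
    by have := sqr_ge0 (`|z x| - b); rewrite sqrrB; nra.
  rewrite /k mulrDr lerD2r mulrA; apply: ler_wpM2l => //.
have cE : {within `[0, T], continuous E}.
  move=> x; have /cvg_mxP cx := cz x.
  apply: cvg_big; first exact: add_continuous.
  move=> i _; apply: cvg_big; first exact: add_continuous.
  by move=> j _; apply: cvgM; exact: cx.
have cexp : continuous (fun y : R => expR (- k * y)).
  by move=> y; apply: is_derive_continuous; exact: is_derive_expRM.
(* The integrating factor e^(-k x) turns the differential inequality into a comparison with the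
   linear function N b^2 x. *)
have := @ler_derive R (E * (fun y : R => expR (- k * y)))
  (fun y => N * b ^+ 2 * y)
  (fun x => E x * (- k * expR (- k * x)) + expR (- k * x) * dE x)
  (fun=> N * b ^+ 2) 0 T T0 _ _ _ _ _.
rewrite mulr0 subr0 => H.
have {}H : E T * expR (- k * T) - E 0 * expR (- k * 0) <= N * b ^+ 2 * T.
  apply: H.
  - move=> x; apply: cvgM; first exact: cE.
    exact: (continuous_subspaceT cexp).
  - apply: continuous_subspaceT => x; apply: cvgM; [exact: cvg_cst|exact: cvg_id].
  - by move=> x xT; apply: is_deriveM; [exact: hE|exact: is_derive_expRM].
  - move=> x xT; rewrite -[X in is_derive _ _ _ X]mulr1; exact: is_deriveZ.
  - move=> x xT; have := dEle x xT => dE1.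
    have e0 : 0 < expR (- k * x) by exact: expR_gt0.
    have e1 : expR (- k * x) <= 1.
      by rewrite -expR0 ler_expR mulNr oppr_le0 mulr_ge0//; case/andP: xT => /ltW.
    have : expR (- k * x) * dE x <= expR (- k * x) * (k * E x + N * b ^+ 2).
      by rewrite ler_pM2l.
    have : expR (- k * x) * (N * b ^+ 2) <= 1 * (N * b ^+ 2).
      by rewrite ler_wpM2r// mulr_ge0// sqr_ge0.
    by nra.
have E0le : E 0 <= N * `|z 0| ^+ 2.
  apply: NS => i j; rewrite -[X in X <= _]real_normK ?num_real//.
  by rewrite lerXn2r ?nnegrE// mx_entry_le_norm.
rewrite mulr0 expR0 mulr1 in H.
have {}H : E T <= N * expR k * (`|z 0| + b) ^+ 2.
  have H1 : E T * expR (- k * T) <= N * (`|z 0| + b) ^+ 2.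
    have : N * b ^+ 2 * T <= N * b ^+ 2 * 1.
      by rewrite ler_wpM2l// mulr_ge0// sqr_ge0.
    have : 0 <= N * (`|z 0| * b) by rewrite !mulr_ge0.
    by rewrite sqrrD; nra.
  have : E T * expR (- k * T) * expR (k * T) <= N * (`|z 0| + b) ^+ 2 * expR (k * T).
    by rewrite ler_wpM2r// expR_ge0.
  rewrite -mulrA -expRD mulNr addNr expR0 mulr1 => /le_trans; apply.
  rewrite [leRHS]mulrAC; apply: ler_wpM2l; first by rewrite mulr_ge0// sqr_ge0.
  by rewrite ler_expR -[leRHS]mulr1 ler_wpM2l.
have Nk0 : 0 <= N * expR k by rewrite mulr_ge0// expR_ge0.
rewrite -(@ler_pXn2r _ 2) ?nnegrE//; last by rewrite mulr_ge0 ?addr_ge0.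
apply: le_trans (zE T) _; apply: le_trans H _.
rewrite exprMn; apply: ler_wpM2r; first exact: sqr_ge0.
by nra.
Qed.

End Gronwall.

(** * Picard's theorem and the flow near an equilibrium *)

Section Picard.
Context {R : realType}.

(** Picard iteration, measured with the weight e^(2 L x): each step then halves the distance on all
    of [0, 1], whatever the size of [L], and no gluing of short intervals is required. *)
Lemma picard p q (H : R -> 'M[R]_(p, q) -> 'M[R]_(p, q)) (L : R)
    (y0 : 'M[R]_(p, q)) : 0 < L ->
  (forall u : R -> 'M[R]_(p, q), continuous u -> continuous (fun x => H x (u x))) ->
  (forall x A B, `|H x A - H x B| <= L * `|A - B|) ->
  exists2 y : R -> 'M[R]_(p, q), y 0 = y0 &
    forall x : R, 0 <= x <= 1 -> is_derive x 1 y (H x (y x)).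
Proof.
move=> L0 Hc HL.
(* Time is clamped so that an iterate, controlled only on [0, 1], yields an integrand continuous on
   the whole line and hence two-sided derivatives at 0 and 1. *)
pose cl : R -> R := clamp 0 1.
have clc : continuous cl.
  by apply: (@lip_continuous R _ _ _ 1) => x y; rewrite mul1r; exact: clamp_lip.
have cl01 x : 0 <= cl x <= 1 by exact: clamp_in.
have clid (x : R) : 0 <= x <= 1 -> cl x = x by exact: clamp_id.
pose Q (v : R -> 'M[R]_(p, q)) :=
  v 0 = y0 /\ forall x : R, 0 <= x <= 1 -> {for x, continuous v}.
have Qc v : Q v -> continuous (v \o cl).
  by move=> [_ cv] x; apply: continuous_comp; [exact: clc|exact: cv].
have ext v : continuous (v \o cl) -> exists2 w : R -> 'M[R]_(p, q), Q w &
    forall x : R, 0 <= x <= 1 -> is_derive x 1 w (H x (v x)).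
  move=> /Hc/continuous_antiderivative[F F0 dF].
  have dw (x : R) : 0 <= x <= 1 -> is_derive x 1 (cst y0 + F) (H x (v x)).
    move=> x01; rewrite -[H x _]add0r; apply: is_deriveD.
    by have := dF x x01; rewrite /= clid.
  exists (cst y0 + F); last exact: dw.
  split; first by rewrite -[LHS]/(y0 + F 0) F0 addr0.
  by move=> x x01; apply: is_derive_continuous (dw x x01).
have step v : exists w, Q v ->
    Q w /\ forall x : R, 0 <= x <= 1 -> is_derive x 1 w (H x (v x)).
  have [Qv|nQv] := pselect (Q v); last by exists v.
  by have [w Qw dw] := ext v (Qc v Qv); exists w.
have [S SP] := choice step.
pose v k := iter k S (cst y0).
have Qv k : Q (v k).
  elim: k => [|k IH]; last by have [] := SP _ IH.
  by split; [exact: erefl|move=> x _; exact: cvg_cst].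
have dv k (x : R) : 0 <= x <= 1 -> is_derive x 1 (v k.+1) (H x (v k x)).
  by have [_] := SP _ (Qv k); apply.
have v0 k : v k 0 = y0 by have [] := Qv k.
have cv k (x : R) : 0 <= x <= 1 -> {for x, continuous (v k)}.
  by have [_] := Qv k; apply.
have cvw k a b : 0 <= a -> b <= 1 -> {within `[a, b], continuous (v k)}.
  move=> a0 b1; apply: continuous_in_subspaceT => x.
  rewrite inE/= in_itv/= => /andP[ax xb]; apply: cv.
  by rewrite (le_trans a0 ax) (le_trans xb b1).
have [M M0 HM] : exists2 M, 0 <= M & forall x : R, 0 <= x <= 1 ->
    `|v 1%N x - v 0%N x| <= M.
  have cn : {within `[0, 1], continuous (fun x => `|v 1%N x - v 0%N x|)}.
    by apply: within_continuous_norm; apply: within_continuousB; apply: cvw.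
  have [c _ cM] := EVT_max ler01 cn.
  exists `|v 1%N c - v 0%N c|; first exact: normr_ge0.
  by move=> x x01; apply: cM; rewrite in_itv.
have cexp : continuous (fun y : R => expR (2 * L * y)).
  by move=> y; apply: is_derive_continuous; exact: is_derive_expRM.
have est k (x : R) : 0 <= x <= 1 ->
    `|v k.+1 x - v k x| <= M * 2^-1 ^+ k * expR (2 * L * x).
  elim: k x => [|k IH] x x01.
    rewrite expr0 mulr1; apply: le_trans (HM x x01) _.
    rewrite -[leLHS]mulr1; apply: ler_wpM2l => //.
    by rewrite -expR0 ler_expR; case/andP: x01 => x0 _; rewrite !mulr_ge0// ltW.
  have /andP[x0 x1] := x01.
  (* The bound L M 2^-k e^(2 L t) on the derivative equals c (2 L) e^(2 L t), the derivative of c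
     e^(2 L t): this is the gain of one half. *)
  pose c := M * 2^-1 ^+ k.+1.
  have c0 : 0 <= c by rewrite mulr_ge0// exprn_ge0// invr_ge0.
  have := @norm_ler_derive R p q (fun t => v k.+2 t - v k.+1 t)
    (fun t => H t (v k.+1 t) - H t (v k t))
    (fun t => c * expR (2 * L * t)) (fun t => c * (2 * L * expR (2 * L * t)))
    0 x x0.
  cbv beta; rewrite !v0 !subrr subr0 mulr0 expR0 mulr1.
  move=> G; apply: le_trans (_ : _ <= c * expR (2 * L * x) - c) _; last first.
    by rewrite gerBl.
  have in01 t : 0 < t < x -> 0 <= t <= 1.
    by move=> /andP[t0 tx]; rewrite ltW//= (le_trans (ltW tx)).
  apply: G.
  - by apply: within_continuousB; exact: cvw.
  - apply: continuous_subspaceT => t.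
    by apply: cvgM; [exact: cvg_cst|exact: cexp].
  - by move=> t /in01 t01; apply: is_derive_subl; exact: dv.
  - by move=> t _; apply: is_derive_cmull; exact: is_derive_expRM.
  - move=> t /in01 t01; apply: le_trans (HL _ _ _) _.
    have := IH t t01; rewrite -(ler_pM2l L0) => /le_trans; apply.
    by rewrite /c exprS le_eqVlt; apply/orP; left; apply/eqP; field.
pose c := M * expR (2 * L).
have est1 k (x : R) : 0 <= x <= 1 -> `|v k.+1 x - v k x| <= c * 2^-1 ^+ k.
  move=> x01; apply: le_trans (est k x x01) _.
  rewrite /c mulrAC; apply: ler_wpM2r; first by rewrite exprn_ge0// invr_ge0.
  apply: ler_wpM2l => //; rewrite ler_expR -[leRHS]mulr1 ler_wpM2l//.
    by rewrite mulr_ge0// ltW.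
  by case/andP: x01.
have limE x : exists l : 'M[R]_(p, q), 0 <= x <= 1 ->
    forall k, `|v k x - l| <= 2 * c * 2^-1 ^+ k.
  have [x01|] := boolP (0 <= x <= 1); last by exists 0.
  have ex ij : exists l, forall k, `|v k x ij.1 ij.2 - l| <= 2 * c * 2^-1 ^+ k.
    apply: geometric_limit => k; apply: le_trans (est1 k x x01).
    by have := mx_entry_le_norm (v k.+1 x - v k x) ij.1 ij.2; rewrite !mxE.
  have [l lP] := choice ex.
  exists (\matrix_(i, j) l (i, j)) => _ k.
  apply: mx_norm_leP => [|i j]; last by rewrite !mxE; exact: lP (i, j) k.
  by rewrite !mulr_ge0 ?expR_ge0 ?exprn_ge0 ?invr_ge0.
have [y yP] := choice limE.
have cy : continuous (y \o cl).
  move=> x; apply/cvgrPdist_le => /= e e0.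
  have c1 : 0 < 2 * c + 1.
    by rewrite ltr_wpDl// mulr_ge0// mulr_ge0// expR_ge0.
  have [k kP] : exists k, (2 * c + 1) * 2^-1 ^+ k < e / 3.
    apply: contrapT => /forallNP nk.
    have : e / 3 <= 0.
      by apply: (@le0_geometric R _ (2 * c + 1)) => k; rewrite leNgt; apply/negP.
    by rewrite leNgt divr_gt0.
  have yk (t : R) : `|v k (cl t) - y (cl t)| <= e / 3.
    apply: le_trans (yP (cl t) (cl01 t) k) _; apply: le_trans (ltW kP).
    by rewrite ler_wpM2r ?exprn_ge0 ?invr_ge0// lerDl.
  have e3 : 0 < e / 3 by rewrite divr_gt0.
  have : \forall t \near x, `|(v k \o cl) x - (v k \o cl) t| <= e / 3.
    exact: (cvgrPdist_le _ _).1 (Qc _ (Qv k) x) _ e3.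
  apply: filterS => t /= vt.
  have -> : y (cl x) - y (cl t) = y (cl x) - v k (cl x) +
    (v k (cl x) - v k (cl t) + (v k (cl t) - y (cl t))) by rewrite !subrKA.
  have h1 := ler_normD (y (cl x) - v k (cl x))
    (v k (cl x) - v k (cl t) + (v k (cl t) - y (cl t))).
  have h2 := ler_normD (v k (cl x) - v k (cl t)) (v k (cl t) - y (cl t)).
  have := yk x; rewrite distrC => h3; have h4 := yk t.
  by apply: (le_trans h1); lra.
(* The uniform limit [y] comes without a derivative. [w] integrates the field along [y], and it
   equals [y] because both are within a multiple of 2^-k of the iterates. *)
have [w Qw dw] := ext y cy.
have wy (x : R) : 0 <= x <= 1 -> w x = y x.
  move=> x01; have /andP[x0 x1] := x01.
  apply/eqP; rewrite -subr_eq0 -normr_le0.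
  apply: (@le0_geometric R _ (L * (2 * c) + c)) => k.
  have e1 : `|w x - v k.+1 x| <= L * (2 * c) * 2^-1 ^+ k.
    have b0 : 0 <= L * (2 * c) * 2^-1 ^+ k.
      by rewrite !mulr_ge0 ?expR_ge0 ?exprn_ge0 ?invr_ge0// ltW.
    have := @norm_ler_derive R p q (fun t => w t - v k.+1 t)
      (fun t => H t (y t) - H t (v k t))
      (fun t => L * (2 * c) * 2^-1 ^+ k * t) (fun=> L * (2 * c) * 2^-1 ^+ k)
      0 x x0.
    cbv beta; rewrite v0 (proj1 Qw) subrr subr0 mulr0 subr0 => G.
    apply: le_trans (_ : _ <= L * (2 * c) * 2^-1 ^+ k * x) _; last first.
      by rewrite -[leRHS]mulr1 ler_wpM2l.
    have in01 t : 0 < t < x -> 0 <= t <= 1.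
      by move=> /andP[t0 tx]; rewrite ltW//= (le_trans (ltW tx)).
    apply: G.
    - apply: within_continuousB; last exact: cvw.
      apply: continuous_in_subspaceT => s.
      rewrite inE/= in_itv/= => /andP[s0 sx]; apply: (proj2 Qw).
      by rewrite s0 (le_trans sx).
    - by apply: continuous_subspaceT => t; apply: cvgM; [exact: cvg_cst|exact: cvg_id].
    - by move=> t /in01 t01; apply: is_derive_subl; [exact: dw|exact: dv].
    - move=> t _; rewrite -[X in is_derive _ _ _ X]mulr1.
      by apply: is_derive_cmull; exact: is_derive_id.
    - move=> t /in01 t01; apply: le_trans (HL _ _ _) _.
      have := yP t t01 k; rewrite distrC -(ler_pM2l L0) => /le_trans; apply.
      by rewrite !mulrA.
  have e2 := yP x x01 k.+1; rewrite exprS in e2.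
  have -> : w x - y x = (w x - v k.+1 x) + (v k.+1 x - y x).
    by rewrite addrA subrK.
  apply: le_trans (ler_normD _ _) _; rewrite mulrDl lerD//.
  by apply: le_trans e2 _; rewrite le_eqVlt; apply/orP; left; apply/eqP; field.
exists w; first exact: (proj1 Qw).
by move=> x x01; rewrite wy//; exact: dw.
Qed.

End Picard.

(** * The flow near an equilibrium and its variational equation *)

Section Flow.
Context {R : realType}.

Lemma gronwall01 p q (L : R) : 0 <= L -> exists2 C : R, 1 <= C &
  forall (z dz : R -> 'M[R]_(p, q)) (b : R), 0 <= b ->
    (forall x : R, 0 <= x <= 1 -> is_derive x 1 z (dz x)) ->
    (forall x : R, 0 <= x <= 1 -> `|dz x| <= L * `|z x| + b) ->
    forall x : R, 0 <= x <= 1 -> `|z x| <= C * (`|z 0| + b).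
Proof.
move=> L0; have [C C1 HC] := @gronwall R p q L L0; exists C => // z dz b b0 hz le x x01.
have /andP[x0 x1] := x01.
have in01 t : 0 <= t <= x -> 0 <= t <= 1.
  by move=> /andP[-> tx]; exact: le_trans x1.
have in01' t : 0 < t < x -> 0 <= t <= 1.
  by move=> /andP[t0 tx]; apply: in01; rewrite !ltW.
apply: (HC z dz) => //.
- apply: continuous_in_subspaceT => t; rewrite inE/= in_itv/= => /in01 t01.
  exact: is_derive_continuous (hz t t01).
- by move=> t /in01'; exact: hz.
- by move=> t /in01'; exact: le.
Qed.

(* The middle clause is a strict differentiability estimate, uniform in the
   base point [y]: [y = y2] gives differentiability at [y2], and letting
   [y1, y2] tend to [y] gives strict differentiability at [y]. *)
Definition c11_on p s (F : 'cV[R]_p -> 'cV[R]_s) (DF : 'cV[R]_p -> 'M[R]_(s, p))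
    (a : 'cV[R]_p) (rho K : R) :=
  [/\ forall y, `|y - a| <= rho -> `|DF y| <= K,
      forall y y1 y2, `|y - a| <= rho -> `|y1 - a| <= rho -> `|y2 - a| <= rho ->
        `|F y1 - F y2 - DF y *m (y1 - y2)| <=
          K * (`|y1 - y| + `|y2 - y|) * `|y1 - y2| &
      forall y y', `|y - a| <= rho -> `|y' - a| <= rho ->
        `|DF y - DF y'| <= K * `|y - y'|].

Lemma c11_lip p s (F : 'cV[R]_p -> 'cV[R]_s) DF a rho K : 0 <= K -> 0 <= rho ->
  c11_on F DF a rho K -> forall y1 y2, `|y1 - a| <= rho -> `|y2 - a| <= rho ->
  `|F y1 - F y2| <= (p%:R * K + K * (2 * rho)) * `|y1 - y2|.
Proof.
move=> K0 rho0 [DK H _] y1 y2 h1 h2.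
have -> : F y1 - F y2 = F y1 - F y2 - DF y1 *m (y1 - y2) + DF y1 *m (y1 - y2).
  by rewrite subrK.
apply: le_trans (ler_normD _ _) _; rewrite addrC mulrDl; apply: lerD.
  by apply: norm_mulmx_le2 => //; exact: DK.
apply: le_trans (H _ _ _ h1 h1 h2) _; rewrite subrr normr0 add0r.
rewrite ler_wpM2r// ler_wpM2l//.
have := ler_normD (y2 - a) (a - y1); rewrite subrKA => /le_trans; apply.
by rewrite (distrC a); lra.
Qed.

(** For the sup norm this is a 1-Lipschitz projection onto the closed ball of radius [rho] about
    [a]. *)
Definition clamp_ball p (a : 'cV[R]_p) (rho : R) (y : 'cV[R]_p) : 'cV[R]_p :=
  \col_i clamp (a i 0 - rho) (a i 0 + rho) (y i 0).

Lemma clamp_ball_lip p (a : 'cV[R]_p) rho y1 y2 :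
  `|clamp_ball a rho y1 - clamp_ball a rho y2| <= `|y1 - y2|.
Proof.
apply: mx_norm_leP => // i j; rewrite !mxE ?ord1.
apply: le_trans (clamp_lip _ _ _ _) _.
by have := mx_entry_le_norm (y1 - y2) i 0; rewrite !mxE.
Qed.

Lemma clamp_ball_in p (a : 'cV[R]_p) rho y : 0 <= rho ->
  `|clamp_ball a rho y - a| <= rho.
Proof.
move=> r0; apply: mx_norm_leP => // i j; rewrite !mxE ?ord1.
by rewrite ler_distl; apply: clamp_in; lra.
Qed.

Lemma clamp_ball_id p (a : 'cV[R]_p) rho y :
  `|y - a| <= rho -> clamp_ball a rho y = y.
Proof.
move=> h; apply/colP => i; rewrite !mxE; apply: clamp_id.
rewrite -ler_distl.
by apply: le_trans h; have := mx_entry_le_norm (y - a) i 0; rewrite !mxE.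
Qed.

(** The field is made globally Lipschitz by composing it with the projection onto the ball.
    Gronwall's inequality against the constant solution [a] keeps nearby solutions in the half ball
    up to time one, where the modified and the original field agree. [E y] is the time-one value of
    the variational equation along the solution from [y]; at [y = a] its coefficient is the constant
    [DF a]. *)
Lemma flow p (F : 'cV[R]_p -> 'cV[R]_p) (DF : 'cV[R]_p -> 'M[R]_p)
    (a : 'cV[R]_p) (rho K : R) : 0 <= K -> 0 < rho ->
    c11_on F DF a rho K -> F a = 0 ->
  exists (rho0 : R) (Y : 'cV[R]_p -> R -> 'cV[R]_p) (E : 'cV[R]_p -> 'M[R]_p) (C : R),
  [/\ 0 < rho0 <= rho / 2 /\ 0 < C,
      forall y, `|y - a| <= rho0 -> Y y 0 = y /\ forall x : R, 0 <= x <= 1 ->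
        `|Y y x - a| <= rho / 2 /\ is_derive x 1 (Y y) (F (Y y x)),
      forall y y1 y2, `|y - a| <= rho0 -> `|y1 - a| <= rho0 -> `|y2 - a| <= rho0 ->
        `|Y y1 1 - Y y2 1 - E y *m (y1 - y2)| <=
          C * (`|y1 - y| + `|y2 - y|) * `|y1 - y2| &
      exists Z : R -> 'M[R]_p, [/\ Z 0 = 1%:M, Z 1 = E a &
        forall x : R, 0 <= x <= 1 -> is_derive x 1 Z (DF a *m Z x)]].
Proof.
move=> K0 rho0 hF Fa; have [DK HF DL] := hF.
pose cb := clamp_ball a rho.
have cbin y : `|cb y - a| <= rho by apply: clamp_ball_in; exact: ltW.
(* The added 1 makes the Lipschitz constant positive even if [K] is 0. *)
pose L := p%:R * K + K * (2 * rho) + 1.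
have L0 : 0 < L by rewrite ltr_wpDl// addr_ge0// mulr_ge0// mulr_ge0// ltW.
have FL y1 y2 : `|F (cb y1) - F (cb y2)| <= L * `|y1 - y2|.
  apply: le_trans (c11_lip K0 (ltW rho0) hF (cbin _) (cbin _)) _.
  by apply: ler_pM => //; [rewrite addr_ge0// !mulr_ge0// ltW|
    rewrite lerDl|exact: clamp_ball_lip].
have [Y0 Y0P] : exists Y : 'cV[R]_p -> R -> 'cV[R]_p, forall y,
    Y y 0 = y /\
    forall x : R, 0 <= x <= 1 -> is_derive x 1 (Y y) (F (cb (Y y x))).
  have ex y : exists u : R -> 'cV[R]_p, u 0 = y /\
      forall x : R, 0 <= x <= 1 -> is_derive x 1 u (F (cb (u x))).
    have [||u u0 du] := @picard R p 1 (fun _ A => F (cb A)) L y L0.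
    - move=> u cu x; apply: (@continuous_comp _ _ _ u (fun A => F (cb A))).
        exact: cu.
      exact: (lip_continuous FL).
    - by move=> _ A B; exact: FL.
    - by exists u.
  by have [Y YP] := choice ex; exists Y.
have [C1 C11 G1] := @gronwall01 p 1 L (ltW L0).
have C10 : 0 < C1 by exact: lt_le_trans C11.
have cba : cb a = a by apply: clamp_ball_id; rewrite subrr normr0 ltW.
have Yin y x : 0 <= x <= 1 -> `|Y0 y x - a| <= C1 * `|y - a|.
  move=> x01; have [yy0 dy] := Y0P y.
  suff : `|Y0 y x - a| <= C1 * (`|Y0 y 0 - a| + 0) by rewrite yy0 addr0.
  apply: (G1 (fun x => Y0 y x - a) (fun x => F (cb (Y0 y x)))) => //.
    move=> t t01; rewrite -[F _]subr0.
    exact: (is_derive_subl (dy t t01) (is_derive_cst a t 1)).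
  move=> t t01; rewrite addr0 -[F (cb (Y0 y t))]subr0.
  by have := FL (Y0 y t) a; rewrite cba Fa.
(* Distances to [a] grow by a factor of at most [C1], so this radius leads into the ball of radius
   rho / 2. *)
pose r0 := rho / (2 * C1).
have r0C : C1 * r0 = rho / 2 by rewrite /r0; field; rewrite gt_eqF.
have r00 : 0 < r0 by rewrite divr_gt0// mulr_gt0.
have Yin2 y x : `|y - a| <= r0 -> 0 <= x <= 1 -> `|Y0 y x - a| <= rho / 2.
  move=> yr x01; apply: le_trans (Yin y x x01) _.
  by rewrite -r0C ler_pM2l.
have Yin3 y x : `|y - a| <= r0 -> 0 <= x <= 1 -> `|Y0 y x - a| <= rho.
  by move=> yr x01; apply: le_trans (Yin2 y x yr x01) _; lra.
have dY y (x : R) : `|y - a| <= r0 -> 0 <= x <= 1 ->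
    is_derive x 1 (Y0 y) (F (Y0 y x)).
  move=> yr x01; have [_ dy] := Y0P y; have := dy x x01.
  by rewrite /cb clamp_ball_id//; exact: Yin3.
have YL y1 y2 x : 0 <= x <= 1 -> `|Y0 y1 x - Y0 y2 x| <= C1 * `|y1 - y2|.
  move=> x01; have [yy1 dy1] := Y0P y1; have [yy2 dy2] := Y0P y2.
  suff : `|Y0 y1 x - Y0 y2 x| <= C1 * (`|Y0 y1 0 - Y0 y2 0| + 0).
    by rewrite yy1 yy2 addr0.
  apply: (G1 (fun x => Y0 y1 x - Y0 y2 x)
    (fun x => F (cb (Y0 y1 x)) - F (cb (Y0 y2 x)))) => //.
    by move=> t t01; apply: is_derive_subl; [exact: dy1|exact: dy2].
  by move=> t t01; rewrite addr0; exact: FL.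
have [Z ZP] : exists Z : 'cV[R]_p -> R -> 'M[R]_p, forall y, Z y 0 = 1%:M /\
    forall x : R, 0 <= x <= 1 -> is_derive x 1 (Z y) (DF (cb (Y0 y x)) *m Z y x).
  have ex y : exists Z : R -> 'M[R]_p, Z 0 = 1%:M /\
      forall x : R, 0 <= x <= 1 -> is_derive x 1 Z (DF (cb (Y0 y x)) *m Z x).
    (* The two projections make the coefficient continuous on the whole line and bounded by [K]. *)
    pose A x := DF (cb (Y0 y (clamp 0 1 x))).
    have cA : continuous A.
      have c1 : continuous (fun y => DF (cb y)).
        apply: (@lip_continuous R _ _ _ K) => y1 y2.
        apply: le_trans (DL _ _ (cbin _) (cbin _)) _.
        by rewrite ler_wpM2l//; exact: clamp_ball_lip.
      have c0 : continuous (clamp 0 1 : R -> R).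
        by apply: (@lip_continuous R _ _ _ 1) => s t; rewrite mul1r; exact: clamp_lip.
      have c2 x : {for clamp 0 1 x, continuous (Y0 y)}.
        exact: (is_derive_continuous (proj2 (Y0P y) _ (clamp_in x ler01))).
      move=> x; have c3 := @continuous_comp _ _ _ (clamp 0 1) (Y0 y) x (c0 x) (c2 x).
      exact: (@continuous_comp _ _ _ _ (fun y => DF (cb y)) x c3 (c1 _)).
    have pK0 : 0 < p%:R * K + 1 :> R by rewrite ltr_wpDl// mulr_ge0.
    have [||Z Z0 dZ] := @picard R p p (fun x B => A x *m B) (p%:R * K + 1) 1%:M pK0.
    - move=> u cu x; apply/cvg_mxP => i j; under eq_fun do rewrite mxE.
      rewrite mxE; apply: cvg_big; first exact: add_continuous.
      move=> k _; have h1 := (continuous_mxP A x).1 (cA x) i k.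
      have h2 := (continuous_mxP u x).1 (cu x) k j.
      exact: (cvgM h1 h2).
    - move=> x B1 B2; rewrite -mulmxBr.
      apply: (@le_trans _ _ (p%:R * K * `|B1 - B2|)).
        by apply: norm_mulmx_le2 => //; exact: DK.
      by rewrite ler_wpM2r// lerDl.
    - exists Z; split=> // x x01; have := dZ x x01.
      by rewrite /A clamp_id.
  by have [Z ZP] := choice ex; exists Z.
have [C2 C21 G2] := @gronwall01 p 1 (p%:R * K) (mulr_ge0 (ler0n _ _) K0).
have C20 : 0 < C2 by exact: lt_le_trans C21.
exists r0, Y0, (fun y => Z y 1), (C2 * K * C1 * C1 + 1).
have C0 : 0 <= C2 * K * C1 * C1 by rewrite !mulr_ge0// ltW.
split.
- split; last by rewrite ltr_wpDl.
  by rewrite r00/= -r0C -[leLHS]mul1r ler_pM2r.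
- move=> y yr; split=> [|x x01]; first exact: (proj1 (Y0P y)).
  by split; [exact: Yin2|exact: dY].
- move=> y y1 y2 yr y1r y2r.
  have one01 : 0 <= (1 : R) <= 1 by rewrite ler01 lexx.
  (* The error of the linear approximation solves z' = DF(Y) z plus the first-order remainder of [F]
     along the three solutions. *)
  pose z x := Y0 y1 x - Y0 y2 x - Z y x *m (y1 - y2).
  pose dz x := F (Y0 y1 x) - F (Y0 y2 x) - DF (Y0 y x) *m Z y x *m (y1 - y2).
  have z0 : z 0 = 0.
    by rewrite /z !(proj1 (Y0P _)) (proj1 (ZP _)) mul1mx subrr.
  have dzP (x : R) : 0 <= x <= 1 -> is_derive x 1 z (dz x).
    move=> x01; apply: is_derive_subl.
      by apply: is_derive_subl; exact: dY.
    apply: is_derive_mulmxr; have := (proj2 (ZP y)) x x01.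
    by rewrite /cb clamp_ball_id//; exact: Yin3.
  (* This bounds that remainder: the expansion of [F] is combined with the Lipschitz dependence of
     the solutions on their initial data. *)
  pose b := K * (C1 * `|y1 - y| + C1 * `|y2 - y|) * (C1 * `|y1 - y2|).
  have C1ge0 := ltW C10.
  have b0 : 0 <= b by rewrite /b !(mulr_ge0, addr_ge0).
  have := G2 z dz b b0 dzP _ 1 one01.
  rewrite z0 normr0 add0r => G; apply: le_trans (G _) _ => [x x01|]; last first.
    have -> : C2 * b = C2 * K * C1 * C1 * (`|y1 - y| + `|y2 - y|) * `|y1 - y2|.
      by rewrite /b; ring.
    by rewrite ler_wpM2r// ler_wpM2r ?addr_ge0// lerDl.
  have -> : dz x = DF (Y0 y x) *m z x +
     (F (Y0 y1 x) - F (Y0 y2 x) - DF (Y0 y x) *m (Y0 y1 x - Y0 y2 x)).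
    rewrite /dz /z; move: (Y0 y1 x - Y0 y2 x) (y1 - y2) => u d.
    by rewrite mulmxBr mulmxA [RHS]addrC subrKA.
  apply: le_trans (ler_normD _ _) _; apply: lerD.
    by apply: norm_mulmx_le2 => //; apply: DK; exact: Yin3.
  apply: le_trans (HF _ _ _ (Yin3 y x yr x01) (Yin3 y1 x y1r x01) (Yin3 y2 x y2r x01)) _.
  rewrite /b; apply: ler_pM => //; last exact: YL.
    by rewrite mulr_ge0// addr_ge0.
  by apply: ler_wpM2l => //; apply: lerD; exact: YL.
- exists (Z a); split=> //; first exact: (proj1 (ZP a)).
  move=> x x01; have := (proj2 (ZP a)) x x01.
  have -> : Y0 a x = a; last by rewrite cba.
  apply/eqP; rewrite -subr_eq0 -normr_le0; apply: le_trans (Yin a x x01) _.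
  by rewrite subrr normr0 mulr0.
Qed.

End Flow.

(** * Smooth functions *)

Section Cdiff.
Context {R : realType}.

(* Unlike [Ck], the derivative is only constrained on [D], so that the calculus
   rules need no extensionality argument on germs. *)
Fixpoint Cdiff (V : normedModType R) (k : nat) (D : set V) (f : V -> R) : Prop :=
  match k with
  | 0 => forall x, D x -> {for x, continuous f}
  | k'.+1 => (forall x, D x -> differentiable f x) /\
      forall v : V, exists2 g, Cdiff k' D g & forall x, D x -> is_derive x v f (g x)
  end.

Context {V : normedModType R}.
Implicit Types (D : set V) (f g : V -> R) (k : nat).

Lemma Cdiff_coord k D p q (F : V -> 'M[R]_(p, q)) i j :
  Ck k D F -> Cdiff k D (fun x => F x i j).
Proof.
elim: k F => [F CF x Dx|k IH F [dF CF]].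
  exact: ((continuous_mxP F x).1 (CF x Dx) i j).
split=> [x Dx|v].
  apply: (@differentiable_comp _ _ _ _ F (fun A : 'M[R]_(p, q) => A i j : R)).
    exact: dF.
  exact: differentiable_coord.
exists (fun x => 'D_v F x i j); first exact: (IH (fun x => 'D_v F x) (CF v)).
move=> x Dx; have dFv := @diff_derivable _ _ _ F x v (dF x Dx).
exact: ((is_derive_mxP F x v _).1 (derivableP dFv) i j).
Qed.

Lemma CdiffW k D f : Cdiff k.+1 D f -> Cdiff k D f.
Proof.
elim: k f => [f [df _] x Dx|k IH f [df Cf]].
  exact: differentiable_continuous (df x Dx).
by split=> // v; have [g Cg hg] := Cf v; exists g => //; exact: IH.
Qed.

Lemma Cdiff_cst k D c : Cdiff k D (fun=> c).
Proof.
elim: k c => [c x _|k IH c]; first exact: cvg_cst.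
split=> [x _|v]; first exact: differentiable_cst.
by exists (fun=> 0) => // x _; exact: is_derive_cst.
Qed.

Lemma CdiffD k D f g : Cdiff k D f -> Cdiff k D g -> Cdiff k D (fun x => f x + g x).
Proof.
elim: k f g => [f g cf cg x Dx|k IH f g [df Cf] [dg Cg]].
  by apply: cvgD; [exact: cf|exact: cg].
split=> [x Dx|v].
  exact: (differentiableD (df x Dx) (dg x Dx)).
have [f' Cf' hf] := Cf v; have [g' Cg' hg] := Cg v.
exists (fun x => f' x + g' x); first exact: IH.
by move=> x Dx; exact: (is_deriveD (hf x Dx) (hg x Dx)).
Qed.

Lemma CdiffM k D f g : Cdiff k D f -> Cdiff k D g -> Cdiff k D (fun x => f x * g x).
Proof.
elim: k f g => [f g cf cg x Dx|k IH f g Cf Cg].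
  by apply: cvgM; [exact: cf|exact: cg].
have [f0 g0] := (CdiffW Cf, CdiffW Cg).
have [[df {}Cf] [dg {}Cg]] := (Cf, Cg).
split=> [x Dx|v].
  exact: (differentiableM (df x Dx) (dg x Dx)).
have [f' Cf' hf] := Cf v; have [g' Cg' hg] := Cg v.
exists (fun x => f x * g' x + g x * f' x); first by apply: CdiffD; exact: IH.
by move=> x Dx; exact: (is_deriveM (hf x Dx) (hg x Dx)).
Qed.

Lemma CdiffV k D f : (forall x, D x -> f x != 0) -> Cdiff k D f ->
  Cdiff k D (fun x => (f x)^-1).
Proof.
move=> f0; elim: k => [cf x Dx|k IH Cf].
  by apply: cvgV; [exact: f0|exact: cf].
have {}IH := IH (CdiffW Cf); have [df {}Cf] := Cf.
split=> [x Dx|v].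
  exact: (differentiableV (df x Dx) (f0 x Dx)).
have [f' Cf' hf] := Cf v.
exists (fun x => - 1 * ((f x)^-1 * (f x)^-1) * f' x).
  by apply: CdiffM => //; apply: CdiffM; [exact: Cdiff_cst|exact: CdiffM].
move=> x Dx; have [fd fE] := hf x Dx.
apply: DeriveDef; first exact: (derivableV (f0 x Dx) fd).
rewrite (deriveV (f0 x Dx) fd) fE /GRing.scale/=.
by rewrite -exprVn expr2; ring.
Qed.

Lemma Cdiff_sum k D (I : finType) (F : I -> V -> R) :
  (forall i, Cdiff k D (F i)) -> Cdiff k D (fun x => \sum_i F i x).
Proof.
move=> CF; elim: (index_enum I) => [|i s IH].
  by under eq_fun do rewrite big_nil; exact: Cdiff_cst.
by under eq_fun do rewrite big_cons; exact: CdiffD.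
Qed.

Lemma Cdiff_prod k D (I : finType) (F : I -> V -> R) :
  (forall i, Cdiff k D (F i)) -> Cdiff k D (fun x => \prod_i F i x).
Proof.
move=> CF; elim: (index_enum I) => [|i s IH].
  by under eq_fun do rewrite big_nil; exact: Cdiff_cst.
by under eq_fun do rewrite big_cons; exact: CdiffM.
Qed.

(** Determinant and adjugate are polynomials in the entries; together with the rule for reciprocals,
    Cramer's formula then gives the regularity of an inverse matrix. *)
Lemma Cdiff_det k D n (A : V -> 'M[R]_n) :
  (forall i j, Cdiff k D (fun x => A x i j)) -> Cdiff k D (fun x => \det (A x)).
Proof.
move=> CA; apply: Cdiff_sum => s; apply: CdiffM; first exact: Cdiff_cst.
by apply: Cdiff_prod => i; exact: CA.
Qed.

Lemma Cdiff_adj k D n (A : V -> 'M[R]_n) i j :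
  (forall i j, Cdiff k D (fun x => A x i j)) ->
  Cdiff k D (fun x => (\adj (A x)) i j).
Proof.
move=> CA; under eq_fun do rewrite mxE; apply: CdiffM; first exact: Cdiff_cst.
by apply: Cdiff_det => a b; under eq_fun do rewrite !mxE; exact: CA.
Qed.

(** By linearity of [l] the two difference quotients are the same function of the increment. *)
Lemma is_derive_comp_lin (U W : normedModType R) (l : {linear U -> V}) (f : V -> W) x v w :
  is_derive (l x) (l v) f w -> is_derive x v (f \o l) w.
Proof.
have E : (fun h : R => h^-1 *: ((f \o l) (h *: v + x) - (f \o l) x)) =
         (fun h : R => h^-1 *: (f (h *: l v + l x) - f (l x))).
  by apply/funext => h; rewrite /= linearP.
case=> fd fw; apply: DeriveDef; first by rewrite /derivable E.
by rewrite /derive E.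
Qed.

Lemma Cdiff_lin (U : normedModType R) (l : {linear U -> V}) k D f : continuous l ->
  Cdiff k D f -> Cdiff k (l @^-1` D) (f \o l).
Proof.
move=> cl; elim: k f => [f cf x Dx|k IH f [df Cf]].
  by apply: continuous_comp; [exact: cl|exact: cf].
split=> [x Dx|v].
  apply: differentiable_comp; first exact: linear_differentiable.
  exact: df.
have [g Cg hg] := Cf (l v); exists (g \o l); first exact: IH.
by move=> x Dx; apply: is_derive_comp_lin; exact: hg.
Qed.

End Cdiff.

(** * From C^2 regularity to uniform first-order expansions *)

Section C11.
Context {R : realType}.

Lemma diff_partials p (W : normedModType R) (f : 'cV[R]_p -> W) (f' : 'I_p -> W) x d :
  differentiable f x ->
  (forall j, is_derive x (delta_mx j 0) f (f' j)) ->
  is_derive x d f (\sum_j d j 0 *: f' j).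
Proof.
move=> df hf; apply: DeriveDef; first exact: diff_derivable.
rewrite deriveE// [d in LHS]matrix_sum_delta linear_sum; apply: eq_bigr => j _.
rewrite linear_sum big_ord1 linearZ; congr (_ *: _).
by rewrite -deriveE//; exact: derive_val.
Qed.

Lemma is_derive_line (V W : normedModType R) (f : V -> W) (y d : V) (t : R) w :
  is_derive (y + t *: d) d f w -> is_derive t 1 (fun s => f (y + s *: d)) w.
Proof.
have E : (fun h : R => h^-1 *: (f (y + (h *: (1 : R) + t) *: d) - f (y + t *: d))) =
         (fun h : R => h^-1 *: (f (h *: d + (y + t *: d)) - f (y + t *: d))).
  apply/funext => h; congr (_ *: (f _ - _)).
  have -> : h *: (1 : R) = h by rewrite /GRing.scale/= mulr1.
  by rewrite scalerDl addrCA.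
by case=> fd fw; apply: DeriveDef; rewrite /derivable /derive E.
Qed.

Lemma MVT_partials p (f : 'cV[R]_p -> R) (f' : 'I_p -> 'cV[R]_p -> R) y1 y2 :
  (forall t : R, 0 <= t <= 1 -> differentiable f (y2 + t *: (y1 - y2))) ->
  (forall (t : R) j, 0 <= t <= 1 ->
     is_derive (y2 + t *: (y1 - y2)) (delta_mx j 0) f (f' j (y2 + t *: (y1 - y2)))) ->
  exists2 t : R, 0 <= t <= 1 &
    f y1 - f y2 = \sum_j (y1 - y2) j 0 * f' j (y2 + t *: (y1 - y2)).
Proof.
move=> df hf; set d := y1 - y2.
pose phi t := f (y2 + t *: d).
pose phi' t := \sum_j d j 0 *: f' j (y2 + t *: d).
have dphi (t : R) : 0 <= t <= 1 -> is_derive t 1 phi (phi' t).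
  move=> t01; apply: is_derive_line; apply: diff_partials; first exact: df.
  by move=> j; exact: hf.
have [||t t01] := @MVT R phi phi' 0 1 ltr01.
- move=> t; rewrite in_itv/= => /andP[t0 t1]; apply: dphi.
  by rewrite !ltW.
- apply: continuous_in_subspaceT => t; rewrite inE/= in_itv/= => t01.
  exact: is_derive_continuous (dphi t t01).
- rewrite /phi scale1r scale0r addr0 subr0 mulr1 /d subrKC => E.
  exists t => //; move: t01; rewrite in_itv/= => /andP[t0 t1].
  by rewrite !ltW.
Qed.

Lemma segment_ball p (a y1 y2 : 'cV[R]_p) (rho t : R) : 0 <= t <= 1 ->
  `|y1 - a| <= rho -> `|y2 - a| <= rho -> `|y2 + t *: (y1 - y2) - a| <= rho.
Proof.
move=> /andP[t0 t1] h1 h2.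
have -> : y2 + t *: (y1 - y2) - a = t *: (y1 - a) + (1 - t) *: (y2 - a).
  by apply/matrixP => i j; rewrite !mxE; ring.
apply: le_trans (ler_normD _ _) _; rewrite !normrZ (ger0_norm t0) ger0_norm ?subr_ge0//.
by nra.
Qed.

Lemma segment_dist p (y y1 y2 : 'cV[R]_p) (t : R) : 0 <= t <= 1 ->
  `|y2 + t *: (y1 - y2) - y| <= `|y1 - y| + `|y2 - y|.
Proof.
by move=> t01; apply: segment_ball => //; rewrite ?lerDl ?lerDr.
Qed.

Lemma sum_dist_le p (d : 'cV[R]_p) (u : 'I_p -> R) (M : R) : 0 <= M ->
  (forall j, `|u j| <= M) -> `|\sum_j d j 0 * u j| <= p%:R * M * `|d|.
Proof.
move=> M0 uM; apply: le_trans (ler_norm_sum _ _ _) _.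
apply: (@le_trans _ _ (\sum_(j < p) M * `|d|)).
  apply: ler_sum => j _; rewrite normrM mulrC ler_pM//.
  exact: mx_entry_le_norm.
by rewrite sumr_const card_ord -[X in X <= _]mulr_natl mulrA.
Qed.

(** Continuity at [a] bounds the first and second partial derivatives near [a]; the mean value
    theorem on segments, which stay in the convex ball, gives the three estimates. The last clause
    ties the abstract [DF] to the partial derivatives of [F]. *)
Lemma Cdiff_c11 p s (F : 'cV[R]_p -> 'cV[R]_s) (D : set 'cV[R]_p) a :
  open D -> D a -> (forall i, Cdiff 2 D (fun y => F y i 0)) ->
  exists (DF : 'cV[R]_p -> 'M[R]_(s, p)) (rho K : R),
    [/\ 0 < rho, 0 <= K, forall y, `|y - a| <= rho -> D y,
        c11_on F DF a rho K &
        forall y, `|y - a| <= rho ->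
          forall j, is_derive y (delta_mx j 0) F (col j (DF y))].
Proof.
move=> oD Da CF.
have ex1 (ij : 'I_s * 'I_p) : exists g, Cdiff 1 D g /\ forall x, D x ->
    is_derive x (delta_mx ij.2 0) (fun y => F y ij.1 0) (g x).
  by have [_ /(_ (delta_mx ij.2 0)) [g ? ?]] := CF ij.1; exists g.
have [G GP] := choice ex1.
have ex2 (ijk : 'I_s * 'I_p * 'I_p) : exists g, Cdiff 0 D g /\ forall x, D x ->
    is_derive x (delta_mx ijk.2 0) (G ijk.1) (g x).
  have [[_ /(_ (delta_mx ijk.2 0)) [g ? ?]] _] := GP ijk.1.
  by exists g.
have [H HP] := choice ex2.
have bnd (I : finType) (g : I -> 'cV[R]_p -> R) :
    (forall i, {for a, continuous (g i)}) ->
    exists2 M : R, 0 <= M & \forall y \near a, forall i, `|g i y| <= M.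
  move=> cg; exists (\sum_i `|g i a| + 1).
    by rewrite addr_ge0// sumr_ge0.
  have h i : \forall y \near a, `|g i y| <= \sum_i `|g i a| + 1.
    have : \forall y \near a, `|g i a - g i y| <= 1.
      exact: ((cvgrPdist_le _ _).1 (cg i) _ ltr01).
    apply: filterS => y h.
    rewrite -(subrK (g i a) (g i y)); apply: le_trans (ler_normD _ _) _.
    rewrite addrC lerD//; last by rewrite distrC.
    by rewrite (bigD1 i)//= lerDl sumr_ge0.
  exact: (filter_forall _ h).
have [M1 M10 near1] := bnd _ G (fun ij => CdiffW (GP ij).1 a Da).
have [M2 M20 near2] := bnd _ H (fun ijk => (HP ijk).1 a Da).
have /nbhs_ballP[r /= r0 hr] :
    \forall y \near a, [/\ D y, forall i, `|G i y| <= M1 & forall i, `|H i y| <= M2].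
  near=> y; split; last by near: y.
    by near: y; exact: open_nbhs_nbhs.
  by near: y.
pose rho := r / 2.
have rho0 : 0 < rho by rewrite divr_gt0.
have inr y : `|y - a| <= rho ->
    [/\ D y, forall i, `|G i y| <= M1 & forall i, `|H i y| <= M2].
  move=> yr; apply: hr; rewrite -ball_normE/= distrC.
  by apply: le_lt_trans yr _; rewrite /rho; lra.
have inD y : `|y - a| <= rho -> D y by case/inr.
pose DF y := \matrix_(i < s, j < p) G (i, j) y.
(* The summands serve the three estimates: the size of [DF], its Lipschitz constant and the
   first-order remainder. *)
pose K := M1 + p%:R * M2 + p%:R * (p%:R * M2).
have K1 : M1 <= K by rewrite /K -addrA lerDl addr_ge0// !mulr_ge0.
have K2 : p%:R * M2 <= K by rewrite /K addrAC lerDr addr_ge0// !mulr_ge0.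
have K3 : p%:R * (p%:R * M2) <= K by rewrite /K lerDr addr_ge0// !mulr_ge0.
have K0 : 0 <= K by exact: le_trans K1.
have GL ij y y' : `|y - a| <= rho -> `|y' - a| <= rho ->
    `|G ij y - G ij y'| <= p%:R * M2 * `|y - y'|.
  move=> yr yr'.
  have [|t j t01|t t01 ->] := @MVT_partials p (G ij) (fun j => H (ij, j)) y y'.
  - move=> t t01; have [[dG _] _] := GP ij; apply: dG; apply: inD.
    exact: segment_ball.
  - by apply: (HP (ij, j)).2; apply: inD; exact: segment_ball.
  - apply: sum_dist_le => // j.
    by have [_ _] := inr _ (segment_ball t01 yr yr'); exact.
exists DF, rho, K; split => //.
- split.
  + move=> y yr; apply: mx_norm_leP => // i j.
    by rewrite mxE; apply: le_trans K1; have [_ + _] := inr y yr; apply.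
  + move=> y y1 y2 yr yr1 yr2; apply: mx_norm_leP => [|i j].
      by rewrite !mulr_ge0// addr_ge0.
    rewrite !mxE ord1.
    have [|t k t01|t t01 E] := @MVT_partials p (fun y => F y i 0)
      (fun j => G (i, j)) y1 y2.
    * move=> t t01; have [dF _] := CF i; apply: dF; apply: inD.
      exact: segment_ball.
    * by apply: (GP (i, k)).2; apply: inD; exact: segment_ball.
    rewrite E -sumrB.
    rewrite (eq_bigr (fun k => (y1 - y2) k 0 *
        (G (i, k) (y2 + t *: (y1 - y2)) - G (i, k) y))); last first.
      by move=> k _; rewrite !mxE; ring.
    apply: (@le_trans _ _ (p%:R * (p%:R * M2 * (`|y1 - y| + `|y2 - y|)) * `|y1 - y2|)).
      apply: sum_dist_le => [|k]; first by rewrite !mulr_ge0// addr_ge0.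
      apply: le_trans (GL _ _ _ (segment_ball t01 yr1 yr2) yr) _.
      by rewrite ler_wpM2l ?mulr_ge0//; exact: segment_dist.
    by rewrite ler_wpM2r// mulrA ler_wpM2r// addr_ge0.
  + move=> y y' yr yr'; apply: mx_norm_leP => [|i j].
      by rewrite mulr_ge0.
    rewrite !mxE; apply: le_trans (GL _ _ _ yr yr') _.
    by rewrite ler_wpM2r.
- move=> y yr j; apply/is_derive_mxP => i k; rewrite !mxE ord1.
  by apply: (GP (i, j)).2; exact: inD.
Unshelve. all: by end_near. Qed.

End C11.

(** * The resonance condition *)

Section Spectrum.
Context {R : realType}.

Lemma nonunit_kernel n (S : 'M[R]_n) : S \notin unitmx ->
  exists2 v : 'rV[R]_n, v *m S = 0 & v != 0.
Proof.
rewrite -row_free_unit -kermx_eq0 => /rowV0Pn[v /sub_kermxP vS v0].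
by exists v.
Qed.

Lemma spectrum0_unitmx n (M : 'M[R]_n) : ~ spectrum M 0 -> M \in unitmx.
Proof.
move=> M0; apply: contrapT => /negP /nonunit_kernel[v vM v0]; apply: M0.
apply/eigenvalueP; exists (map_mx (real_complex R) v).
  by rewrite -map_mxM vM map_mx0 scale0r.
by rewrite map_mx_eq0.
Qed.

Lemma real_complex_real (x : R) : real_complex R x \is Num.real.
Proof. by rewrite realE !ler0c lecR -realE num_real. Qed.

Local Open Scope sesquilinear_scope.

(** If v S = 0 then v (S + S^T) v^T = 0. Diagonalising the symmetric matrix by a unitary one writes
    this as a sum of terms d_i |w_i|^2 with d_i > 0, which forces v = 0. *)
Lemma posdef_unitmx n (S : 'M[R]_n) :
  (forall z : R[i], spectrum (S + S^T) z -> 0 < z) -> S \in unitmx.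
Proof.
move=> pos; apply: contrapT => /negP /nonunit_kernel[v vS v0].
pose A := map_mx (real_complex R) (S + S^T); pose u := map_mx (real_complex R) v.
have uC : u ^t* = u^T.
  by apply/matrixP => i j; rewrite !mxE; apply/CrealP; exact: real_complex_real.
have uAu : u *m A *m u^T = 0.
  rewrite /u /A map_trmx -!map_mxM mulmxDr vS add0r -mulmxA -trmx_mul vS trmx0.
  by rewrite mulmx0 map_mx0.
have An : A \is normalmx.
  apply: symmetric_normalmx.
    apply/is_hermitianmxP; rewrite expr0 scale1r map_mx_id//.
    by rewrite /A map_trmx linearD/= trmxK addrC.
  by apply/mxOverP => i j; rewrite mxE; exact: real_complex_real.
have /orthomx_spectralP AE := An.
set P := spectralmx A in AE; set d := spectral_diag A in AE.
have Pu : P \in unitmx by exact: spectral_unit.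
have Pinv : invmx P = P ^t* by apply: invmx_unitary; exact: spectral_unitarymx.
(* The rows of the unitary matrix [P] are left eigenvectors, nonzero because [P] is invertible. *)
have dpos i : 0 < d 0 i.
  apply: pos; apply/eigenvalueP; exists (row i P).
    rewrite -/A {1}AE mulmxA -row_mul mulmxA mulmxV// mul1mx -row_mul mul_diag_mx.
    by apply/rowP => j; rewrite !mxE.
  apply/eqP => P0; have := congr1 (mulmx^~ (invmx P)) P0.
  rewrite -row_mul mulmxV// mul0mx => /rowP/(_ i); rewrite !mxE eqxx => /eqP.
  by rewrite oner_eq0.
pose w := u *m invmx P.
have wP : u = w *m P by rewrite /w mulmxKV.
have w0 : \sum_i w 0 i * d 0 i * (w 0 i)^* = 0.
  have : w *m diag_mx d *m w ^t* = 0.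
    have wt : u ^t* = invmx P *m w ^t* by rewrite {1}wP trmx_mul map_mxM Pinv.
    by rewrite -uAu AE -uC wt !mulmxA (mulmxK Pu).
  move=> /matrixP/(_ 0 0); rewrite mxE [X in _ = X]mxE => E; rewrite -[RHS]E.
  by apply: eq_bigr => i _; rewrite mul_mx_diag !mxE.
have nn i : 0 <= w 0 i * d 0 i * (w 0 i)^*.
  rewrite mulrAC; apply: mulr_ge0; last exact: ltW.
  exact: mul_conjC_ge0.
have /psumr_eq0P h := w0.
have {}w0 : w = 0.
  apply/rowP => i; rewrite [RHS]mxE; have /eqP := h (fun i _ => nn i) i isT.
  by rewrite mulrAC mulf_eq0 mul_conjC_eq0 (gt_eqF (dpos i)) orbF => /eqP.
by move: v0; rewrite -(map_mx_eq0 (real_complex R)) -/u wP w0 mul0mx eqxx.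
Qed.


(** After reduction of [b] to [r] in [0, 2 pi), the half-angle formula cos r = 1 - 2 sin^2(r / 2)
    and the positivity of the sine on (0, pi) leave only r = 0. *)
Lemma cos1_2pi (b : R) : cos b = 1 -> exists k : int, b = 2 * pi * k%:~R.
Proof.
move=> cb; have pi0 := pi_gt0 R.
have p2 : 0 < 2 * pi :> R by rewrite mulr_gt0.
pose k := Num.floor (b / (2 * pi)); exists k.
have /andP[k1 k2] := floor_itv (b / (2 * pi)).
pose r := b - 2 * pi * k%:~R.
have r0 : 0 <= r.
  by rewrite subr_ge0 mulrC -ler_pdivlMr.
have r1 : r < 2 * pi.
  move: k2; rewrite ltr_pdivrMr// intrD mulrDl mul1r => k2.
  by rewrite /r; lra.
have cr : cos r = 1.
  have per n x : cos (x + 2 * pi * n%:R) = cos x :> R.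
    have -> : 2 * pi * n%:R = pi *+ 2 *+ n :> R.
      by rewrite -[RHS]mulr_natr -[pi *+ 2]mulr_natl.
    exact: (periodicn (@cosD2pi R)).
  suff : cos r = cos b by rewrite cb.
  rewrite /r; case: (k) => n.
    by rewrite -pmulrn -[LHS](per n) subrK.
  by rewrite NegzE mulrNz mulrN opprK -pmulrn per.
move: r0; rewrite le_eqVlt => /orP[/eqP r0|r0].
  by apply/eqP; rewrite -subr_eq0 -/r -r0.
have s0 : 0 < sin (r / 2) by apply: sin_gt0_pi; lra.
have : cos (r / 2 *+ 2) = 1 by rewrite -mulr_natr divfK.
rewrite cos_mulr2n; have := cos2Dsin2 (r / 2).
rewrite !expr2 mulr2n; have := mulr_gt0 s0 s0; lra.
Qed.

Lemma is_derive_eq0_const (g : R -> R) :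
  (forall x : R, 0 <= x <= 1 -> is_derive x 1 g 0) -> g 1 = g 0.
Proof.
move=> hg; have cg : {within `[0, 1], continuous g}.
  apply: continuous_in_subspaceT => x; rewrite inE/= in_itv/= => x01.
  exact: is_derive_continuous (hg x x01).
have H : `|g 1 - g 0| <= cst 0 (1 : R) - cst 0 (0 : R).
  apply: (@abs_ler_derive R g (cst 0) (cst 0) (cst 0)) => // [x|x|x _].
  - exact: cvg_cst.
  - by move=> /andP[x0 x1]; apply: hg; rewrite !ltW.
  - by rewrite normr0.
by apply/eqP; rewrite -subr_eq0 -normr_le0 (le_trans H)// /cst subrr.
Qed.

(* With [mu = a + b i] and [s = sp + sq i] this is the complex equation
   [s' = mu s + (P + Q i)], for which [exp(- mu x) s'(x)] is constant. *)
Lemma resonance (a b P Q : R) (sp sq : R -> R) :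
  (forall x : R, 0 <= x <= 1 -> is_derive x 1 sp (a * sp x - b * sq x + P)) ->
  (forall x : R, 0 <= x <= 1 -> is_derive x 1 sq (b * sp x + a * sq x + Q)) ->
  sp 0 = 0 -> sq 0 = 0 -> sp 1 = 0 -> sq 1 = 0 -> (P != 0) || (Q != 0) ->
  a = 0 /\ exists2 k : int, k != 0 & b = 2 * pi * k%:~R.
Proof.
move=> dp dq p0 q0 p1 q1 PQ.
(* These are the real and imaginary parts of s', which solves v' = mu v and takes the value P + Q i
   at both ends, where s vanishes. *)
pose vp x := a * sp x - b * sq x + P; pose vq x := b * sp x + a * sq x + Q.
have dvp (x : R) : 0 <= x <= 1 -> is_derive x 1 vp (a * vp x - b * vq x).
  move=> x01; rewrite -[X in is_derive _ _ _ X]addr0.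
  have h := is_derive_subl (is_derive_cmull a (dp x x01)) (is_derive_cmull b (dq x x01)).
  exact: (is_deriveD h (is_derive_cst P x 1)).
have dvq (x : R) : 0 <= x <= 1 -> is_derive x 1 vq (b * vp x + a * vq x).
  move=> x01; rewrite -[X in is_derive _ _ _ X]addr0.
  have h := is_deriveD (is_derive_cmull b (dp x x01)) (is_derive_cmull a (dq x x01)).
  exact: (is_deriveD h (is_derive_cst Q x 1)).
have dlin (x : R) : is_derive x 1 (fun y => b * y) b.
  by rewrite -[X in is_derive _ _ _ X]mulr1; apply: is_derive_cmull; exact: is_derive_id.
have dc (x : R) : is_derive x 1 (fun y => cos (b * y)) (- b * sin (b * x)).
  have := @is_derive1_comp R cos ( *%R b) x _ _ (is_derive_cos _) (dlin x).
  by rewrite mulNr mulrC -mulNr mulrC mulrN mulrC.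
have ds (x : R) : is_derive x 1 (fun y => sin (b * y)) (b * cos (b * x)).
  have := @is_derive1_comp R sin ( *%R b) x _ _ (is_derive_sin _) (dlin x).
  by rewrite mulrC.
have de (x : R) := is_derive_expRM (- a) x.
have dm (f g : R -> R) (x f' g' : R) : is_derive x 1 f f' -> is_derive x 1 g g' ->
    is_derive x 1 (fun y => f y * g y) (f x * g' + g x * f').
  by move=> hf hg; exact: (is_deriveM hf hg).
have da (f g : R -> R) (x f' g' : R) : is_derive x 1 f f' -> is_derive x 1 g g' ->
    is_derive x 1 (fun y => f y + g y) (f' + g').
  by move=> hf hg; exact: (is_deriveD hf hg).
(* [G] and [H] are the real and imaginary parts of e^(-mu x) s'(x). *)
pose G x := expR (- a * x) * (cos (b * x) * vp x + sin (b * x) * vq x).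
pose H x := expR (- a * x) * (cos (b * x) * vq x - sin (b * x) * vp x).
have G10 : G 1 = G 0.
  apply: is_derive_eq0_const => x x01.
  have := dm _ _ _ _ _ (de x)
    (da _ _ _ _ _ (dm _ _ _ _ _ (dc x) (dvp x x01)) (dm _ _ _ _ _ (ds x) (dvq x x01))).
  by congr is_derive; ring.
have H10 : H 1 = H 0.
  apply: is_derive_eq0_const => x x01.
  have := dm _ _ _ _ _ (de x)
    (is_derive_subl (dm _ _ _ _ _ (dc x) (dvq x x01)) (dm _ _ _ _ _ (ds x) (dvp x x01))).
  by congr is_derive; ring.
have vp0 : vp 0 = P by rewrite /vp p0 q0; ring.
have vq0 : vq 0 = Q by rewrite /vq p0 q0; ring.
have vp1 : vp 1 = P by rewrite /vp p1 q1; ring.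
have vq1 : vq 1 = Q by rewrite /vq p1 q1; ring.
move: G10 H10; rewrite /G /H vp0 vq0 vp1 vq1 !mulr1 !mulr0 expR0 cos0 sin0.
rewrite !mul0r addr0 subr0 !mul1r.
set e := expR (- a); set c := cos b; set s := sin b => e1 e2.
have n0 : 0 < P ^+ 2 + Q ^+ 2.
  case/orP: PQ => h.
    by rewrite ltr_pwDl ?sqr_ge0// exprn_even_gt0.
  by rewrite ltr_wpDl ?sqr_ge0// exprn_even_gt0.
have cs := cos2Dsin2 b.
(* [e1] and [e2] say that e^(-mu) fixes the nonzero number P + Q i. Taking squared moduli isolates
   the modulus [e] of e^(-mu). *)
have ee : e ^+ 2 = 1.
  apply: (@mulIf _ (P ^+ 2 + Q ^+ 2)); first by rewrite gt_eqF.
  have E : (e * (c * P + s * Q)) ^+ 2 + (e * (c * Q - s * P)) ^+ 2 =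
      P ^+ 2 + Q ^+ 2 by rewrite e1 e2.
  rewrite mul1r -[RHS]E -[e ^+ 2]mulr1 -cs -/c -/s.
  by ring.
have e1' : e = 1.
  by apply/eqP; rewrite -(@eqrXn2 _ 2) ?expR_ge0// ee expr1n.
have a0 : a = 0.
  by move: e1'; rewrite /e -expR0 => /expR_inj/eqP; rewrite oppr_eq0 => /eqP.
have c1 : c = 1.
  apply: (@mulIf _ (P ^+ 2 + Q ^+ 2)); first by rewrite gt_eqF.
  move: e1 e2; rewrite e1' !mul1r => e1 e2.
  transitivity (P * (c * P + s * Q) + Q * (c * Q - s * P)); first by ring.
  by rewrite e1 e2; ring.
split=> //; have [k bk] := cos1_2pi c1; exists k => //.
(* For k = 0 the equation reads s' = P + Q i, so s(1) = P + Q i would vanish. *)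
apply/eqP => k0; move: bk; rewrite k0 mulr0 => b0.
have P0 : P = 0.
  have := @is_derive_eq0_const (fun x => sp x - P * x) _.
  rewrite p1 p0 mulr1 mulr0 subr0 sub0r => /(_ _)/eqP.
  rewrite oppr_eq0 => h; apply/eqP; apply: h => x x01.
  have := is_derive_subl (dp x x01) (is_derive_cmull P (is_derive_id x 1)).
  by rewrite a0 b0; congr is_derive; ring.
have Q0 : Q = 0.
  have := @is_derive_eq0_const (fun x => sq x - Q * x) _.
  rewrite q1 q0 mulr1 mulr0 subr0 sub0r => /(_ _)/eqP.
  rewrite oppr_eq0 => h; apply/eqP; apply: h => x x01.
  have := is_derive_subl (dq x x01) (is_derive_cmull Q (is_derive_id x 1)).
  by rewrite a0 b0; congr is_derive; ring.
by move: PQ; rewrite P0 Q0 eqxx.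
Qed.

End Spectrum.

(** * Invertibility of (e^M - 1) / M *)

Section Phi.
Context {R : realType}.

(** The commutator solves X' = M X with X(0) = 0, so Gronwall's inequality with zero forcing makes
    it vanish. *)
Lemma commute_phi n (M : 'M[R]_n) (Phi : R -> 'M[R]_n) : Phi 0 = 0 ->
  (forall x : R, 0 <= x <= 1 -> is_derive x 1 Phi (M *m Phi x + 1%:M)) ->
  Phi 1 *m M = M *m Phi 1.
Proof.
move=> P0 dP; apply/eqP; rewrite -subr_eq0 -normr_le0.
have L0 : 0 <= n%:R * `|M| :> R by rewrite mulr_ge0.
have [C C1 G] := @gronwall01 R n n (n%:R * `|M|) L0.
have := G (fun x => Phi x *m M - M *m Phi x)
  (fun x => M *m (Phi x *m M - M *m Phi x)) 0 (lexx _) _ _ 1.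
rewrite P0 mul0mx mulmx0 subrr normr0 addr0 mulr0; apply; last by rewrite ler01 lexx.
  move=> x x01.
  have := is_derive_subl (is_derive_mulmxr M (dP x x01)) (is_derive_mulmxl M (dP x x01)).
  congr is_derive; rewrite mulmxDl mulmxDr mul1mx mulmx1 mulmxBr !mulmxA.
  by rewrite opprD addrACA subrr addr0.
by move=> x _; rewrite addr0; exact: norm_mulmx_le.
Qed.

Let Re_sum (I : finType) (F : I -> R[i]) :
  complex.Re (\sum_i F i) = \sum_i complex.Re (F i).
Proof. by apply: (big_morph (@complex.Re R)) => // -[x1 y1] [x2 y2]. Qed.

Let Im_sum (I : finType) (F : I -> R[i]) :
  complex.Im (\sum_i F i) = \sum_i complex.Im (F i).
Proof. by apply: (big_morph (@complex.Im R)) => // -[x1 y1] [x2 y2]. Qed.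

(** [T] is real, so the complex eigenvector equation splits into two real ones, to which real
    calculus applies. *)
Lemma complex_eigen_parts n (T : 'M[R]_n) (t : 'rV[R[i]]_n) (mu : R[i]) :
  t *m map_mx (real_complex R) T = mu *: t ->
  let p := map_mx (@complex.Re R) t in let q := map_mx (@complex.Im R) t in
  p *m T = complex.Re mu *: p - complex.Im mu *: q /\
  q *m T = complex.Im mu *: p + complex.Re mu *: q.
Proof.
move=> tT p q; have E j := congr1 (fun A : 'rV[R[i]]_n => A 0 j) tT.
split; apply/rowP => j; have := E j; rewrite !mxE.
  move=> /(congr1 (@complex.Re R)); rewrite Re_sum => H.
  transitivity (complex.Re (mu * t 0 j)); last first.
    by case: mu {tT E H} => a b; case: (t 0 j) => c d.
  rewrite -H; apply: eq_bigr => i _; rewrite !mxE.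
  by case: (t 0 i) => c d /=; rewrite mulr0 subr0.
move=> /(congr1 (@complex.Im R)); rewrite Im_sum => H.
transitivity (complex.Im (mu * t 0 j)); last first.
  by case: mu {tT E H} => a b; case: (t 0 j) => c d /=; rewrite addrC.
rewrite -H; apply: eq_bigr => i _; rewrite !mxE.
by case: (t 0 i) => c d /=; rewrite mulr0 add0r.
Qed.

(* [Phi 1] is [(e^M - 1) / M]. A left kernel vector of [Phi 1] can be chosen to
   be a left eigenvector of [M], because [M] commutes with [Phi 1]. *)
Lemma phi_unitmx n (M : 'M[R]_n) (Phi : R -> 'M[R]_n) : Phi 0 = 0 ->
  (forall x : R, 0 <= x <= 1 -> is_derive x 1 Phi (M *m Phi x + 1%:M)) ->
  (forall k : int, k != 0 -> ~ spectrum M (Complex 0 (2 * pi * k%:~R))) ->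
  Phi 1 \in unitmx.
Proof.
move=> P0 dP hspec; apply: contrapT => /negP nu.
have PM := commute_phi P0 dP.
pose V := row_base (kermx (Phi 1)); pose k := \rank (kermx (Phi 1)).
have Vfree : row_free V by exact: row_base_free.
have k0 : (0 < k)%N by rewrite lt0n mxrank_eq0 kermx_eq0 row_free_unit.
have VP : V *m Phi 1 = 0 by apply/sub_kermxP; rewrite eq_row_base.
(* The rows of [V] form a basis of the left kernel of [Phi 1], which [M] stabilises by commutation;
   [T] is the matrix of [M] in that basis. *)
pose T := V *m M *m pinvmx V.
have TV : T *m V = V *m M.
  apply: mulmxKpV; rewrite (eq_row_base (kermx _)).
  by apply/sub_kermxP; rewrite -mulmxA -PM mulmxA VP mul0mx.
have [mu /eigenvalueP[t tT t0]] := eigenvalue_closed (map_mx (real_complex R) T) k0.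
have [pT qT] := complex_eigen_parts tT.
set tp := map_mx _ t in pT qT; set tq := map_mx _ t in pT qT.
set a := complex.Re mu in pT qT; set b := complex.Im mu in pT qT.
pose p := tp *m V; pose q := tq *m V.
have pM : p *m M = a *: p - b *: q.
  by rewrite /p -mulmxA -TV mulmxA pT mulmxBl -!scalemxAl.
have qM : q *m M = b *: p + a *: q.
  by rewrite /q -mulmxA -TV mulmxA qT mulmxDl -!scalemxAl.
have pq0 : (p != 0) || (q != 0).
  rewrite -negb_and; apply/negP => /andP[/eqP p0 /eqP q0].
  have inj0 (s : 'rV_k) : s *m V = 0 -> s = 0.
    by move=> sV; apply: (row_free_inj Vfree); rewrite mul0mx.
  have tp0 := inj0 _ p0; have tq0 := inj0 _ q0.
  move/eqP: t0; apply; apply/rowP => j.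
  have := congr1 (fun A : 'rV[R]_k => A 0 j) tp0; have := congr1 (fun A : 'rV[R]_k => A 0 j) tq0.
  by rewrite !mxE; case: (t 0 j) => c d /= -> ->.
(* Column [j] is chosen so that the inhomogeneity p_j + q_j i of the scalar equation is nonzero. *)
have [j pqj] : exists j, (p 0 j != 0) || (q 0 j != 0).
  by case/orP: pq0 => /rV0Pn[j pj]; exists j; rewrite pj ?orbT.
have dl (l : 'rV[R]_n) (x : R) : 0 <= x <= 1 ->
    is_derive x 1 (fun y => (l *m Phi y) 0 j) ((l *m M *m Phi x) 0 j + l 0 j).
  move=> x01; have := (is_derive_mxP _ _ _ _).1 (is_derive_mulmxl l (dP x x01)) 0 j.
  by rewrite mulmxDr mulmx1 mulmxA [X in is_derive _ _ _ X]mxE.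
have end0 (l : 'rV[R]_k) : (l *m V *m Phi 1) 0 j = 0.
  by rewrite -mulmxA VP mulmx0 mxE.
have start0 (l : 'rV[R]_n) : (l *m Phi 0) 0 j = 0 by rewrite P0 mulmx0 mxE.
have [|||a0 [z z0 bz]] := @resonance R a b (p 0 j) (q 0 j)
  (fun y => (p *m Phi y) 0 j) (fun y => (q *m Phi y) 0 j) _ _
  (start0 p) (start0 q) (end0 tp) (end0 tq).
- by move=> x x01; have := dl p x x01; rewrite pM mulmxBl -!scalemxAl !mxE.
- by move=> x x01; have := dl q x x01; rewrite qM mulmxDl -!scalemxAl !mxE.
- exact: pqj.
(* The forbidden eigenvalue is realised by the vector t V, nonzero because the rows of [V] remain
   independent over the complex numbers. *)
apply: (hspec z z0); rewrite -bz.
have -> : Complex 0 b = mu by rewrite -a0 /a /b; case: (mu).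
apply/eigenvalueP; exists (t *m map_mx (real_complex R) V).
  by rewrite -mulmxA -map_mxM -TV map_mxM mulmxA tT -scalemxAl.
apply/eqP => tV0; move/eqP: t0; apply.
apply: (@row_free_inj _ _ _ _ (map_mx (real_complex R) V)); last by rewrite tV0 mul0mx.
by rewrite row_free_map.
Qed.

End Phi.

(** * Chain rules, block projections and a continuity argument *)

Section Helpers.
Context {R : realType}.

Lemma is_derive_comp_diff (V W : normedModType R) (f : V -> W) (u : R -> V) (x : R) v :
  is_derive x 1 u v -> differentiable f (u x) -> is_derive x 1 (f \o u) ('D_v f (u x)).
Proof.
move=> [ud uv] df; have du : differentiable u x by exact/derivable1_diffP.
have dfu : differentiable (f \o u) x by exact: differentiable_comp.
apply: DeriveDef; first exact: diff_derivable.
rewrite deriveE// diff_comp//=.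
have -> : 'd u x 1 = v by rewrite -deriveE.
by rewrite deriveE.
Qed.

Lemma jac_derive p q (f : 'cV[R]_p -> 'cV[R]_q) x w :
  differentiable f x -> is_derive x w f (jac f x *m w).
Proof.
move=> df.
have := @diff_partials R p _ f (fun j => 'D_(delta_mx j 0) f x) x w df.
move=> /(_ _)/= H; have {}H := H (fun j => derivableP (@diff_derivable _ _ _ f x (delta_mx j 0) df)).
rewrite (_ : jac f x *m w = \sum_j w j 0 *: 'D_(delta_mx j 0) f x)//.
apply/colP => i; rewrite mxE summxE; apply: eq_bigr => j _.
by rewrite !mxE mulrC.
Qed.

Lemma jac_comp p q (f : 'cV[R]_p -> 'cV[R]_q) (u : R -> 'cV[R]_p) (x : R) v :
  is_derive x 1 u v -> differentiable f (u x) ->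
  is_derive x 1 (f \o u) (jac f (u x) *m v).
Proof.
move=> uv df; have := is_derive_comp_diff uv df.
by have [_ <-] := jac_derive v df.
Qed.

Lemma is_derive_usubmx p q s (u : R -> 'M[R]_(p + q, s)) (x : R) v :
  is_derive x 1 u v -> is_derive x 1 (fun y => usubmx (u y)) (usubmx v).
Proof.
move=> /is_derive_mxP uv; apply/is_derive_mxP => i j; rewrite mxE.
by under [X in is_derive _ _ X _]eq_fun do rewrite mxE; exact: uv.
Qed.

Lemma is_derive_dsubmx p q s (u : R -> 'M[R]_(p + q, s)) (x : R) v :
  is_derive x 1 u v -> is_derive x 1 (fun y => dsubmx (u y)) (dsubmx v).
Proof.
move=> /is_derive_mxP uv; apply/is_derive_mxP => i j; rewrite mxE.
by under [X in is_derive _ _ X _]eq_fun do rewrite mxE; exact: uv.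
Qed.

Lemma is_derive_rsubmx p q s (u : R -> 'M[R]_(s, p + q)) (x : R) v :
  is_derive x 1 u v -> is_derive x 1 (fun y => rsubmx (u y)) (rsubmx v).
Proof.
move=> /is_derive_mxP uv; apply/is_derive_mxP => i j; rewrite mxE.
by under [X in is_derive _ _ X _]eq_fun do rewrite mxE; exact: uv.
Qed.

Lemma is_derive_zero_const p q (u : R -> 'M[R]_(p, q)) :
  (forall x : R, 0 <= x <= 1 -> is_derive x 1 u 0) ->
  forall x : R, 0 <= x <= 1 -> u x = u 0.
Proof.
move=> du x x01; have [C C1 G] := @gronwall01 R p q 0 (lexx _).
apply/eqP; rewrite -subr_eq0 -normr_le0.
have := G (fun x => u x - u 0) (fun=> 0) 0 (lexx _) _ _ x x01.
rewrite subrr normr0 addr0 mulr0; apply => [t t01|t _].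
  by rewrite -[X in is_derive _ _ _ X]subr0; exact: (is_derive_subl (du t t01) (is_derive_cst (u 0) t 1)).
by rewrite ?normr0 ?mul0r ?addr0 ?mul0r.
Qed.

Lemma norm_usubmx p q s (A : 'M[R]_(p + q, s)) : `|usubmx A| <= `|A|.
Proof. by rewrite -{2}(vsubmxK A) norm_col_mx le_max lexx. Qed.

Lemma norm_dsubmx p q s (A : 'M[R]_(p + q, s)) : `|dsubmx A| <= `|A|.
Proof. by rewrite -{2}(vsubmxK A) norm_col_mx le_max lexx orbT. Qed.

Lemma continuous_usubmx p q s : continuous (usubmx : 'M[R]_(p + q, s) -> 'M[R]_(p, s)).
Proof.
apply: (@lip_continuous R _ _ _ 1) => A B.
by rewrite mul1r -linearB; exact: norm_usubmx.
Qed.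

Lemma continuous_dsubmx p q s : continuous (dsubmx : 'M[R]_(p + q, s) -> 'M[R]_(q, s)).
Proof.
apply: (@lip_continuous R _ _ _ 1) => A B.
by rewrite mul1r -linearB; exact: norm_dsubmx.
Qed.

Lemma within_continuous_dist (W : normedModType R) (A : set R) (f : R -> W) (t e : R) :
  {within A, continuous f} -> A t -> 0 < e ->
  exists2 d : R, 0 < d & forall s, A s -> `|t - s| < d -> `|f t - f s| < e.
Proof.
move=> /subspace_continuousP cf At e0.
have : \forall s \near within A (nbhs t), `|f t - f s| < e.
  exact: ((cvgrPdist_lt _ _).1 (cf t At) e e0).
move=> /nbhs_ballP[d d0 h]; exists d => // s As ts.
by apply: h => //; rewrite -ball_normE.
Qed.

(* Continuity argument: a bound [rho] on an initial segment self-improves to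
   [rho / 2], hence it propagates to the whole interval. *)
Lemma escape (phi : R -> R) (rho : R) : 0 < rho ->
  {within `[0, 1], continuous phi} -> phi 0 <= rho ->
  (forall T : R, 0 <= T <= 1 -> (forall s : R, 0 <= s <= T -> phi s <= rho) ->
     phi T <= rho / 2) ->
  forall s : R, 0 <= s <= 1 -> phi s <= rho.
Proof.
move=> rho0 cphi phi0 improve.
pose G := [set T : R | 0 <= T <= 1 /\ forall s : R, 0 <= s <= T -> phi s <= rho].
have G0 : G 0.
  split=> [|s]; first by rewrite lexx ler01.
  by rewrite -eq_le => /eqP <-.
have Gub : ubound G 1 by move=> T [/andP[]].
have sG : has_sup G by split; [exists 0|exists 1].
pose t := sup G.
have t01 : 0 <= t <= 1.
  by rewrite (ub_le_sup sG.2 G0)/=; apply: ge_sup => //; exists 0.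
have Gt s : 0 <= s < t -> phi s <= rho / 2.
  move=> /andP[s0 st]; have ts : 0 < t - s by rewrite subr_gt0.
  have [T [/andP[T0 T1] GT]] := sup_adherent ts sG.
  rewrite -/t subKr => sT; apply: improve => [|s' /andP[s'0 s's]].
    by rewrite s0 (le_trans (ltW sT)).
  by apply: GT; rewrite s'0 (le_trans s's)// ltW.
(* With oscillation below rho / 4 near [t], the bound rho / 2 before [t] gives 3 rho / 4 at [t] and
   rho shortly after it. *)
have rho4 : 0 < rho / 4 by rewrite divr_gt0.
have [d d0 hd] := @within_continuous_dist _ _ phi t _ cphi t01 rho4.
have phit : phi t <= 3 / 4 * rho.
  have /andP[t0 t1] := t01; move: t0; rewrite le_eqVlt => /orP[/eqP t0|t0].
    have : phi 0 <= rho / 2.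
      apply: improve; first by rewrite lexx ler01.
      by move=> s; rewrite -eq_le => /eqP <-.
    by rewrite -t0; lra.
  pose s := Num.max 0 (t - d / 2).
  have s0 : 0 <= s by rewrite le_max lexx.
  have st : s < t by rewrite gt_max t0; lra.
  have sd : `|t - s| < d.
    by rewrite ger0_norm ?subr_ge0 ?ltW// ltrBlDl -ltrBlDr lt_max; apply/orP; right; lra.
  have := hd s; rewrite /= in_itv/= s0 (ltW (lt_le_trans st t1)) => /(_ isT sd).
  have := Gt s; rewrite s0 st => /(_ isT).
  by rewrite ltr_norml => ? /andP[]; lra.
(* The bound reaches [T], so T <= t by definition of the supremum; this is only possible when T =
   1. *)
pose T := Num.min 1 (t + d / 2).
have /andP[t0 t1] := t01.
have tT : t <= T by rewrite le_min t1/=; lra.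
have T1 : T <= 1 by rewrite ge_min lexx.
have GT : G T.
  split=> [|s /andP[s0 sT]]; first by rewrite (le_trans t0 tT).
  have [st|ts] := ltP s t; first by have := Gt s; rewrite s0 st => /(_ isT); lra.
  have sd : `|t - s| < d.
    rewrite distrC ger0_norm ?subr_ge0//.
    by move: sT; rewrite le_min => /andP[_]; lra.
  have := hd s; rewrite /= in_itv/= s0 (le_trans sT T1) => /(_ isT sd).
  by rewrite ltr_norml => /andP[]; lra.
have Tt : T <= t by apply: (ub_le_sup sG.2).
have T1' : T = 1.
  by move: Tt; rewrite /T; have [//|_] := leP 1 (t + d / 2); lra.
by move=> s s01; apply: GT.2; rewrite T1'.
Qed.

Context {V : normedModType R}.

Lemma Cdiff_mulmx k (D : set V) p q s (A : V -> 'M[R]_(p, q)) (B : V -> 'M[R]_(q, s)) :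
  (forall i j, Cdiff k D (fun x => A x i j)) ->
  (forall i j, Cdiff k D (fun x => B x i j)) ->
  forall i j, Cdiff k D (fun x => (A x *m B x) i j).
Proof.
move=> CA CB i j; under eq_fun do rewrite mxE.
by apply: Cdiff_sum => l; apply: CdiffM.
Qed.

Lemma Cdiff_col_mx k (D : set V) p q s (A : V -> 'M[R]_(p, s)) (B : V -> 'M[R]_(q, s)) :
  (forall i j, Cdiff k D (fun x => A x i j)) ->
  (forall i j, Cdiff k D (fun x => B x i j)) ->
  forall i j, Cdiff k D (fun x => (col_mx (A x) (B x)) i j).
Proof.
move=> CA CB i j; rewrite -(splitK i); case: (fintype.split i) => l /=.
  by under eq_fun do rewrite col_mxEu; exact: CA.
by under eq_fun do rewrite col_mxEd; exact: CB.
Qed.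

End Helpers.

Lemma Cdiff_entry {R : realType} k p q (D : set 'M[R]_(p, q)) i j :
  Cdiff k D (fun A : 'M[R]_(p, q) => A i j).
Proof.
case: k => [A _|k]; first exact: coord_continuous.
split=> [A _|v]; first exact: differentiable_coord.
exists (fun=> v i j); first exact: Cdiff_cst.
move=> A _; exact: ((is_derive_mxP id A v v).1 (is_derive_id A v) i j).
Qed.

(** * The differential-algebraic system *)

Section System.
Context {R : realType} (r m : nat) (D : set 'cV[R]_(r + m))
  (f : 'cV[R]_(r + m) -> 'cV[R]_(r + m)) (B22 : 'cV[R]_(r + m) -> 'M[R]_m)
  (U0 : 'cV[R]_(r + m)).
Context (hD : open D) (hf : smooth_on D f) (hB : smooth_on D (diffusion B22))
  (hU0 : D U0) (uA : forall U, D U -> ulsubmx (jac f U) \in unitmx)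
  (uB : forall U, D U -> B22 U \in unitmx).

(* Differentiating [f_I(U) = f_I(U0)] turns the differential-algebraic system
   into [sysmx U *m U' = (0, rhs U C2)], that is [U' = slope U C2]. *)
Definition sysmx (U : 'cV[R]_(r + m)) : 'M[R]_(r + m) :=
  block_mx (ulsubmx (jac f U)) (ursubmx (jac f U)) 0 (B22 U).

(** Cramer's formula, so that smoothness in [U] can be read off. It is the inverse of [sysmx U]
    wherever the determinant is a unit. *)
Definition sysinv (U : 'cV[R]_(r + m)) : 'M[R]_(r + m) :=
  (\det (sysmx U))^-1 *: \adj (sysmx U).

Definition rhs (U : 'cV[R]_(r + m)) (c : 'cV[R]_m) : 'cV[R]_m :=
  dsubmx (f U) - dsubmx (f U0) + B22 U0 *m c.

Definition slope (U : 'cV[R]_(r + m)) (c : 'cV[R]_m) : 'cV[R]_(r + m) :=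
  sysinv U *m col_mx 0 (rhs U c).

(** Carrying [C2] as a component with zero derivative turns dependence on the parameter into
    dependence on initial data. *)
Definition vfield (y : 'cV[R]_((r + m) + m)) : 'cV[R]_((r + m) + m) :=
  col_mx (slope (usubmx y) (dsubmx y)) 0.

Lemma det_sysmx_unit U : D U -> \det (sysmx U) \is a GRing.unit.
Proof.
by move=> DU; rewrite det_ublock unitrM -!unitmxE uA// uB.
Qed.

Lemma sysmxK U : D U -> sysmx U *m sysinv U = 1%:M.
Proof.
move=> DU; rewrite -scalemxAr mul_mx_adj scale_scalar_mx mulVr//.
exact: det_sysmx_unit.
Qed.

(** The two block rows of the linear system: the upper one makes [f_I] a first integral, the lower
    one is the equation for [U_II]. *)
Lemma slope_eq U c : D U ->
  usubmx (jac f U *m slope U c) = 0 /\ B22 U *m dsubmx (slope U c) = rhs U c.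
Proof.
move=> DU; have : sysmx U *m slope U c = col_mx 0 (rhs U c).
  by rewrite mulmxA sysmxK// mul1mx.
rewrite -[in X in X -> _](vsubmxK (slope U c)) mul_block_col mul0mx add0r.
move=> /eq_col_mx[top bot]; split=> //.
by rewrite -[jac f U]submxK -[slope U c]vsubmxK mul_block_col col_mxKu.
Qed.

(** A Cauchy solution only provides a derivative of [U_II]; since [B22 U] is invertible, the
    equation determines that derivative. *)
Lemma dsub_slopeP U c w : D U -> B22 U *m w = rhs U c -> w = dsubmx (slope U c).
Proof.
move=> DU; have [_ <-] := slope_eq c DU => E.
by rewrite -(mulKmx (uB DU) w) E mulKmx// uB.
Qed.

Lemma rhs0 : rhs U0 0 = 0.
Proof. by rewrite /rhs subrr mulmx0 addr0. Qed.

Lemma vfield0 : vfield (col_mx U0 0) = 0.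
Proof.
rewrite /vfield col_mxKu col_mxKd /slope rhs0 (_ : col_mx 0 0 = 0) ?mulmx0.
  by rewrite col_mx0.
by rewrite col_mx0.
Qed.

Lemma Cdiff_jac k i j : Cdiff k D (fun U => jac f U i j).
Proof.
under eq_fun do rewrite mxE.
have [_ Cf] := hf k.+1; exact: (Cdiff_coord i 0 (Cf (delta_mx j 0))).
Qed.

Lemma Cdiff_B22 k i j : Cdiff k D (fun U => B22 U i j).
Proof.
have := Cdiff_coord (rshift r i) (rshift r j) (hB k).
by under eq_fun do rewrite block_mxEdr.
Qed.

Lemma Cdiff_sysinv k i j : Cdiff k D (fun U => sysinv U i j).
Proof.
have CN a b : Cdiff k D (fun U => sysmx U a b).
  rewrite -(splitK a) -(splitK b).
  case: (fintype.split a) => s; case: (fintype.split b) => t /=;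
    rewrite /sysmx /block_mx.
  - by under eq_fun do rewrite col_mxEu row_mxEl 2!mxE; exact: Cdiff_jac.
  - by under eq_fun do rewrite col_mxEu row_mxEr 2!mxE; exact: Cdiff_jac.
  - by under eq_fun do rewrite col_mxEd row_mxEl mxE; exact: Cdiff_cst.
  - by under eq_fun do rewrite col_mxEd row_mxEr; exact: Cdiff_B22.
under eq_fun do rewrite mxE.
apply: CdiffM; last exact: Cdiff_adj.
apply: CdiffV; last exact: Cdiff_det.
by move=> U DU; rewrite -unitfE; exact: det_sysmx_unit.
Qed.

Local Notation D2 := ((usubmx : 'cV[R]_((r + m) + m) -> 'cV[R]_(r + m)) @^-1` D).

Lemma open_D2 : open D2.
Proof. by apply: open_comp => // y _; exact: continuous_usubmx. Qed.

Lemma Cdiff_usub k (g : 'cV[R]_(r + m) -> R) : Cdiff k D g ->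
  Cdiff k D2 (fun y => g (usubmx y)).
Proof.
move=> Cg; exact: (@Cdiff_lin _ _ _ (usubmx : {linear _ -> _}) _ _ _ (@continuous_usubmx _ _ _ _) Cg).
Qed.

Lemma Cdiff_rhs k i : Cdiff k D2 (fun y => rhs (usubmx y) (dsubmx y) i 0).
Proof.
have -> : (fun y : 'cV[R]_((r + m) + m) => rhs (usubmx y) (dsubmx y) i 0) =
    (fun y => f (usubmx y) (rshift r i) 0 + - f U0 (rshift r i) 0 +
      \sum_j B22 U0 i j * y (rshift (r + m) j) 0).
  apply/funext => y; rewrite !mxE; congr (_ + _).
  by apply: eq_bigr => j _; rewrite !mxE.
apply: CdiffD.
  apply: CdiffD; last exact: Cdiff_cst.
  exact: (Cdiff_usub (Cdiff_coord (rshift r i) 0 (hf k))).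
apply: Cdiff_sum => j; apply: CdiffM; first exact: Cdiff_cst.
exact: Cdiff_entry.
Qed.

Lemma Cdiff_rhs_col k i j :
  Cdiff k D2 (fun y => (col_mx 0 (rhs (usubmx y) (dsubmx y)) : 'cV[R]_(r + m)) i j).
Proof.
apply: Cdiff_col_mx => a b; last by rewrite ord1; exact: Cdiff_rhs.
by under eq_fun do rewrite mxE; exact: Cdiff_cst.
Qed.

Lemma Cdiff_vfield k i : Cdiff k D2 (fun y => vfield y i 0).
Proof.
apply: Cdiff_col_mx => {}i j; last first.
  by under eq_fun do rewrite mxE; exact: Cdiff_cst.
apply: Cdiff_mulmx => a b; last exact: Cdiff_rhs_col.
exact: (Cdiff_usub (Cdiff_sysinv k a b)).
Qed.

Lemma smooth_differentiable U : D U -> differentiable f U.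
Proof. by move=> DU; have [df _] := hf 1; exact: df. Qed.

(** The derivative of [vfield] at (U0, 0). It contains no derivative of [sysinv], because [rhs]
    vanishes at that point. *)
Definition linearization : 'M[R]_((r + m) + m) :=
  block_mx (sysinv U0 *m col_mx 0 (dsubmx (jac f U0)))
           (sysinv U0 *m col_mx 0 (B22 U0)) 0 0.

Lemma is_derive_rhs (d : 'cV[R]_((r + m) + m)) :
  is_derive (col_mx U0 0 : 'cV[R]_((r + m) + m)) d
    (fun y => rhs (usubmx y) (dsubmx y))
    (dsubmx (jac f U0) *m usubmx d + B22 U0 *m dsubmx d).
Proof.
have h1 : is_derive (col_mx U0 0 : 'cV[R]_((r + m) + m)) d
    (fun y => f (usubmx y)) (jac f U0 *m usubmx d).
  apply: (@is_derive_comp_lin _ _ _ _ (usubmx : {linear 'cV[R]_((r + m) + m) -> _}) f).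
  rewrite /= col_mxKu; apply: jac_derive; exact: smooth_differentiable.
apply/is_derive_mxP => i j; rewrite ord1.
have -> : (fun y : 'cV[R]_((r + m) + m) => rhs (usubmx y) (dsubmx y) i 0) =
    (fun y => f (usubmx y) (rshift r i) 0 - f U0 (rshift r i) 0) \+
     (\sum_j (fun y : 'cV[R]_((r + m) + m) => B22 U0 i j * y (rshift (r + m) j) 0)).
  apply/funext => y; rewrite !mxE /= fct_sumE; congr (_ + _).
  by apply: eq_bigr => k _; rewrite !mxE.
have -> : (dsubmx (jac f U0) *m usubmx d + B22 U0 *m dsubmx d) i 0 =
   ((jac f U0 *m usubmx d) (rshift r i) 0 - 0) +
   \sum_j B22 U0 i j * d (rshift (r + m) j) 0.
  rewrite subr0 !mxE; congr (_ + _); apply: eq_bigr => k _; rewrite !mxE//.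
apply: is_deriveD.
  have hc := is_derive_cst (f U0 (rshift r i) 0) (col_mx U0 0) d.
  exact: (is_deriveB ((is_derive_mxP _ _ _ _).1 h1 (rshift r i) 0) hc).
apply: is_derive_sum => k; apply: is_deriveZ.
exact: ((is_derive_mxP _ _ _ _).1 (is_derive_id _ d)).
Qed.

Lemma is_derive_vfield (d : 'cV[R]_((r + m) + m)) :
  is_derive (col_mx U0 0 : 'cV[R]_((r + m) + m)) d vfield (linearization *m d).
Proof.
set a := col_mx U0 0.
have Da : D2 a by rewrite /= /a col_mxKu.
have dr := is_derive_rhs d; set w := _ + _ in dr.
have Ew : linearization *m d = col_mx (sysinv U0 *m col_mx 0 w) 0.
  rewrite /linearization -[in LHS](vsubmxK d) mul_block_col !mul0mx addr0.
  rewrite -!mulmxA -mulmxDr; congr (col_mx (_ *m _) _).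
  by rewrite !mul_col_mx !mul0mx add_col_mx addr0.
rewrite Ew; apply/is_derive_mxP => i j; rewrite ord1 /vfield.
rewrite -(splitK i); case: (fintype.split i) => l /=; last first.
  under [X in is_derive _ _ X _]eq_fun do rewrite col_mxEd mxE.
  by rewrite col_mxEd mxE; exact: is_derive_cst.
under [X in is_derive _ _ X _]eq_fun do rewrite col_mxEu mxE.
rewrite col_mxEu mxE.
have -> : (fun y : 'cV[R]_((r + m) + m) => \sum_k sysinv (usubmx y) l k *
       (col_mx 0 (rhs (usubmx y) (dsubmx y)) : 'cV[R]_(r + m)) k 0) =
    \sum_k (fun y : 'cV[R]_((r + m) + m) => sysinv (usubmx y) l k *
       (col_mx 0 (rhs (usubmx y) (dsubmx y)) : 'cV[R]_(r + m)) k 0).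
  by apply/funext => y; rewrite fct_sumE.
apply: is_derive_sum => k.
(* The derivative [g] of an entry of [sysinv] is not computed: the product rule multiplies it by an
   entry that is zero at [a]. *)
have [_ /(_ d)[g _ /(_ a Da) hg]] := Cdiff_usub (Cdiff_sysinv 1 l k).
have hr : is_derive a d (fun y => (col_mx 0 (rhs (usubmx y) (dsubmx y)) : 'cV[R]_(r + m)) k 0)
    ((col_mx 0 w : 'cV[R]_(r + m)) k 0).
  rewrite -(splitK k); case: (fintype.split k) => t /=.
    under [X in is_derive _ _ X _]eq_fun do rewrite col_mxEu mxE.
    by rewrite col_mxEu mxE; exact: is_derive_cst.
  under [X in is_derive _ _ X _]eq_fun do rewrite col_mxEd.
  by rewrite col_mxEd; exact: ((is_derive_mxP _ _ _ _).1 dr t 0).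
have sa : usubmx a = U0 by rewrite /a col_mxKu.
have ra : col_mx 0 (rhs (usubmx a) (dsubmx a)) = 0 :> 'cV[R]_(r + m).
  by rewrite /a col_mxKu col_mxKd rhs0 col_mx0.
have := is_deriveM hg hr; cbv beta.
by rewrite ra sa [(0 : 'cV[R]_(r + m)) k 0]mxE scale0r addr0.
Qed.

End System.

(** * Level sets of [f_I] and the linearised system *)

Section LocalTheory.
Context {R : realType} (r m : nat) (D : set 'cV[R]_(r + m))
  (f : 'cV[R]_(r + m) -> 'cV[R]_(r + m)) (B22 : 'cV[R]_(r + m) -> 'M[R]_m)
  (U0 : 'cV[R]_(r + m)).
Context (hD : open D) (hf : smooth_on D f) (hB : smooth_on D (diffusion B22))
  (hU0 : D U0) (uA : forall U, D U -> ulsubmx (jac f U) \in unitmx)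
  (uB : forall U, D U -> B22 U \in unitmx).

Local Notation slope := (slope f B22 U0).
Local Notation rhs := (rhs f B22 U0).

(** This plays the role of the implicit function theorem. For two states on a level set of [f_I]
    with difference d, A11 d_I + A12 d_II is a small multiple of |d|; inverting A11 and absorbing
    the error bounds d by d_II. *)
Lemma level_set_estimate : exists rho1 C : R, [/\ 0 < rho1, 0 < C &
  forall U V, `|U - U0| <= rho1 -> `|V - U0| <= rho1 ->
    usubmx (f U) = usubmx (f V) -> `|U - V| <= C * `|dsubmx U - dsubmx V|].
Proof.
have [DF [rho [K [rho0 K0 inD hc hcol]]]] :=
  @Cdiff_c11 R _ _ f D U0 hD hU0 (fun i => Cdiff_coord i 0 (hf 2)).
have DJ : DF U0 = jac f U0.
  apply/matrixP => i j; rewrite mxE.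
  have := hcol U0; rewrite subrr normr0 => /(_ (ltW rho0) j) h.
  by have [_ ->] := h; rewrite mxE.
set J := jac f U0 in DJ.
pose A11 := ulsubmx J; pose A12 := ursubmx J.
have uA11 : A11 \in unitmx by exact: uA.
(* The radius 1 / (2 e) makes the remainder, after multiplication by the inverse of A11, at most |d|
   / 2. The added 1 keeps [e] positive. *)
pose e : R := r%:R * `|invmx A11| * (2 * K) + 1.
have e0 : 0 < e by rewrite ltr_wpDl// !mulr_ge0.
pose rho1 := Num.min rho (e^-1 / 2).
have rho10 : 0 < rho1 by rewrite lt_min rho0/= divr_gt0// invr_gt0.
pose q : R := m%:R * `|invmx A11 *m A12|.
have q0 : 0 <= q by rewrite mulr_ge0.
exists rho1, (2 * (q + 1)); split=> //; first by rewrite mulr_gt0// ltr_wpDl.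
move=> U V hU hV fUV; set d := U - V.
have hU' : `|U - U0| <= rho by rewrite (le_trans hU)// ge_min lexx.
have hV' : `|V - U0| <= rho by rewrite (le_trans hV)// ge_min lexx.
have [_ + _] := hc => /(_ U0 U V); rewrite subrr normr0 => /(_ (ltW rho0) hU' hV').
rewrite DJ -/d => est.
pose E := f U - f V - J *m d.
have Etop : usubmx E = - (A11 *m usubmx d + A12 *m dsubmx d).
  rewrite /E [LHS]linearB/= [usubmx (f U - f V)]linearB/= fUV subrr sub0r.
  by rewrite -[in J *m d](submxK J) -[in _ *m d](vsubmxK d) mul_block_col col_mxKu.
have dI : usubmx d = - (invmx A11 *m usubmx E) - (invmx A11 *m A12) *m dsubmx d.
  rewrite Etop mulmxN opprK mulmxDr mulmxA mulVmx// mul1mx mulmxA.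
  by rewrite addrK.
have dle : `|d| <= `|usubmx d| + `|dsubmx d|.
  rewrite -{1}(vsubmxK d) norm_col_mx ge_max lerDl lerDr.
  by rewrite !normr_ge0.
have h1 : `|invmx A11 *m usubmx E| <= 2^-1 * `|d|.
  apply: (@le_trans _ _ (r%:R * `|invmx A11| * (K * (rho1 + rho1) * `|d|))).
    apply: norm_mulmx_le2 => //; apply: le_trans (norm_usubmx _) _.
    apply: le_trans est _; rewrite ler_wpM2r// ler_wpM2l//.
    by rewrite lerD.
  have -> : r%:R * `|invmx A11| * (K * (rho1 + rho1) * `|d|) =
     (r%:R * `|invmx A11| * (2 * K)) * rho1 * `|d| by ring.
  rewrite ler_wpM2r//; apply: (@le_trans _ _ (e * (e^-1 / 2))).
    apply: ler_pM; [by rewrite !mulr_ge0|exact: ltW|by rewrite /e lerDl|].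
    by rewrite ge_min lexx orbT.
  by rewrite mulrA mulfV ?gt_eqF// mul1r.
have h2 : `|(invmx A11 *m A12) *m dsubmx d| <= q * `|dsubmx d|.
  exact: norm_mulmx_le.
have h3 : `|usubmx d| <= 2^-1 * `|d| + q * `|dsubmx d|.
  rewrite dI; apply: le_trans (ler_normB _ _) _; rewrite normrN.
  exact: lerD.
rewrite -linearB/= -/d.
have : 2 * `|d| <= 2 * (2^-1 * `|d| + q * `|dsubmx d| + `|dsubmx d|).
  by rewrite ler_pM2l// (le_trans dle)// lerD2r.
by lra.
Qed.

(** The block in question is the derivative of U_II(1) with respect to C2. In the corresponding
    columns of [Z] the lower block stays the identity, and the linearised constraint eliminates the
    first components, leaving w_II' = M w_II + 1. *)
Lemma linearized_unit (Z : R -> 'M[R]_((r + m) + m)) : Z 0 = 1%:M ->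
  (forall x : R, 0 <= x <= 1 -> is_derive x 1 Z (linearization f B22 U0 *m Z x)) ->
  (forall k : int, k != 0 -> ~ spectrum (invmx (B22 U0) *m
     (drsubmx (jac f U0) - dlsubmx (jac f U0) *m invmx (ulsubmx (jac f U0)) *m
        ursubmx (jac f U0))) (Complex 0 (2 * pi * k%:~R))) ->
  dsubmx (usubmx (rsubmx (Z 1))) \in unitmx.
Proof.
move=> Z0 dZ hspec.
pose W x := rsubmx (Z x); pose w x := usubmx (W x); pose v x := dsubmx (W x).
have one : (1%:M : 'M[R]_((r + m) + m)) = block_mx 1%:M 0 0 1%:M.
  exact: scalar_mx_block.
have w0 : w 0 = 0.
  by rewrite /w /W Z0 one block_mxEh row_mxKr col_mxKu.
have v0 : v 0 = 1%:M.
  by rewrite /v /W Z0 one block_mxEh row_mxKr col_mxKd.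
have dW (x : R) : 0 <= x <= 1 -> is_derive x 1 W (linearization f B22 U0 *m W x).
  by move=> x01; rewrite mulmx_rsub; exact: is_derive_rsubmx (dZ x x01).
have LW x : linearization f B22 U0 *m W x =
    col_mx (sysinv f B22 U0 *m col_mx 0 (dsubmx (jac f U0) *m w x + B22 U0 *m v x)) 0.
  rewrite -[in LHS](vsubmxK (W x)) mul_block_col !mul0mx addr0.
  rewrite -!mulmxA -mulmxDr; congr (col_mx (_ *m _) _).
  by rewrite !mul_col_mx !mul0mx add_col_mx addr0.
have v1 (x : R) : 0 <= x <= 1 -> v x = 1%:M.
  rewrite -v0; apply: is_derive_zero_const => t t01.
  by have := is_derive_dsubmx (dW t t01); rewrite LW col_mxKd.
pose J := jac f U0; rewrite -/J in hspec.
pose s x := sysinv f B22 U0 *m col_mx 0 (dsubmx J *m w x + B22 U0).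
have dw (x : R) : 0 <= x <= 1 -> is_derive x 1 w (s x).
  move=> x01; have := is_derive_usubmx (dW x x01).
  by rewrite LW col_mxKu v1// mulmx1.
pose A11 := ulsubmx J; pose A12 := ursubmx J.
have uA11 : A11 \in unitmx by exact: uA.
have sE x : A11 *m usubmx (s x) + A12 *m dsubmx (s x) = 0 /\
    B22 U0 *m dsubmx (s x) = dsubmx J *m w x + B22 U0.
  have : sysmx f B22 U0 *m s x = col_mx 0 (dsubmx J *m w x + B22 U0).
    by rewrite mulmxA (sysmxK uA uB hU0) mul1mx.
  rewrite -[in X in X -> _](vsubmxK (s x)) mul_block_col mul0mx add0r.
  by move=> /eq_col_mx.
(* The linearised form of f_I(U) = f_I(U0): the left-hand side has zero derivative and starts at
   0. *)
have wI (x : R) : 0 <= x <= 1 -> A11 *m usubmx (w x) + A12 *m dsubmx (w x) = 0.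
  move=> x01.
  rewrite (@is_derive_zero_const R _ _ (fun x => A11 *m usubmx (w x) + A12 *m dsubmx (w x)) _ x x01).
    by rewrite w0 !linear0 ?mulmx0 addr0.
  move=> t t01; have [<- _] := sE t.
  have h1 := is_derive_mulmxl A11 (is_derive_usubmx (dw t t01)).
  have h2 := is_derive_mulmxl A12 (is_derive_dsubmx (dw t t01)).
  exact: (is_deriveD h1 h2).
apply: (phi_unitmx (Phi := fun x => dsubmx (w x)) _ _ hspec).
  by rewrite w0 linear0.
move=> x x01; have := is_derive_dsubmx (dw x x01); congr is_derive.
have [_ sII] := sE x; have top := wI x x01.
have uB0 : B22 U0 \in unitmx by exact: uB.
have wIE : usubmx (w x) = - (invmx A11 *m (A12 *m dsubmx (w x))).
  rewrite -[LHS](mulKmx uA11) -mulmxN; congr (_ *m _).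
  by apply/eqP; rewrite -addr_eq0 top.
rewrite -[LHS](mulKmx uB0) sII mulmxDr mulVmx//; congr (_ + _).
rewrite -[RHS]mulmxA; congr (_ *m _).
rewrite -{1}(vsubmxK (w x)) -{1}(hsubmxK (dsubmx J)) mul_row_col wIE.
by rewrite mulmxN addrC mulmxBl !mulmxA.
Qed.

End LocalTheory.

(** * The flow of the differential-algebraic system and its uniqueness *)

Section LocalFlow.
Context {R : realType} (r m : nat) (D : set 'cV[R]_(r + m))
  (f : 'cV[R]_(r + m) -> 'cV[R]_(r + m)) (B22 : 'cV[R]_(r + m) -> 'M[R]_m)
  (U0 : 'cV[R]_(r + m)).
Context (hD : open D) (hf : smooth_on D f) (hB : smooth_on D (diffusion B22))
  (hU0 : D U0) (uA : forall U, D U -> ulsubmx (jac f U) \in unitmx)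
  (uB : forall U, D U -> B22 U \in unitmx).

Local Notation slope := (slope f B22 U0).
Local Notation rhs := (rhs f B22 U0).

Lemma c11_onW p s (F : 'cV[R]_p -> 'cV[R]_s) DF a (rho rho' K : R) : rho' <= rho ->
  c11_on F DF a rho K -> c11_on F DF a rho' K.
Proof.
move=> le [h1 h2 h3]; split.
- by move=> y hy; apply: h1; exact: le_trans le.
- by move=> y y1 y2 hy hy1 hy2; apply: h2; exact: le_trans le.
- by move=> y y' hy hy'; apply: h3; exact: le_trans le.
Qed.

(** Gathers, for common radii, the flow of [vfield] from (U0, c), the Lipschitz bound on [slope] and
    the level-set estimate. [Phi c] is the block of the derivative of the flow that sends variations
    of C2 to variations of U_II(1). *)
Lemma dae_flow :
  (forall k : int, k != 0 -> ~ spectrum (invmx (B22 U0) *m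
     (drsubmx (jac f U0) - dlsubmx (jac f U0) *m invmx (ulsubmx (jac f U0)) *m
        ursubmx (jac f U0))) (Complex 0 (2 * pi * k%:~R))) ->
  exists (rho1 rho0 L C1 C : R) (u : 'cV[R]_m -> R -> 'cV[R]_(r + m))
      (Phi : 'cV[R]_m -> 'M[R]_m),
  [/\ [/\ 0 < rho1, 0 < rho0, 0 <= L, 0 < C1 & 0 < C],
      forall U, `|U - U0| <= rho1 -> D U,
      forall U V c, `|U - U0| <= rho1 -> `|V - U0| <= rho1 -> `|c| <= rho0 ->
        `|slope U c - slope V c| <= L * `|U - V|,
      forall U V, `|U - U0| <= rho1 -> `|V - U0| <= rho1 ->
        usubmx (f U) = usubmx (f V) -> `|U - V| <= C1 * `|dsubmx U - dsubmx V| &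
      [/\ forall c, `|c| <= rho0 -> u c 0 = U0 /\ forall x : R, 0 <= x <= 1 ->
            `|u c x - U0| <= rho1 / 2 /\ is_derive x 1 (u c) (slope (u c x) c),
          forall c c1 c2, `|c| <= rho0 -> `|c1| <= rho0 -> `|c2| <= rho0 ->
            `|dsubmx (u c1 1) - dsubmx (u c2 1) - Phi c *m (c1 - c2)| <=
              C * (`|c1 - c| + `|c2 - c|) * `|c1 - c2| &
          Phi 0 \in unitmx]].
Proof.
move=> hspec.
have [rhot [C1 [rhot0 C10 htr]]] := level_set_estimate hD hf hU0 uA.
pose a := col_mx U0 0 : 'cV[R]_((r + m) + m).
have Da : ((usubmx : 'cV[R]_((r + m) + m) -> 'cV[R]_(r + m)) @^-1` D) a.
  by rewrite /= /a col_mxKu.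
have [DF [rho [K [rhop K0 inD hc hcol]]]] :=
  Cdiff_c11 (open_D2 hD) Da (Cdiff_vfield U0 hf hB uA uB 2).
(* [DF] is known through its columns, which are partial derivatives; uniqueness of derivatives
   identifies it at [a]. *)
have DFa : DF a = linearization f B22 U0.
  apply/matrixP => i j.
  have := hcol a; rewrite subrr normr0 => /(_ (ltW rhop) j) h1.
  have h2 := is_derive_vfield hf hB hU0 uA uB (delta_mx j 0).
  have := @derive_val _ _ _ _ _ _ _ h2; rewrite (@derive_val _ _ _ _ _ _ _ h1).
  rewrite -colE => /colP/(_ i); by rewrite !mxE.
pose rho1 := Num.min rhot rho.
have rho10 : 0 < rho1 by rewrite lt_min rhot0.
have le1 : rho1 <= rho by rewrite ge_min lexx orbT.
have le2 : rho1 <= rhot by rewrite ge_min lexx.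
have hc1 := c11_onW le1 hc.
have [rho0 [Y [E [C [[/andP[rho00 rho01] C0] YP ET [Z [Z0 Z1 dZ]]]]]]] :=
  flow K0 rho10 hc1 (vfield0 f B22 U0).
rewrite DFa in dZ.
pose y (c : 'cV[R]_m) : 'cV[R]_((r + m) + m) := col_mx U0 c.
have ydist c c' : `|y c - y c'| = `|c - c'|.
  by rewrite /y opp_col_mx add_col_mx subrr norm_col_mx normr0 max_r.
have yball c : `|c| <= rho0 -> `|y c - a| <= rho0.
  by rewrite (ydist c 0) subr0.
pose u c x := usubmx (Y (y c) x).
pose Phi c := dsubmx (usubmx (rsubmx (E (y c)))).
pose L := ((r + m + m)%:R * K + K * (2 * rho1)).
exists rho1, rho0, L, C1, C, u, Phi; split.
- by split => //; rewrite addr_ge0 ?mulr_ge0// ltW.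
- move=> U hU; have := inD (col_mx U 0); rewrite /= col_mxKu; apply.
  by rewrite opp_col_mx add_col_mx subrr norm_col_mx normr0 max_l// (le_trans hU).
- move=> U V c hU hV hcr.
  have inb W : `|W - U0| <= rho1 -> `|col_mx W c - a| <= rho1.
    move=> hW; rewrite /a opp_col_mx add_col_mx subr0 norm_col_mx ge_max hW/=.
    by apply: le_trans hcr _; lra.
  have := c11_lip K0 (ltW rho10) hc1 (inb U hU) (inb V hV).
  rewrite /vfield !col_mxKu !col_mxKd !opp_col_mx !add_col_mx !subrr !norm_col_mx.
  by rewrite !normr0 !max_l.
- move=> U V hU hV; apply: htr; first exact: le_trans le2.
  exact: le_trans le2.
split.
- move=> c hcr; have [Y0 dY] := YP _ (yball c hcr).
  split=> [|x x01]; first by rewrite /u Y0 col_mxKu.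
  have [Yb _] := dY x x01; split.
    apply: le_trans Yb.
    by have := norm_usubmx (Y (y c) x - a); rewrite linearB/= /a col_mxKu.
  (* The parameter component of the flow keeps its initial value, so the other component solves the
     equation with parameter [c]. *)
  have cE : dsubmx (Y (y c) x) = c.
    rewrite (@is_derive_zero_const R _ _ (fun x => dsubmx (Y (y c) x)) _ x x01).
      by rewrite Y0 col_mxKd.
    move=> t t01; have [_ dt] := dY t t01.
    by have := is_derive_dsubmx dt; rewrite col_mxKd.
  have [_ dt] := dY x x01.
  by have := is_derive_usubmx dt; rewrite col_mxKu cE.
- move=> c c1 c2 hc0 hc1' hc2'.
  have := ET _ _ _ (yball c hc0) (yball c1 hc1') (yball c2 hc2').
  rewrite !ydist; apply: le_trans.
  (* The estimate for the full state restricts to one block. The initial increment is (0, c1 - c2),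
     so only the right block column of [E] acts. *)
  apply: le_trans (norm_usubmx _); apply: le_trans (norm_dsubmx _).
  rewrite le_eqVlt; apply/orP; left; apply/eqP; congr `|_|.
  rewrite [usubmx _]linearB/= [usubmx (_ - _)]linearB/= [RHS]linearB/=.
  rewrite [dsubmx (_ - _)]linearB/=; congr (_ - _).
  rewrite /Phi !mul_dsub_mx !mul_usub_mx; congr (dsubmx (usubmx _)).
  rewrite -[in RHS](hsubmxK (E (y c))) /y opp_col_mx add_col_mx subrr.
  by rewrite mul_row_col mulmx0 add0r.
- by rewrite /Phi /y -/a -Z1; exact: (linearized_unit hU0 uA uB Z0 dZ hspec).
Qed.

Lemma first_integral (u : R -> 'cV[R]_(r + m)) c : u 0 = U0 ->
  (forall x : R, 0 <= x <= 1 -> D (u x)) ->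
  (forall x : R, 0 <= x <= 1 -> is_derive x 1 u (slope (u x) c)) ->
  forall x : R, 0 <= x <= 1 -> usubmx (f (u x)) = usubmx (f U0).
Proof.
move=> u0 Du du x x01; rewrite -[in RHS]u0.
apply: (@is_derive_zero_const R _ _ (fun x => usubmx (f (u x)))) => // t t01.
have := is_derive_usubmx (jac_comp (du t t01) (smooth_differentiable hf (Du t t01))).
by have [-> _] := slope_eq U0 uA uB c (Du t t01).
Qed.

(** As long as [v] stays in the ball of radius [rho1], the level-set estimate turns the Lipschitz
    bound into a closed inequality for u_II - v_II, and Gronwall gives v = u. Since [u] lies in the
    half ball, [escape] shows that [v] never leaves. *)
Lemma dae_unique (rho1 L C1 : R) (c : 'cV[R]_m) (u v : R -> 'cV[R]_(r + m)) :
  0 < rho1 -> 0 <= L -> 0 < C1 ->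
  (forall U V, `|U - U0| <= rho1 -> `|V - U0| <= rho1 ->
     `|slope U c - slope V c| <= L * `|U - V|) ->
  (forall U V, `|U - U0| <= rho1 -> `|V - U0| <= rho1 ->
     usubmx (f U) = usubmx (f V) -> `|U - V| <= C1 * `|dsubmx U - dsubmx V|) ->
  u 0 = U0 ->
  (forall x : R, 0 <= x <= 1 -> `|u x - U0| <= rho1 / 2 /\ D (u x)) ->
  (forall x : R, 0 <= x <= 1 -> is_derive x 1 u (slope (u x) c)) ->
  v 0 = U0 -> {within `[0, 1], continuous v} ->
  (forall x : R, 0 <= x <= 1 -> D (v x) /\ usubmx (f (v x)) = usubmx (f U0)) ->
  (forall x : R, 0 < x < 1 -> exists2 w, is_derive x 1 (fun y => dsubmx (v y)) w &
     B22 (v x) *m w = rhs (v x) c) ->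
  forall x : R, 0 <= x <= 1 -> v x = u x.
Proof.
move=> rho10 L0 C10 slip htr u0 uP du v0 cv vP dv.
have Du (x : R) : 0 <= x <= 1 -> D (u x) by move=> /uP[].
have fu := first_integral u0 Du du.
have uin (x : R) : 0 <= x <= 1 -> `|u x - U0| <= rho1.
  by move=> /uP[h _]; apply: le_trans h _; lra.
have LC0 : 0 <= L * C1 by rewrite mulr_ge0// ltW.
have [C C11 G] := @gronwall R m 1 (L * C1) LC0.
have uv (T : R) : 0 <= T <= 1 -> (forall s : R, 0 <= s <= T -> `|v s - U0| <= rho1) ->
    v T = u T.
  move=> T01 vin; have /andP[T0 T1] := T01.
  have in01 (s : R) : 0 <= s <= T -> 0 <= s <= 1.
    by move=> /andP[-> sT]; exact: le_trans T1.
  have ino (s : R) : 0 < s < T -> 0 <= s <= T.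
    by move=> /andP[s0 sT]; rewrite !ltW.
  have fuv (s : R) : 0 <= s <= T -> `|u s - v s| <= C1 * `|dsubmx (u s) - dsubmx (v s)|.
    move=> sT; apply: htr; [by apply: uin; exact: in01|exact: vin|].
    by rewrite fu ?(vP _ (in01 s sT)).2//; exact: in01.
  pose z s := dsubmx (u s) - dsubmx (v s).
  have : `|z T| <= C * (`|z 0| + 0).
    apply: (G z (fun s => dsubmx (slope (u s) c) - dsubmx (slope (v s) c))) => //.
    - apply: within_continuousB.
        apply: continuous_in_subspaceT => s; rewrite inE/= in_itv/= => sT.
        exact: is_derive_continuous (is_derive_dsubmx (du s (in01 s sT))).
      have cdv : {within `[0, 1], continuous (fun s => dsubmx (v s))}.
        apply/subspace_continuousP => s s01.
        have cvs := (subspace_continuousP _ _).1 cv s s01.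
        exact: (cvg_comp _ _ cvs (@continuous_dsubmx _ _ _ _ (v s))).
      by apply: continuous_subspaceW cdv => s; rewrite /= !in_itv/=; exact: in01.
    - move=> s sT; have s01 := in01 s (ino s sT).
      apply: is_derive_subl; first exact: is_derive_dsubmx (du s s01).
      have s1 : 0 < s < 1 by case/andP: sT => -> sT; exact: lt_le_trans T1.
      have [w dw wE] := dv s s1.
      by rewrite -(dsub_slopeP uA uB (vP s s01).1 wE).
    - move=> s sT; have sT' := ino s sT; rewrite addr0 -linearB/=.
      apply: le_trans (norm_dsubmx _) _.
      apply: le_trans (slip _ _ _ _) _; [by apply: uin; exact: in01|exact: vin|].
      by rewrite -mulrA ler_wpM2l//; exact: fuv.
  rewrite /z u0 v0 subrr normr0 addr0 mulr0 normr_le0 => /eqP z0.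
  have := fuv T; rewrite T0 lexx z0 normr0 mulr0 => /(_ isT).
  by rewrite normr_le0 subr_eq0 => /eqP ->.
have vin := @escape R (fun s => `|v s - U0|) rho1 rho10.
move=> x x01; apply: (uv) => // s /andP[s0 sx].
apply: vin.
- apply: within_continuous_norm; apply: within_continuousB; first exact: cv.
  by move=> t; exact: cvg_cst.
- by rewrite v0 subrr normr0 ltW.
- by move=> T T01 vT; rewrite (uv T T01 vT); have [] := uP T T01.
- by rewrite s0 (le_trans sx)//; case/andP: x01.
Qed.

End LocalFlow.

(** * One-sided derivatives and maximal solutions *)

Section OneSided.
Context {R : realType}.

Lemma cvg_within_local (W : topologicalType) (J J' : set R) (F : set_system R)
    (g g' : R -> W) (l : W) : Filter F ->
  (\forall y \near F, J' y -> J y /\ g' y = g y) ->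
  g y @[y --> within J F] --> l -> g' y @[y --> within J' F] --> l.
Proof.
move=> FF near gl B Bl; have h : F [set y | J y -> B (g y)] by exact: (gl B Bl).
have : F [set y | J' y -> B (g' y)]; last by [].
apply: filterS2 h near => y JB JJ /= J'y.
by have [Jy ->] := JJ J'y; exact: JB.
Qed.

Lemma is_derive_slope (W : normedModType R) (g : R -> W) (x : R) (v : W) :
  is_derive x 1 g v <-> (y - x)^-1 *: (g y - g x) @[y --> x^'] --> v.
Proof.
have E (h : R) : h *: (1 : R) = h by rewrite /GRing.scale/= mulr1.
split=> [[/cvg_ex[/= l gl] gv]|gv].
  have lv : l = v by rewrite -gv; apply/esym; exact: cvg_lim gl.
  apply/cvgrPdist_le => /= e e0.
  move/cvgrPdist_le : gl => /(_ e e0)/nbhs_ballP[/= d d0 hd].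
  apply/nbhs_ballP; exists d => //= y xy yx.
  have := hd (y - x); rewrite /ball/= sub0r normrN distrC subr_eq0 => /(_ xy yx).
  by rewrite E subrK lv.
have gl : h^-1 *: ((g \o shift x) (h *: (1 : R)) - g x) @[h --> 0^'] --> v.
  apply/cvgrPdist_le => /= e e0.
  move/cvgrPdist_le : gv => /(_ e e0)/nbhs_ballP[/= d d0 hd].
  apply/nbhs_ballP; exists d => //= h h0 hn0.
  have := hd (h + x); rewrite /ball/= opprD addrCA subrr addr0 addrK E.
  apply; first by move: h0; rewrite /ball/= sub0r.
  by rewrite -subr_eq0 addrK.
by apply: DeriveDef; [apply/cvg_ex; exists v|exact: cvg_lim gl].
Qed.

Lemma is_derive_is_derive_in (W : normedModType R) (J : set R) (g : R -> W) (x : R) (v : W) :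
  is_derive x 1 g v -> is_derive_in J g x v.
Proof.
by move=> /is_derive_slope gv; apply: cvg_trans gv; apply: cvg_app; exact: cvg_within.
Qed.

Lemma is_derive_in_is_derive (W : normedModType R) (J : set R) (g : R -> W) (x : R) (v : W) :
  (\forall y \near x, J y) -> is_derive_in J g x v -> is_derive x 1 g v.
Proof.
move=> Jx gv; apply/is_derive_slope.
have : (y - x)^-1 *: (g y - g x) @[y --> within setT x^'] --> v.
  apply: cvg_within_local gv; apply: nbhs_dnbhs.
  by apply: filterS Jx => y Jy _.
move=> gl B Bl.
have h : x^' [set y | setT y -> B ((y - x)^-1 *: (g y - g x))] := gl B Bl.
by have : x^' [set y | B ((y - x)^-1 *: (g y - g x))] by apply: filterS h => y; apply.
Qed.

End OneSided.

(** * Quadratic expansions, contractions and comparison of norms *)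

Section Differentiability.
Context {R : realType}.

Lemma differentiable_expansion p q (g : 'cV[R]_p -> 'cV[R]_q) (A : 'M[R]_(q, p)) c (rho C : R) :
  0 < rho -> 0 <= C ->
  (forall h, `|h| <= rho -> `|g (c + h) - g c - A *m h| <= C * `|h| ^+ 2) ->
  differentiable g c /\ jac g c = A.
Proof.
move=> rho0 C0 est.
pose l : {linear 'cV[R]_p -> 'cV[R]_q} := mulmx A.
have cl : continuous l.
  apply: (@lip_continuous R _ _ _ (p%:R * `|A|)) => h k.
  by rewrite -linearB/=; exact: norm_mulmx_le.
have exp : g \o shift c = cst (g c) + l +o_ (0 : 'cV[R]_p) id.
  apply/eqaddoP => e e0.
  (* On this radius C |h|^2 <= e |h|; the added 1 covers C = 0. *)
  have r0 : 0 < Num.min rho (e / (C + 1)).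
    by rewrite lt_min rho0/= divr_gt0// ltr_wpDl.
  near=> h.
  have hr : `|h| <= Num.min rho (e / (C + 1)).
    near: h; rewrite nearE; apply/nbhs_ballP; exists (Num.min rho (e / (C + 1))) => // h.
    by rewrite -ball_normE/= sub0r normrN => /ltW.
  move: hr; rewrite le_min => /andP[h1 h2].
  have -> : (g \o shift c - (cst (g c) + l)) h = g (c + h) - g c - A *m h.
    by rewrite -[LHS]/(g (h + c) - (g c + A *m h)) opprD addrA [h + c]addrC.
  apply: le_trans (est h h1) _; rewrite expr2 mulrA ler_wpM2r//.
  apply: (@le_trans _ _ ((C + 1) * `|h|)); first by rewrite ler_wpM2r// lerDl.
  by rewrite mulrC -ler_pdivlMr// ltr_wpDl.
have dE : 'd g c = l :> ('cV[R]_p -> 'cV[R]_q) by exact: diff_unique cl exp.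
have dg : differentiable g c.
  apply/diff_locallyP; rewrite dE; split => //.
split=> //; apply/matrixP => i j.
by rewrite mxE deriveE// dE /l/= -colE mxE.
Unshelve. all: by end_near. Qed.

(** Banach's iteration from 0. With ratio one half, [geometric_limit] provides the limit entry by
    entry. *)
Lemma contraction_fixpoint p (T : 'cV[R]_p -> 'cV[R]_p) (e : R) : 0 <= e ->
  (forall c, `|c| <= e -> `|T c| <= e) ->
  (forall c1 c2, `|c1| <= e -> `|c2| <= e -> `|T c1 - T c2| <= 2^-1 * `|c1 - c2|) ->
  exists2 c, `|c| <= e & T c = c.
Proof.
move=> e0 Te HT; pose s k := iter k T 0.
have se k : `|s k| <= e by elim: k => [|k IH]; [rewrite normr0|exact: Te].
have sS k : `|s k.+1 - s k| <= e * 2^-1 ^+ k.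
  elim: k => [|k IH]; first by rewrite subr0 expr0 mulr1; exact: (se 1%N).
  apply: le_trans (HT _ _ (se k.+1) (se k)) _.
  by rewrite exprS mulrCA ler_pM2l.
have ex ij : exists l, forall k, `|s k ij.1 ij.2 - l| <= 2 * e * 2^-1 ^+ k.
  apply: geometric_limit => k; apply: le_trans (sS k).
  by have := mx_entry_le_norm (s k.+1 - s k) ij.1 ij.2; rewrite !mxE.
have [l lP] := choice ex.
pose c : 'cV[R]_p := \matrix_(i, j) l (i, j).
have p2 k : 0 <= 2^-1 ^+ k :> R by rewrite exprn_ge0.
have sc k : `|s k - c| <= 2 * e * 2^-1 ^+ k.
  apply: mx_norm_leP => [|i j]; last by rewrite !mxE; exact: lP (i, j) k.
  by rewrite mulr_ge0// mulr_ge0.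
have ce : `|c| <= e.
  rewrite -subr_le0; apply: (@le0_geometric R _ (2 * e)) => k.
  rewrite lerBlDl -(subrK (s k) c) addrC.
  apply: le_trans (ler_normD _ _) _; apply: lerD; first exact: se.
  by rewrite distrC.
exists c => //; apply/eqP; rewrite -subr_eq0 -normr_le0.
apply: (@le0_geometric R _ (2 * e)) => k.
have -> : T c - c = (T c - T (s k)) + (s k.+1 - c) by rewrite subrKA.
apply: le_trans (ler_normD _ _) _.
have h1 := HT _ _ ce (se k); have h2 := sc k; have h3 := sc k.+1.
rewrite distrC in h2; rewrite exprS in h3.
by have := mulr_ge0 e0 (p2 k); lra.
Qed.

Lemma norm_le_enorm p (v : 'cV[R]_p) : `|v| <= enorm v.
Proof.
apply: mx_norm_leP => [|i j]; first exact: sqrtr_ge0.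
rewrite ord1 -sqrtr_sqr; apply: ler_wsqrtr.
by rewrite (bigD1 i)//= lerDl sumr_ge0// => k _; exact: sqr_ge0.
Qed.

(** The constant is crude, but it is positive for every [p] and can be divided by. *)
Lemma enorm_le_norm p (v : 'cV[R]_p) : enorm v <= (p%:R + 1) * `|v|.
Proof.
have p0 : 0 <= (p%:R + 1) * `|v| :> R by rewrite mulr_ge0// addr_ge0.
rewrite -[leRHS]ger0_norm// -sqrtr_sqr; apply: ler_wsqrtr.
apply: (@le_trans _ _ (\sum_(i < p) `|v| ^+ 2)).
  apply: ler_sum => i _; rewrite -[leLHS]real_normK ?num_real//.
  by rewrite lerXn2r ?nnegrE// mx_entry_le_norm.
rewrite sumr_const card_ord -[leLHS]mulr_natl exprMn ler_wpM2r ?sqr_ge0//.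
have : 0 <= p%:R :> R by [].
by rewrite expr2; nra.
Qed.

End Differentiability.

(** * Maximal solutions by Zorn's lemma *)

Section Maximal.
Context {R : realType} (r m : nat) (D : set 'cV[R]_(r + m))
  (f : 'cV[R]_(r + m) -> 'cV[R]_(r + m)) (B22 : 'cV[R]_(r + m) -> 'M[R]_m)
  (U0 : 'cV[R]_(r + m)) (c : 'cV[R]_m).

Local Notation sol := (cauchy_solution D f B22 U0 c).

(** Zorn's lemma for the solutions extending [u0], preordered by extension, so that members of a
    chain agree wherever both are defined. What has to be shown is that the union of a chain is
    again a solution, including the one-sided derivatives at endpoints of its domain. *)
Lemma maximal_extension (J0 : set R) u0 : sol J0 u0 ->
  exists (J : set R) (u : R -> 'cV[R]_(r + m)),
    [/\ maximal_solution D f B22 U0 c J u, J0 `<=` J & forall x, J0 x -> u x = u0 x].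
Proof.
move=> sol0.
pose ext (J : set R) (u : R -> 'cV[R]_(r + m)) (J' : set R) (u' : R -> 'cV[R]_(r + m)) :=
  J `<=` J' /\ forall x, J x -> u' x = u x.
pose T := {p : set R * (R -> 'cV[R]_(r + m)) | sol p.1 p.2 /\ ext J0 u0 p.1 p.2}.
pose dom (t : T) := (sval t).1; pose fn (t : T) := (sval t).2.
have tsol t : sol (dom t) (fn t) by have [] := svalP t.
have text t : ext J0 u0 (dom t) (fn t) by have [] := svalP t.
pose rel (s t : T) := `[< ext (dom s) (fn s) (dom t) (fn t) >].
have t0 : T by exists (J0, u0); split; [exact: sol0|split].
have [||A totA|t tmax] := @ZL_preorder T t0 rel.
- by move=> t; apply/asboolP; split.
- move=> a b d /asboolP[ab1 ab2] /asboolP[bd1 bd2]; apply/asboolP; split.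
    exact: subset_trans bd1.
  by move=> x ax; rewrite bd2 ?ab2//; exact: ab1.
- have [[s0 As0]|nA] := pselect (exists s, A s); last first.
    by exists t0 => s As; exfalso; apply: nA; exists s.
  have total a b : A a -> A b -> ext (dom a) (fn a) (dom b) (fn b) \/
      ext (dom b) (fn b) (dom a) (fn a).
    by move=> Aa Ab; have [/asboolP|/asboolP] := totA a b Aa Ab; [left|right].
  have dir a b : A a -> A b -> exists2 s, A s & dom a `<=` dom s /\ dom b `<=` dom s.
    move=> Aa Ab; have [[ab _]|[ba _]] := total a b Aa Ab.
      by exists b => //; split; [exact: ab|exact: subset_refl].
    by exists a => //; split; [exact: subset_refl|exact: ba].
  pose J := [set x | exists2 s, A s & dom s x].
  have exu x : exists y, forall s, A s -> dom s x -> fn s x = y.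
    have [[s As sx]|nx] := pselect (J x); last first.
      by exists 0 => s As sx; exfalso; apply: nx; exists s.
    exists (fn s x) => s' As' s'x.
    have [[_ e]|[_ e]] := total s s' As As'; first exact: e.
    by rewrite e.
  have [u uE] := choice exu.
  (* A member of the chain reaching a point of [J] on each side of [x] contains [J] near [x],
     domains being intervals; a side without points of [J] asks for nothing. Continuity and
     derivatives within [J] at [x] are then inherited from that member. *)
  have local x : J x -> exists2 s, A s & dom s x /\
      \forall y \near x, J y -> dom s y.
    move=> [s As sx].
    have [s1 As1 [ss1 up]] : exists2 s1, A s1 & dom s `<=` dom s1 /\
        \forall y \near x, x <= y -> J y -> dom s1 y.
      have [[y [xy [s' As' s'y]]]|ny] := pselect (exists y, x < y /\ J y).
        have [s1 As1 [h1 h2]] := dir s s' As As'; exists s1 => //; split=> //.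
        have : \forall z \near x, z < y by exact: lt_nbhsl.
        apply: filterS => z zy xz _.
        have [[itv _] _ _ _ _] := tsol s1.
        by apply: (itv x y (h1 _ sx) (h2 _ s'y)); rewrite xz ltW.
      exists s => //; split=> //; apply: filterE => y.
      rewrite le_eqVlt => /orP[/eqP <-//|xy] Jy.
      by exfalso; apply: ny; exists y.
    have [s2 As2 [ss2 lo]] : exists2 s2, A s2 & dom s1 `<=` dom s2 /\
        \forall y \near x, y <= x -> J y -> dom s2 y.
      have [[y [xy [s' As' s'y]]]|ny] := pselect (exists y, y < x /\ J y).
        have [s2 As2 [h1 h2]] := dir s1 s' As1 As'; exists s2 => //; split=> //.
        have : \forall z \near x, y < z by exact: lt_nbhsr.
        apply: filterS => z zy xz _.
        have [[itv _] _ _ _ _] := tsol s2.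
        apply: (itv y x (h2 _ s'y) (h1 _ (ss1 _ sx))).
        by rewrite xz ltW.
      exists s1 => //; split=> //; apply: filterE => y.
      rewrite le_eqVlt => /orP[/eqP -> _|xy Jy]; first exact: ss1.
      by exfalso; apply: ny; exists y.
    exists s2 => //; split; first by apply: ss2; exact: ss1.
    apply: filterS2 up lo => y h1 h2 Jy.
    by have [xy|yx] := leP x y; [apply: ss2; exact: h1|apply: h2 => //; exact: ltW].
  have solJ : sol J u.
    have [[_ s00] _ _ _ fs0] := tsol s0.
    split.
    + split; last by exists s0.
      move=> x y [s As sx] [s' As' s'y] z xzy.
      have [s1 As1 [h1 h2]] := dir s s' As As'; exists s1 => //.
      have [[itv _] _ _ _ _] := tsol s1.
      exact: (itv x y (h1 _ sx) (h2 _ s'y)).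
    + apply/subspace_continuousP => x Jx; have [s As [sx near]] := local x Jx.
      have [_ cs _ _ _] := tsol s.
      have h : fn s y @[y --> within (dom s) (nbhs x)] --> fn s x.
        exact: (subspace_continuousP _ _).1 cs x sx.
      rewrite (uE x s As sx) in h; apply: cvg_within_local h.
      by apply: filterS near => y h' Jy; split; [exact: h'|rewrite (uE y s As (h' Jy))].
    + move=> x [s As sx]; have [_ _ Ds _ _] := tsol s.
      by rewrite -(uE x s As sx); exact: Ds.
    + move=> x Jx; have [s As [sx near]] := local x Jx.
      have [_ _ _ Es _] := tsol s; have [E1 [v dv E2]] := Es x sx.
      rewrite -(uE x s As sx); split=> //; exists v => //.
      rewrite /is_derive_in -(uE x s As sx).
      apply: cvg_within_local dv; apply: nbhs_dnbhs.
      by apply: filterS near => y h' Jy; split; [exact: h'|rewrite (uE y s As (h' Jy))].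
    + by rewrite -(uE 0 s0 As0 s00).
  have extJ : ext J0 u0 J u.
    have [h1 h2] := text s0; split=> x J0x; first by exists s0 => //; exact: h1.
    by rewrite -(uE x s0 As0 (h1 _ J0x)) h2.
  exists (exist _ (J, u) (conj solJ extJ)) => s As; apply/asboolP; split.
    by move=> x sx; exists s.
  by move=> x sx; rewrite /fn/= -(uE x s As sx).
exists (dom t), (fn t); split; [|exact: (text t).1|exact: (text t).2].
split=> [|J' u' sol' JJ' uu']; first exact: tsol.
have ext' : ext J0 u0 J' u'.
  have [h1 h2] := text t; split; first exact: subset_trans JJ'.
  by move=> x J0x; rewrite uu' ?h2//; exact: h1.
pose t' : T := exist _ (J', u') (conj sol' ext').
have /asboolP[J'J _] : rel t' t by apply: tmax; apply/asboolP; split.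
by rewrite eqEsubset; split.
Qed.

End Maximal.

(** * Steady solutions *)

Section OpenInterval.
Context {R : realType}.

Lemma const_open_itv p q (K : R -> 'M[R]_(p, q)) :
  (forall x : R, 0 < x < 1 -> is_derive x 1 K 0) ->
  forall x : R, 0 < x < 1 -> K x = K (1 / 2).
Proof.
move=> dK.
have le (a b : R) : 0 < a -> a <= b -> b < 1 -> K b = K a.
  move=> a0 ab b1; apply/eqP; rewrite -subr_eq0 -normr_le0.
  have dK' x : a <= x <= b -> is_derive x 1 K 0.
    by move=> /andP[ax xb]; apply: dK; rewrite (lt_le_trans a0 ax) (le_lt_trans xb b1).
  suff : `|K b - K a| <= cst 0 b - cst 0 a :> R by rewrite /cst subrr.
  apply: (@norm_ler_derive R p q K (cst 0) (cst 0) (cst 0)) => //.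
  - apply: continuous_in_subspaceT => x; rewrite inE/= in_itv/= => /dK' h.
    exact: is_derive_continuous h.
  - by move=> x; exact: cvg_cst.
  - by move=> x /andP[ax xb]; apply: dK'; rewrite !ltW.
  - by move=> x _; rewrite normr0.
move=> x /andP[x0 x1]; have [xh|hx] := leP x (1 / 2).
  by apply/esym; apply: le => //; lra.
by apply: le => //; lra.
Qed.

Lemma within_continuous_eq_closure (W : normedModType R) (h : R -> W) (k : W) :
  {within `[0, 1], continuous h} -> (forall x : R, 0 < x < 1 -> h x = k) ->
  forall x : R, 0 <= x <= 1 -> h x = k.
Proof.
move=> ch hk t t01; apply/eqP; rewrite -subr_eq0 -normr_le0 leNgt; apply/negP => e0.
have [d d0 hd] := within_continuous_dist ch (t01 : `[0, 1]%classic t) e0.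
pose eta := Num.min 2^-1 d.
have eta0 : 0 < eta by rewrite lt_min invr_gt0 d0 ltr0n.
have eta1 : eta <= 2^-1 by rewrite ge_min lexx.
have etad : eta <= d by rewrite ge_min lexx orbT.
have /andP[t0 t1] := t01.
(* A convex combination of [t] and 1 / 2, hence interior, at distance at most eta / 2 from [t]. *)
pose s := t + (1 / 2 - t) * eta.
have s0 : 0 < s by rewrite /s; nra.
have s1 : s < 1 by rewrite /s; nra.
have sd : `|t - s| < d by rewrite /s ltr_norml; apply/andP; split; nra.
have := hd s; rewrite /= in_itv/= !ltW// => /(_ isT sd).
by rewrite (hk s) ?s0// ltxx.
Qed.

End OpenInterval.

(** * Steady solutions and Cauchy solutions *)

Section Steady.
Context {R : realType} (r m : nat) (D : set 'cV[R]_(r + m))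
  (f : 'cV[R]_(r + m) -> 'cV[R]_(r + m)) (B22 : 'cV[R]_(r + m) -> 'M[R]_m)
  (U0 : 'cV[R]_(r + m)).
Context (hD : open D) (hf : smooth_on D f) (hB : smooth_on D (diffusion B22))
  (hU0 : D U0) (uA : forall U, D U -> ulsubmx (jac f U) \in unitmx)
  (uB : forall U, D U -> B22 U \in unitmx).

Local Notation slope := (slope f B22 U0).
Local Notation rhs := (rhs f B22 U0).

Lemma continuous_slope c U : D U -> {for U, continuous (fun V => slope V c)}.
Proof.
move=> DU; apply/continuous_mxP => i j.
suff : Cdiff 0 D (fun V => slope V c i j) by apply.
apply: Cdiff_mulmx => {}i {}j; first exact: Cdiff_sysinv.
apply: Cdiff_col_mx => {}i {}j; first exact: (Cdiff_cst 0 D ((0 : 'cV[R]_r) i j)).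
have -> : (fun V => rhs V c i j) = (fun V => f V (rshift r i) j +
    (- f U0 (rshift r i) j + (B22 U0 *m c) i j)).
  by apply/funext => V; rewrite addrA !mxE.
apply: CdiffD; [exact: Cdiff_coord (hf 0)|exact: Cdiff_cst].
Qed.

Lemma diffusion_mulmx U (w : 'cV[R]_(r + m)) :
  diffusion B22 U *m w = col_mx 0 (B22 U *m dsubmx w).
Proof.
by rewrite -[in LHS](vsubmxK w) mul_block_col !mul0mx !add0r.
Qed.

Lemma within_comp (W : normedModType R) (h : 'cV[R]_(r + m) -> W) (u : R -> 'cV[R]_(r + m)) :
  {within `[0, 1], continuous u} -> (forall x : R, 0 <= x <= 1 -> D (u x)) ->
  (forall U, D U -> {for U, continuous h}) -> {within `[0, 1], continuous (h \o u)}.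
Proof.
move=> cu Du ch; apply/subspace_continuousP => s s01.
have cus := (subspace_continuousP _ _).1 cu s s01.
apply: (cvg_comp _ _ cus); apply: ch; apply: Du.
by move: s01; rewrite /= in_itv.
Qed.

(* The integration constant of [f(u) - B(u) u'] is recovered at [x = 0], where
   the one-sided derivative is the limit of [u_II'(x)] by the mean value
   inequality. *)
Lemma steady_dae (u : R -> 'cV[R]_(r + m)) U1II v :
  steady_solution D f B22 U0 U1II u ->
  is_derive_in `[0, 1] (fun x => dsubmx (u x)) 0 v ->
  (forall x : R, 0 <= x <= 1 -> D (u x) /\ usubmx (f (u x)) = usubmx (f U0)) /\
  (forall x : R, 0 < x < 1 -> exists2 w, is_derive x 1 (fun y => dsubmx (u y)) w &
     B22 (u x) *m w = rhs (u x) v).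
Proof.
move=> [cu Du ode u0 _] dv.
pose flux x := diffusion B22 (u x) *m derive1 u x.
pose K x := (f \o u) x - flux x.
have dK (x : R) : 0 < x < 1 -> is_derive x 1 K 0.
  move=> x01; have [_ dfu dfl E] := ode x x01.
  have h1 := derivableP dfu; have h2 := derivableP dfl.
  rewrite !derive1E in E; have := is_derive_subl h1 h2.
  by rewrite E subrr.
have K1 := const_open_itv dK; set k := K (1 / 2) in K1.
have Ku (x : R) : 0 < x < 1 -> f (u x) = k + col_mx 0 (B22 (u x) *m dsubmx (derive1 u x)).
  by move=> x01; rewrite -diffusion_mulmx -/(flux x) -(K1 x x01) /K /= subrK.
have cf U : D U -> {for U, continuous f}.
  exact: (hf 0).
have cfu : {within `[0, 1], continuous (fun x => usubmx (f (u x)))}.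
  have ch U : D U -> {for U, continuous (fun U => usubmx (f U))}.
    by move=> DU; exact: (cvg_comp _ _ (cf U DU) (@continuous_usubmx _ _ _ _ (f U))).
  exact: (within_comp cu Du ch).
have fI (x : R) : 0 <= x <= 1 -> usubmx (f (u x)) = usubmx k.
  apply: (within_continuous_eq_closure cfu) => {}x x01.
  by rewrite Ku// linearD/= col_mxKu addr0.
have zero01 : 0 <= (0 : R) <= 1 by rewrite lexx ler01.
have fIE (x : R) : 0 <= x <= 1 -> usubmx (f (u x)) = usubmx (f U0).
  by move=> x01; rewrite fI// -[in RHS]u0 fI.
(* The value of U_II'(0) dictated by the integration constant [k]; it remains to identify it with
   the given one-sided derivative [v]. *)
pose w := invmx (B22 U0) *m (dsubmx (f U0) - dsubmx k).
have uB0 := uB hU0.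
have rhsw U : rhs U w = dsubmx (f U) - dsubmx k.
  by rewrite /rhs mulmxA mulmxV// mul1mx subrKA.
have du (x : R) : 0 < x < 1 -> is_derive x 1 (fun y => dsubmx (u y)) (dsubmx (derive1 u x)).
  move=> x01; have [ud _ _ _] := ode x x01.
  by rewrite derive1E; exact: is_derive_dsubmx (derivableP ud).
have eqn (x : R) : 0 < x < 1 -> B22 (u x) *m dsubmx (derive1 u x) = rhs (u x) w.
  move=> x01; rewrite rhsw Ku// linearD/= col_mxKd.
  by rewrite addrAC subrr add0r.
have slw (x : R) : 0 < x < 1 -> dsubmx (derive1 u x) = dsubmx (slope (u x) w).
  move=> x01; apply: (dsub_slopeP uA uB) (eqn x x01).
  by apply: Du; case/andP: x01 => x0 x1; rewrite !ltW.
have slw0 : dsubmx (slope (u 0) w) = w.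
  apply/esym/(dsub_slopeP uA uB); first exact: Du.
  by rewrite u0 /rhs subrr add0r.
have csl : {within `[0, 1], continuous (fun x => dsubmx (slope (u x) w))}.
  have ch U : D U -> {for U, continuous (fun U => dsubmx (slope U w))}.
    move=> DU; have cs := continuous_slope (c := w) DU.
    exact: (cvg_comp _ _ cs (@continuous_dsubmx _ _ _ _ (slope U w))).
  exact: (within_comp cu Du ch).
have cdu : {within `[0, 1], continuous (fun x => dsubmx (u x))}.
  have ch U : D U -> {for U, continuous (dsubmx : 'cV[R]_(r + m) -> 'cV[R]_m)}.
    by move=> _; exact: continuous_dsubmx.
  exact: (within_comp cu Du ch).
(* The difference quotient at a small [h] is within [e] of [v] by definition, and within [e] of [w]
   by the mean value inequality, since u_II' is close to [w] on (0, h). *)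
have small (e : R) : 0 < e -> `|v - w| <= 2 * e.
  move=> e0; have [d d0 hd] := within_continuous_dist csl (zero01 : `[0, 1]%classic (0 : R)) e0.
  move/cvgrPdist_le : dv => /(_ e e0)/nbhs_ballP[/= d' d'0 hd'].
  pose h := Num.min 2^-1 (Num.min (d / 2) (d' / 2)).
  have h0 : 0 < h by rewrite !lt_min invr_gt0 ltr0n !divr_gt0.
  have h1 : h < 1.
    by apply: (@le_lt_trans _ _ 2^-1); [rewrite ge_min lexx|rewrite invf_lt1// ltr1n].
  have hdd : h < d.
    by apply: (@le_lt_trans _ _ (d / 2)); [rewrite !ge_min lexx orbT|lra].
  have hdd' : h < d'.
    by apply: (@le_lt_trans _ _ (d' / 2)); [rewrite !ge_min lexx !orbT|lra].
  have H1 : `|v - h^-1 *: (dsubmx (u h) - dsubmx (u 0))| <= e.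
    have := hd' h; rewrite /ball/= sub0r normrN gtr0_norm// subr0 => /(_ hdd').
    by rewrite gt_eqF// => /(_ isT); apply; rewrite in_itv/= !ltW.
  have inh (s : R) : 0 < s < h -> 0 < s < 1.
    by move=> /andP[-> sh]; exact: lt_trans h1.
  have dlin (s : R) : is_derive s 1 (fun t => t *: w) w.
    apply/is_derive_mxP => i j.
    under [X in is_derive _ _ X _]eq_fun do rewrite mxE mulrC.
    rewrite -[X in is_derive _ _ _ X]mulr1.
    exact: (is_derive_cmull (w i j) (is_derive_id s 1)).
  have H2 : `|(dsubmx (u h) - h *: w) - (dsubmx (u 0) - 0 *: w)| <= e * h - e * 0.
    apply: (@norm_ler_derive R m 1 (fun t => dsubmx (u t) - t *: w)
      (fun t => dsubmx (derive1 u t) - w) (fun t => e * t) (cst e)) => [|||s sh|s sh|s sh].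
    - exact: ltW.
    - apply: within_continuousB.
        apply: continuous_subspaceW cdu => s; rewrite /= !in_itv/= => /andP[-> sh].
        by rewrite (le_trans sh)// ltW.
      by apply: continuous_subspaceT => s; exact: is_derive_continuous (dlin s).
    - by apply: continuous_subspaceT => s; apply: cvgM; [exact: cvg_cst|exact: cvg_id].
    - exact: (is_derive_subl (du s (inh s sh)) (dlin s)).
    - rewrite /cst -[X in is_derive _ _ _ X]mulr1.
      exact: (is_derive_cmull e (is_derive_id s 1)).
    - rewrite slw; last exact: inh.
      rewrite -[X in _ - X]slw0 distrC; apply: ltW; apply: hd.
        by case/andP: (inh s sh) => s0 s1; rewrite /= in_itv/= !ltW.
      by case/andP: sh => s0 sh; rewrite sub0r normrN gtr0_norm// (lt_trans sh).
  rewrite scale0r subr0 mulr0 subr0 addrAC in H2.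
  have H3 : `|h^-1 *: (dsubmx (u h) - dsubmx (u 0)) - w| <= e.
    have -> : h^-1 *: (dsubmx (u h) - dsubmx (u 0)) - w =
        h^-1 *: (dsubmx (u h) - dsubmx (u 0) - h *: w).
      by rewrite [RHS]scalerBr scalerA mulVf ?gt_eqF// scale1r.
    rewrite normrZ gtr0_norm ?invr_gt0// mulrC ler_pdivrMr//.
  rewrite -(subrKA (h^-1 *: (dsubmx (u h) - dsubmx (u 0)))).
  apply: le_trans (ler_normD _ _) _.
  by have := lerD H1 H3; rewrite mulr2n mulrDl !mul1r.
have vw : v = w.
  apply/eqP; rewrite -subr_eq0 -normr_le0.
  apply: (@le0_geometric R _ 2) => k'; apply: small.
  by rewrite exprn_gt0// invr_gt0.
split=> [x x01|x x01]; first by split; [exact: Du|exact: fIE].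
by exists (dsubmx (derive1 u x)); [exact: du|rewrite vw; exact: eqn].
Qed.

Lemma flow_steady (u : R -> 'cV[R]_(r + m)) c : u 0 = U0 ->
  (forall x : R, 0 <= x <= 1 -> D (u x)) ->
  (forall x : R, 0 <= x <= 1 -> is_derive x 1 u (slope (u x) c)) ->
  steady_solution D f B22 U0 (dsubmx (u 1)) u.
Proof.
move=> u0 Du du.
have fI := first_integral hf uA uB u0 Du du.
split=> //.
- apply: continuous_in_subspaceT => x; rewrite inE/= in_itv/= => x01.
  exact: is_derive_continuous (du x x01).
- move=> x x01.
  have x01' : 0 <= x <= 1 by case/andP: x01 => x0 x1; rewrite !ltW.
  have dux := du x x01'.
  have dfu := jac_comp dux (smooth_differentiable hf (Du x x01')).
  (* In the open interval the viscous flux equals f(u) - k, so it inherits the derivative of f(u)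
     without differentiating [u] twice. *)
  pose k := col_mx (usubmx (f U0)) (dsubmx (f U0) - B22 U0 *m c).
  have E (y : R) : 0 < y < 1 ->
      f (u y) - k = diffusion B22 (u y) *m derive1 u y.
    move=> y01; have y01' : 0 <= y <= 1 by case/andP: y01 => y0 y1; rewrite !ltW.
    have duy := du y y01'.
    have [_ slE] := slope_eq U0 uA uB c (Du y y01').
    rewrite derive1E (@derive_val _ _ _ _ _ _ _ duy) diffusion_mulmx slE.
    rewrite -[f (u y)]vsubmxK /k opp_col_mx add_col_mx fI// subrr.
    by rewrite /rhs opprB addrA [in RHS]addrAC addrAC.
  have near : \forall y \near x, f (u y) - k = diffusion B22 (u y) *m derive1 u y.
    case/andP: x01 => x0 x1; have n0 := lt_nbhsr x0; have n1 := lt_nbhsl x1.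
    by apply: filterS2 n0 n1 => y y0 y1; apply: E; rewrite y0.
  have dk := is_derive_subl dfu (is_derive_cst k x 1); rewrite subr0 in dk.
  have dfl := near_eq_is_derive near dk.
  split.
  + exact: (@ex_derive _ _ _ _ _ _ _ dux).
  + exact: (@ex_derive _ _ _ _ _ _ _ dfu).
  + exact: (@ex_derive _ _ _ _ _ _ _ dfl).
  + by rewrite !derive1E (@derive_val _ _ _ _ _ _ _ dfu) (@derive_val _ _ _ _ _ _ _ dfl).
Qed.

Lemma flow_cauchy (u : R -> 'cV[R]_(r + m)) c : u 0 = U0 ->
  (forall x : R, 0 <= x <= 1 -> D (u x)) ->
  (forall x : R, 0 <= x <= 1 -> is_derive x 1 u (slope (u x) c)) ->
  cauchy_solution D f B22 U0 c `[0, 1] u.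
Proof.
move=> u0 Du du; have fI := first_integral hf uA uB u0 Du du.
split=> //.
- split; first exact: interval_is_interval.
  by rewrite /= in_itv/= lexx ler01.
- apply: continuous_in_subspaceT => x; rewrite inE/= in_itv/= => x01.
  exact: is_derive_continuous (du x x01).
- move=> x; rewrite /= in_itv/= => x01; split; first exact: fI.
  exists (dsubmx (slope (u x) c)).
    by apply: is_derive_is_derive_in; exact: is_derive_dsubmx (du x x01).
  by have [_ ->] := slope_eq U0 uA uB c (Du x x01).
Qed.

(** Brings a Cauchy solution into the form compared by [dae_unique]: at interior points of [0, 1]
    the derivative within [J] is an ordinary one. *)
Lemma cauchy_dae (u : R -> 'cV[R]_(r + m)) c J :
  cauchy_solution D f B22 U0 c J u -> `[0, 1] `<=` J ->
  [/\ u 0 = U0, {within `[0, 1], continuous u},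
   (forall x : R, 0 <= x <= 1 -> D (u x) /\ usubmx (f (u x)) = usubmx (f U0)) &
   (forall x : R, 0 < x < 1 -> exists2 w, is_derive x 1 (fun y => dsubmx (u y)) w &
      B22 (u x) *m w = rhs (u x) c)].
Proof.
move=> [_ cu Du E u0] J01.
have inJ (x : R) : 0 <= x <= 1 -> J x by move=> x01; apply: J01; rewrite /= in_itv.
split=> //.
- exact: continuous_subspaceW cu.
- by move=> x /inJ Jx; split; [exact: Du|have [] := E x Jx].
- move=> x x01; have Jx : J x.
    by apply: inJ; case/andP: x01 => x0 x1; rewrite !ltW.
  have [_ [w dw wE]] := E x Jx; exists w => //.
  apply: is_derive_in_is_derive dw.
  case/andP: x01 => x0 x1; have n0 := lt_nbhsr x0; have n1 := lt_nbhsl x1.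
  by apply: filterS2 n0 n1 => y y0 y1; apply: inJ; rewrite !ltW.
Qed.

End Steady.

(** * Contraction in [C2] and nondegeneracy of the root *)

Theorem proposition2p2 (R : realType) (r m : nat)
    (D : set 'cV[R]_(r + m)) (hD : open D)
    (f0 f : 'cV[R]_(r + m) -> 'cV[R]_(r + m))
    (B22 : 'cV[R]_(r + m) -> 'M[R]_m)
    (hA0 : forall U, D U ->
       [/\ ulsubmx (jac f0 U) = 1%:M, ursubmx (jac f0 U) = 0,
           jac f0 U \in unitmx & 0 < \det (drsubmx (jac f0 U))])
    (hf0 : smooth_on D f0) (hf : smooth_on D f)
    (hB : smooth_on D (diffusion B22))
    (hb : forall U, D U ->
       let S := invmx (drsubmx (jac f0 U)) *m B22 U in
       forall z : R[i], spectrum (S + S^T) z -> 0 < z)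
    (hc : forall U, D U ->
       forall z : R[i], spectrum (ulsubmx (jac f U)) z -> 0 < z)
    (U0 : 'cV[R]_(r + m)) (hU0 : D U0)
    (hspec : let A := jac f U0 in
       spectrum (invmx (B22 U0) *m
         (drsubmx A - dlsubmx A *m invmx (ulsubmx A) *m ursubmx A))
       `&` [set Complex 0 (2 * pi * k%:~R) | k in [set k : int | k != 0]]
       = set0) :
  exists delta eps : R, [/\ 0 < delta, 0 < eps &
    forall U1II : 'cV[R]_m, enorm (dsubmx U0 - U1II) <= delta ->
      let solves (u : R -> 'cV[R]_(r + m)) :=
        steady_solution D f B22 U0 U1II u /\
        exists2 v : 'cV[R]_m,
          is_derive_in `[0, 1] (fun x => dsubmx (u x)) 0 v &
          enorm v <= eps in
      exists uhat : R -> 'cV[R]_(r + m),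
        [/\ solves uhat,
            forall u, solves u -> forall x : R, 0 <= x <= 1 -> u x = uhat x &
            nondegenerate_solution D f B22 U0 U1II uhat]].
Proof.
have uA U : D U -> ulsubmx (jac f U) \in unitmx.
  by move=> DU; apply: spectrum0_unitmx => /(hc U DU); rewrite ltxx.
have uB U : D U -> B22 U \in unitmx.
  by move=> DU; have := posdef_unitmx (hb U DU); rewrite unitmx_mul => /andP[].
have nores (k : int) : k != 0 -> ~ spectrum (invmx (B22 U0) *m
     (drsubmx (jac f U0) - dlsubmx (jac f U0) *m invmx (ulsubmx (jac f U0)) *m
        ursubmx (jac f U0))) (Complex 0 (2 * pi * k%:~R)).
  move=> k0 sk; have : (set0 : set R[i]) (Complex 0 (2 * pi * k%:~R)); last by [].
  by rewrite -hspec; split => //; exists k.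
have [rho1 [rho0 [L [C1 [C [u [Phi [[rho10 rho00 L0 C10 C0]
  inD slip htr [uP est uPhi0]]]]]]]]] := dae_flow hD hf hB hU0 uA uB nores.
have zero01 : 0 <= (0 : R) <= 1 by rewrite lexx ler01.
have one01 : 0 <= (1 : R) <= 1 by rewrite lexx ler01.
have Du c (x : R) : `|c| <= rho0 -> 0 <= x <= 1 -> D (u c x).
  move=> cr x01; have [_ /(_ x x01)[h _]] := uP c cr; apply: inD.
  by apply: le_trans h _; lra.
have uc0 c : `|c| <= rho0 -> u c 0 = U0 by move=> /uP[].
have du c (x : R) : `|c| <= rho0 -> 0 <= x <= 1 ->
    is_derive x 1 (u c) (slope f B22 U0 (u c x) c).
  by move=> cr x01; have [_ /(_ x x01)[]] := uP c cr.
have uniq c (v : R -> 'cV[R]_(r + m)) : `|c| <= rho0 -> v 0 = U0 -> {within `[0, 1], continuous v} ->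
    (forall x : R, 0 <= x <= 1 -> D (v x) /\ usubmx (f (v x)) = usubmx (f U0)) ->
    (forall x : R, 0 < x < 1 -> exists2 w, is_derive x 1 (fun y => dsubmx (v y)) w &
       B22 (v x) *m w = rhs f B22 U0 (v x) c) ->
    forall x : R, 0 <= x <= 1 -> v x = u c x.
  move=> cr v0 cv vP dv.
  apply: (dae_unique hf uA uB rho10 L0 C10 _ htr (uc0 c cr) _ _ v0 cv vP dv).
  - by move=> U V hU hV; exact: slip.
  - by move=> x x01; split; [have [_ /(_ x x01)[]] := uP c cr|exact: Du].
  - by move=> x x01; exact: du.
pose g c := dsubmx (u c 1).
(* The constant [U0] solves the problem for c = 0, so uniqueness identifies it with [u 0]. *)
have g0 : g 0 = dsubmx U0.
  have r0 : `|0 : 'cV[R]_m| <= rho0 by rewrite normr0 ltW.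
  rewrite /g -(uniq 0 (cst U0) r0) // => [|x].
    by move=> x; exact: cvg_cst.
  move=> _; exists 0; first exact: (is_derive_cst (dsubmx U0) x 1).
  by rewrite mulmx0 rhs0.
pose kap : R := m%:R * `|invmx (Phi 0)|.
have kap0 : 0 <= kap by rewrite mulr_ge0.
have invle (h : 'cV[R]_m) : `|invmx (Phi 0) *m h| <= kap * `|h| by exact: norm_mulmx_le.
(* The bound rho0 / 2 leaves room for a second increment of size [e1]. The factor 8 gives 8 kap C e1
   <= 1, enough for the ratio one half of the contraction and for the final contradiction. *)
pose e1 : R := Num.min (rho0 / 2) (8 * (kap * C + 1))^-1.
have kC0 : 0 <= kap * C by rewrite mulr_ge0// ltW.
have e10 : 0 < e1.
  by rewrite lt_min divr_gt0//= invr_gt0 mulr_gt0// ltr_wpDl.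
have e1rho : e1 <= rho0 / 2 by rewrite ge_min lexx.
have e1C : 8 * (kap * C) * e1 <= 1.
  apply: (@le_trans _ _ (8 * (kap * C + 1) * e1)).
    by rewrite ler_pM2r// ler_pM2l// lerDl.
  rewrite mulrC -ler_pdivlMr ?mul1r; last by rewrite mulr_gt0// ltr_wpDl.
  by rewrite ge_min lexx orbT.
have z0 : `|0 : 'cV[R]_m| <= rho0 by rewrite normr0 ltW.
have b1 (c : 'cV[R]_m) : `|c| <= e1 -> `|c| <= rho0 by move=> h; apply: le_trans h _; lra.
have est0 c1 c2 : `|c1| <= rho0 -> `|c2| <= rho0 ->
    `|g c1 - g c2 - Phi 0 *m (c1 - c2)| <= C * (`|c1| + `|c2|) * `|c1 - c2|.
  by move=> h1 h2; have := est 0 c1 c2 z0 h1 h2; rewrite !subr0.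
(* Newton's map with the derivative frozen at 0; its fixed points are the solutions of g c = W. *)
pose T (W c : 'cV[R]_m) := c - invmx (Phi 0) *m (g c - W).
have TL W c1 c2 : `|c1| <= e1 -> `|c2| <= e1 -> `|T W c1 - T W c2| <= 2^-1 * `|c1 - c2|.
  move=> h1 h2.
  have -> : T W c1 - T W c2 = - (invmx (Phi 0) *m (g c1 - g c2 - Phi 0 *m (c1 - c2))).
    rewrite /T [in RHS]mulmxBr mulKmx// opprB !mulmxBr.
    by apply/matrixP => i j; rewrite !mxE; ring.
  rewrite normrN; apply: le_trans (invle _) _.
  have h := est0 _ _ (b1 _ h1) (b1 _ h2).
  apply: (@le_trans _ _ (kap * (C * (e1 + e1) * `|c1 - c2|))).
    apply: ler_wpM2l => //; apply: le_trans h _; rewrite ler_wpM2r//.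
    by rewrite ler_pM2l// lerD.
  rewrite [leLHS](_ : _ = (2 * (kap * C) * e1) * `|c1 - c2|); last by ring.
  by rewrite ler_wpM2r//; lra.
have Tfix W c : T W c = c <-> g c = W.
  split=> [Tc|<-]; last by rewrite /T subrr mulmx0 subr0.
  have : invmx (Phi 0) *m (g c - W) = 0.
    have -> : invmx (Phi 0) *m (g c - W) = c - T W c by rewrite /T subKr.
    by rewrite Tc subrr.
  move=> /(congr1 (mulmx (Phi 0))); rewrite mulKVmx// mulmx0 => /eqP.
  by rewrite subr_eq0 => /eqP.
have m1 : 0 < m%:R + 1 :> R by rewrite ltr_wpDl.
(* The root is sought in this smaller sup-norm ball so that its Euclidean norm is at most [e1];
   uniqueness holds in the whole sup-norm ball of radius [e1]. *)
pose e2 := e1 / (m%:R + 1).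
have e20 : 0 < e2 by rewrite divr_gt0.
have e21 : e2 <= e1.
  by rewrite ler_pdivrMr// ler_peMr ?lerDr//; exact: ltW.
(* This choice gives |T W 0| <= e2 / 2, so the contraction maps the ball of radius [e2] into
   itself. *)
pose delta := e2 / (2 * (kap + 1)).
have kap1 : 0 < 2 * (kap + 1) by rewrite mulr_gt0// ltr_wpDl.
exists delta, e1; split=> //; first by rewrite divr_gt0.
move=> W hW solves.
have hW' : kap * `|dsubmx U0 - W| <= e2 / 2.
  have := le_trans (norm_le_enorm _) hW; rewrite /delta ler_pdivlMr//.
  by have : 0 <= `|dsubmx U0 - W| by []; nra.
have [c ce Tc] : exists2 c, `|c| <= e2 & T W c = c.
  apply: contraction_fixpoint; first exact: ltW.
    move=> c ce; have ce1 := le_trans ce e21.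
    have h0 : `|0 : 'cV[R]_m| <= e1 by rewrite normr0 ltW.
    have h1 := TL W c 0 ce1 h0; rewrite subr0 in h1.
    have h2 : `|T W 0| <= e2 / 2.
      rewrite /T sub0r normrN g0; exact: le_trans (invle _) hW'.
    rewrite -(subrK (T W 0) (T W c)); apply: le_trans (ler_normD _ _) _.
    by lra.
  by move=> c1 c2 h1 h2; apply: TL; exact: le_trans e21.
have gc : g c = W by apply/Tfix.
have ce1 : `|c| <= e1 by exact: le_trans e21.
have cr := b1 c ce1.
have dIn c' : `|c'| <= rho0 -> is_derive_in `[0, 1] (fun x => dsubmx (u c' x)) 0 c'.
  move=> cr'; have := is_derive_dsubmx (du c' 0 cr' zero01).
  rewrite (uc0 c' cr') -(@dsub_slopeP _ _ _ D f B22 U0 uA uB U0 c' c')//.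
    exact: is_derive_is_derive_in.
  by rewrite /rhs subrr add0r.
have cauchyu c' : `|c'| <= rho0 -> cauchy_solution D f B22 U0 c' `[0, 1] (u c').
  move=> cr'; apply: (flow_cauchy hf uA uB (uc0 c' cr')).
    by move=> x; exact: Du.
  by move=> x; exact: du.
have maxu c' : `|c'| <= rho0 -> exists (J : set R) (v : R -> 'cV[R]_(r + m)),
    [/\ maximal_solution D f B22 U0 c' J v, `[0, 1] `<=` J &
        forall x : R, 0 <= x <= 1 -> v x = u c' x].
  move=> cr'; have [J [v [h1 h2 h3]]] := maximal_extension (cauchyu c' cr').
  by exists J, v; split=> // x x01; apply: h3; rewrite /= in_itv.
(* The set under [get] is inhabited by a maximal extension of the flow, and every maximal solution
   in it takes the value of the flow at 1. *)
have PsiE c' : `|c'| <= rho0 -> Psi D f B22 U0 W c' = g c' - W.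
  move=> cr'; rewrite /Psi; set S := [set w | _].
  have [J [v [vmax v01 vu]]] := maxu c' cr'.
  have : S (get S).
    apply: getPex; exists (dsubmx (v 1) - W); exists J, v; split=> //.
  case=> J' [v' [[v'sol _] v'01 ->]].
  have [v'0 cv' v'P dv'] := cauchy_dae v'sol v'01.
  by rewrite (uniq c' v' cr' v'0 cv' v'P dv' 1 one01).
exists (u c); split.
- split.
    rewrite -gc; apply: (flow_steady hf uA uB (uc0 c cr)).
      by move=> x; exact: Du.
    by move=> x; exact: du.
  exists c; first exact: dIn.
  apply: le_trans (enorm_le_norm _) _.
  by move: ce; rewrite /e2 ler_pdivlMr// mulrC.
- move=> w [wst [v dv ve]].
  have ve1 : `|v| <= e1 by exact: le_trans (norm_le_enorm _) ve.
  have [cw _ _ w0 w1] := wst.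
  have [wP dw] := steady_dae hf hB hU0 uA uB wst dv.
  have wu := uniq v w (b1 v ve1) w0 cw wP dw.
  have gv : g v = W by rewrite /g -wu.
  have Tv : T W v = v by apply/Tfix.
  have := TL W v c ve1 ce1; rewrite Tv Tc => vc.
  have -> : c = v; last exact: wu.
  apply/esym/eqP; rewrite -subr_eq0 -normr_le0.
  by have := normr_ge0 (v - c); lra.
exists c; split; [exact: dIn|exact: maxu| |by rewrite PsiE// gc subrr|].
  have cr1 : 0 < rho0 - `|c| by rewrite subr_gt0 (le_lt_trans ce1)//; lra.
  apply/nbhs_ballP; exists (rho0 - `|c|) => // c'; rewrite -ball_normE/= => cc'.
  have cr' : `|c'| <= rho0.
    rewrite -(subrK c c'); apply: le_trans (ler_normD _ _) _.
    by rewrite distrC in cc'; lra.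
  by have [J [v [h1 h2 _]]] := maxu c' cr'; exists J, v.
have cr1 : 0 < rho0 - `|c| by rewrite subr_gt0 (le_lt_trans ce1)//; lra.
have [|dPsi jPsi] := @differentiable_expansion R m m (Psi D f B22 U0 W) (Phi c) c
    (rho0 - `|c|) C cr1 (ltW C0).
  move=> h hr; have chr : `|c + h| <= rho0.
    by apply: le_trans (ler_normD _ _) _; lra.
  rewrite !PsiE// opprB addrA subrK.
  have Eh : c + h - c = h by rewrite addrC addKr.
  by have := est c (c + h) c cr chr cr; rewrite Eh subrr normr0 addr0 expr2 mulrA.
split=> //; rewrite jPsi; apply: contrapT => /negP; rewrite -unitmx_tr.
move=> /nonunit_kernel[v vPhi v0].
have Phiv : Phi c *m v^T = 0.
  by apply: trmx_inj; rewrite trmx_mul trmxK vPhi trmx0.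
have nv : 0 < `|v^T| by rewrite normr_gt0 trmx_eq0.
(* A kernel vector of [Phi c] scaled to norm [e1]. Based at [c], the expansion makes g(c + h) - g(c)
   quadratic in [e1]; based at 0, it then makes Phi(0) h quadratic too, and inverting Phi(0) yields
   e1 <= 4 kap C e1^2 <= e1 / 2. *)
pose h := (e1 / `|v^T|) *: v^T.
have nh : `|h| = e1.
  by rewrite normrZ gtr0_norm ?divr_gt0// divfK// gt_eqF.
have chr : `|c + h| <= e1 + e1.
  by apply: le_trans (ler_normD _ _) _; rewrite nh lerD2r.
have chr0 : `|c + h| <= rho0 by lra.
have Eh : c + h - c = h by rewrite addrC addKr.
have s1 : `|g (c + h) - g c| <= C * e1 * e1.
  have := est c (c + h) c cr chr0 cr.
  by rewrite Eh /h -scalemxAr Phiv scaler0 subr0 -/h subrr normr0 addr0 nh.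
have s2 : `|g (c + h) - g c - Phi 0 *m h| <= C * (3 * e1) * e1.
  have := est0 (c + h) c chr0 cr; rewrite Eh nh => /le_trans; apply.
  by rewrite ler_pM2r// ler_pM2l//; lra.
have s3 : `|Phi 0 *m h| <= 4 * C * e1 * e1.
  have -> : Phi 0 *m h = (g (c + h) - g c) - (g (c + h) - g c - Phi 0 *m h).
    by rewrite opprB addrC subrK.
  by apply: le_trans (ler_normB _ _) _; lra.
have := invle (Phi 0 *m h); rewrite mulKmx// nh.
have : kap * `|Phi 0 *m h| <= kap * (4 * C * e1 * e1) by rewrite ler_wpM2l.
have : (8 * (kap * C) * e1) * e1 <= 1 * e1 by rewrite ler_pM2r.
by lra.
Qed.
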